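(* Suppose that $\mathcal{D}(M_wEM_u)=\{f\in L^2(\Sigma): wE(uf)\in L^2(\Sigma)\}$ is dense in $L^2(\Sigma)$. Let $M_wEM_u=U|M_wEM_u|$ be the polar decomposition of $M_wEM_u$. Let $S=S(E(|u|^2))$ and $G=S(E(|w|^2))$. Then: (i) $|M_wEM_u|=M_{u'}EM_u$, where $u'=\left(\dfrac{E(|w|^2)}{E(|u|^2)}\right)^{1/2}\chi_S\,\bar u$; (ii) $U=M_{w'}EM_u$, where $w':\Omega\to\mathbb{C}$ is the a.e. $\mu$ well-defined $\Sigma$-measurable function $$w'=\frac{w}{(E(|w|^2)E(|u|^2))^{1/2}}\,\chi_{S\cap G}.$$
   Context: $(\Omega,\Sigma,\mu)$ is a $\sigma$-finite measure space and $\mathcal{A}\subseteq\Sigma$ is a $\sigma$-subalgebra such that $(\Omega,\mathcal{A},\mu)$ is also $\sigma$-finite. $L^2(\Sigma)=L^2(\mu)=L^2(\Omega,\Sigma,\mu)$ (complex-valued functions). Comparisons between functions or sets hold up to $\mu$-null sets; $S(f)=\{t\in\Omega: f(t)\ne0\}$ is the support of $f$. $E=E^{\mathcal{A}}$ is the conditional expectation with respect to $\mathcal{A}$: for $f\ge0$ $\Sigma$-measurable (then $E(f)$ may take values in $[0,\infty]$) or $f\in L^2(\Sigma)$, $E(f)$ is the unique $\mathcal{A}$-measurable function with $\int_A f\,d\mu=\int_A E(f)\,d\mu$ for all $A\in\mathcal{A}$ for which the integrals exist. For a general complex-valued $\Sigma$-measurable $f$, $E(f)$ is understood to be defined when $E(|f|)<\infty$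 a.e. (by linearity from nonnegative functions). The functions $u,w:\Omega\to\mathbb{C}$ are $\Sigma$-measurable and conditionable, i.e. $E(u)$ and $E(w)$ are defined. For measurable functions $a,b$, the operator $M_aEM_b$ in $L^2(\Sigma)$ is $f\mapsto aE(bf)$ with domain $\{f\in L^2(\Sigma): aE(bf)\in L^2(\Sigma)\}$ (which includes the requirement that $E(bf)$ is defined). For a densely defined closed operator $T$, the polar decomposition is $T=U_T|T|$ where $|T|=(T^*T)^{1/2}$ and $U_T$ is the partial isometry with initial space $\mathcal{N}(T)^\perp=\overline{\mathcal{R}(|T|)}$ and final space $\overline{\mathcal{R}(T)}$.
   Formalization: The operator M_wEM_u is taken to be closed as well as densely defined, since density of the domain alone does not make it closed (e.g. trivial 𝒜, w=1, u in L¹ but not L²), and then it has no polar decomposition. *)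

(* Defs.v *)
From HB Require Import structures.
From mathcomp Require Import all_boot all_order all_algebra.
From mathcomp Require Export complex.
From mathcomp Require Import all_classical all_reals all_analysis.
From mathcomp Require Import measurable_realfun.

Set Implicit Arguments.
Unset Strict Implicit.
Unset Printing Implicit Defensive.

Import Order.TTheory GRing.Theory Num.Theory.
Import numFieldNormedType.Exports.

Local Open Scope classical_set_scope.
Local Open Scope ring_scope.
Local Open Scope complex_scope.

Section L2.
Context {d : measure_display} {X : measurableType d} {R : realType}.
Variable mu : {measure set X -> \bar R}.
Implicit Types (f g : X -> R[i]) (V : set (X -> R[i])).

Definition cmeasurable f : Prop :=
  measurable_fun setT (fun x => complex.Re (f x)) /\
  measurable_fun setT (fun x => complex.Im (f x)).

Definition cmod f : X -> R := fun x => Normc.normc (f x).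

(* Elements of L^2 are represented by functions; classes are taken up to
   almost-everywhere equality by requiring every operator below to be
   invariant under it (see linear_operator). *)
Definition L2 : set (X -> R[i]) :=
  [set f | cmeasurable f /\ (\int[mu]_x ((cmod f x) ^+ 2)%:E < +oo)%E].

Definition cintegral f : R[i] :=
  (\int[mu]_x complex.Re (f x)) +i* (\int[mu]_x complex.Im (f x)).

Definition dot f g : R[i] := cintegral (fun x => f x * (g x)^*).

Definition l2norm f : R := Num.sqrt (\int[mu]_x (cmod f x) ^+ 2).

Definition l2dist f g : R := l2norm (fun x => f x - g x).

Definition l2closure V : set (X -> R[i]) :=
  [set f | L2 f /\ forall e : R, 0 < e -> exists2 g, V g & l2dist f g < e].

Definition l2dense V : Prop := L2 `<=` l2closure V.

Definition orthogonal_complement V : set (X -> R[i]) :=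
  [set g | L2 g /\ forall f, V f -> dot f g = 0].

(* An unbounded operator is given by its graph: T (f, g) means that f belongs
   to the domain of T and that g represents T f. *)
Definition graph := set ((X -> R[i]) * (X -> R[i])).
Implicit Types (T U A B : graph).

Definition linear_operator T : Prop :=
  [/\ (forall f g, T (f, g) -> L2 f /\ L2 g),
      (forall f g f' g', T (f, g) -> L2 f' -> L2 g' ->
         f = f' %[ae mu] -> g = g' %[ae mu] -> T (f', g')),
      (forall f g g', T (f, g) -> T (f, g') -> g = g' %[ae mu]),
      T (cst 0, cst 0) &
      (forall (c : R[i]) f g f' g', T (f, g) -> T (f', g') ->
         T (fun x => c * f x + f' x, fun x => c * g x + g' x))].

Definition domain T : set (X -> R[i]) := [set f | exists g, T (f, g)].

Definition range_of T : set (X -> R[i]) := [set g | exists f, T (f, g)].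

Definition null_space T : set (X -> R[i]) := [set f | T (f, cst 0)].

Definition op_comp B A : graph := [set p | exists2 g, A (p.1, g) & B (g, p.2)].

Definition closed_operator T : Prop :=
  forall (fs gs : nat -> X -> R[i]) f g,
    (forall n, T (fs n, gs n)) -> L2 f -> L2 g ->
    l2dist (fs n) f @[n --> \oo] --> (0 : R) ->
    l2dist (gs n) g @[n --> \oo] --> (0 : R) ->
    T (f, g).

Definition adjoint T : graph :=
  [set p | [/\ L2 p.1, L2 p.2 &
               forall f g, T (f, g) -> dot g p.1 = dot f p.2]].

Definition selfadjoint A : Prop := l2dense (domain A) /\ adjoint A = A.

Definition positive_operator A : Prop := forall f g, A (f, g) -> 0 <= dot g f.

(* B = A^{1/2}: for positive self-adjoint A the positive self-adjoint square
   root exists and is unique, so this determines B. *)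
Definition is_sqrt_operator A B : Prop :=
  [/\ linear_operator B, selfadjoint B, positive_operator B &
      op_comp B B = A].

(* absT = |T| = (T^* T)^{1/2} *)
Definition is_modulus T absT : Prop :=
  is_sqrt_operator (op_comp (adjoint T) T) absT.

Definition initial_space U := orthogonal_complement (null_space U).

Definition bounded_operator U : Prop :=
  [/\ linear_operator U, domain U = L2 &
      exists c : R, forall f g, U (f, g) -> l2norm g <= c * l2norm f].

Definition partial_isometry U : Prop :=
  bounded_operator U /\
  forall f g, initial_space U f -> U (f, g) -> l2norm g = l2norm f.

(* The final space of a partial isometry is its range. *)
Definition polar_decomposition T U absT : Prop :=
  [/\ linear_operator T /\ l2dense (domain T), closed_operator T,
      is_modulus T absT,
      [/\ partial_isometry U,
          initial_space U = orthogonal_complement (null_space T) &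
          range_of U = l2closure (range_of T)] &
      T = op_comp U absT].

End L2.

Section ConditionalExpectation.
Context {d : measure_display} {X : measurableType d} {R : realType}.
Variables (mu : {measure set X -> \bar R}) (A : set (set X)).

(* A is a sigma-subalgebra on which mu is sigma-finite. As A is itself a
   sigma-algebra, the measurable sets of g_sigma_algebraType A are exactly the
   members of A. *)
Definition sigma_finite_subalgebra : Prop :=
  [/\ sigma_algebra setT A,
      A `<=` measurable &
      @sigma_finite _ (g_sigma_algebraType A) R setT mu].

Definition is_cond_exp (f g : X -> \bar R) : Prop :=
  [/\ measurable_fun [set: g_sigma_algebraType A] g,
      (forall x, (0 <= g x)%E) &
      forall B, A B -> (\int[mu]_(x in B) f x = \int[mu]_(x in B) g x)%E].

(* For nonnegative measurable f: a version of the conditional expectation,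
   which exists and is a.e. unique when A is a sigma_finite_subalgebra. *)
Definition cond_exp (f : X -> \bar R) : X -> \bar R :=
  xget (cst 0%E) [set g | is_cond_exp f g].

(* E(f) is defined *)
Definition conditionable (f : X -> R[i]) : Prop :=
  cmeasurable f /\ {ae mu, forall x, (cond_exp (EFin \o cmod f) x < +oo)%E}.

Definition cond_expR (f : X -> R) : X -> R := fun x =>
  fine (cond_exp (EFin \o f^\+) x) - fine (cond_exp (EFin \o f^\-) x).

(* meaningful for conditionable f *)
Definition cond_expC (f : X -> R[i]) : X -> R[i] := fun x =>
  cond_expR (fun y => complex.Re (f y)) x +i*
  cond_expR (fun y => complex.Im (f y)) x.

(* the operator M_a E M_b, f |-> a E(b f), with its maximal domain *)
Definition MEM (a b : X -> R[i]) : graph :=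
  [set p | [/\ L2 mu p.1, conditionable (fun x => b x * p.1 x), L2 mu p.2 &
      p.2 = (fun x => a x * cond_expC (fun y => b y * p.1 y) x) %[ae mu]]].

(* E(|f|^2) *)
Definition cond_exp_sq (f : X -> R[i]) : X -> \bar R :=
  cond_exp (fun x => ((cmod f x) ^+ 2)%:E).

Definition esupport (f : X -> \bar R) : set X := [set x | f x != 0%E].

(* (E(|w|^2) / E(|u|^2))^{1/2} chi_S conj(u), with S = S(E(|u|^2)) *)
Definition modulus_weight (w u : X -> R[i]) : X -> R[i] := fun x =>
  (Num.sqrt (fine (cond_exp_sq w x / cond_exp_sq u x)%E))%:C *
  (\1_(esupport (cond_exp_sq u)) x)%:C * (u x)^*.

(* w / (E(|w|^2) E(|u|^2))^{1/2} chi_(S `&` G), with G = S(E(|w|^2)) *)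
Definition isometry_weight (w u : X -> R[i]) : X -> R[i] := fun x =>
  w x / (Num.sqrt (fine (cond_exp_sq w x * cond_exp_sq u x)%E))%:C *
  (\1_(esupport (cond_exp_sq u) `&` esupport (cond_exp_sq w)) x)%:C.

End ConditionalExpectation.

(* Main.v *)
Require Import Defs.
From HB Require Import structures.
From mathcomp Require Import all_boot all_order all_algebra.
From mathcomp Require Import all_classical all_reals all_analysis.
From mathcomp Require Import measurable_realfun.
From mathcomp Require Import lra ring.

(** Write [p = E |u|^2], [q = E |w|^2] and [v = E (u f)], and let [T] be the operator
    [f |-> w E (u f)].

    The theorem is an algebraic identity once enough is known to compute with such
    operators. Composing two of them multiplies [v] by a factor measurable for the
    subalgebra ([MEM_compP]), and as soon as both weights have finite conditional second
    moments the adjoint of [f |-> a E (b f)] is [g |-> conj b E (conj a g)]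
    ([MEM_adjoint]). Hence [T^* T] sends [f] to [conj u q v]; the operator [C] with weight
    [k conj u], [k = (q / p)^(1/2)], is self-adjoint and positive and has the same square
    ([abs_op_comp]); and with [r = (q p)^(-1/2)] the operator [U0] of weight [r w] satisfies
    [U0 C = T] ([MEM_eq_iso_abs]), because [r k p = 1] where [p] and [q] do not vanish.
    Four points need analysis.

    First, [p] and [q] must be finite, the latter where [p > 0]. If [p] were infinite on a
    set, every [E (u f)] could be cancelled there by corrections to [f] of small norm;
    closedness of [T] would then put in its domain a function [G], built from the
    Abel-Dini theorem, such that [E |u G|] is infinite ([closed_MEM_sq_conditionable]).
    If [q] were infinite on a set where [p > 0], every [E (u f)] with [f] in the domain
    would vanish there and the domain could not be dense ([dense_MEM_finite]).

    Second, boundedness. The conditional Cauchy-Schwarz inequality shows that [U0] and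
    [P], the operator of weight [conj u / p], are bounded ([MEM_bounded]). A function of the
    form [a v] has a norm that depends on [a] only through [E |a|^2]
    ([L2_mul_Esq_eq]), so [U0 f] and [P f] have the same norm, and so do [T f] and [C f].
    [P] is the projection onto the complement of the common null space, so [U0] is a partial
    isometry.

    Third, [C] is the only positive square root of its square ([sqrt_unique]). On functions
    [conj u m], with [m] measurable for the subalgebra, [C] is multiplication by
    [h = (q p)^(1/2)]. For such a function [f] carried by a band [a <= h <= b], any other
    root [B] satisfies [(B + a) (B f - a f) = (h^2 - a^2) f], so [B f] differs from
    [h f] by a term of the order of the width of the band; cutting the band into many
    pieces gives [B f = h f]. Functions of this form and the null space exhaust the domain
    of [C], and [B] is closed, so [B] extends [C]; both being self-adjoint, they are equal.

    Fourth, the partial isometry is determined ([iso_unique]): it is prescribed on the range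
    of [C], which is dense in the complement of the null space of [T], and its initial and
    final spaces force it to vanish on that null space. *)

Set Implicit Arguments.
Unset Strict Implicit.
Unset Printing Implicit Defensive.
Import Order.TTheory GRing.Theory Num.Theory.
Import numFieldNormedType.Exports.

Local Open Scope classical_set_scope.
Local Open Scope complex_scope.
Local Open Scope ring_scope.


#[local] Arguments Defs.dot : simpl never.
#[local] Arguments cintegral : simpl never.

(** * Calculus with almost everywhere statements *)

Section almost_everywhere_rules.
Context {d : measure_display} {X : measurableType d} {R : realType}.
Variable mu : {measure set X -> \bar R}.
Implicit Types P Q S T : X -> Prop.

Lemma aeS P Q : (forall x, P x -> Q x) ->
  {ae mu, forall x, P x} -> {ae mu, forall x, Q x}.
Proof. by move=> PQ; apply: negligibleS => x /= nQ /PQ. Qed.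

Lemma aeI P Q : {ae mu, forall x, P x} -> {ae mu, forall x, Q x} ->
  {ae mu, forall x, P x /\ Q x}.
Proof.
move=> hP hQ; apply: (negligibleS _ (negligibleU hP hQ)).
by move=> x /= /not_andP.
Qed.

Lemma aeS2 P Q T : (forall x, P x -> Q x -> T x) ->
  {ae mu, forall x, P x} -> {ae mu, forall x, Q x} -> {ae mu, forall x, T x}.
Proof. by move=> PQT hP hQ; apply: (aeS _ (aeI hP hQ)) => x [? ?]; exact: PQT. Qed.

Lemma aeS3 P Q S T : (forall x, P x -> Q x -> S x -> T x) ->
  {ae mu, forall x, P x} -> {ae mu, forall x, Q x} ->
  {ae mu, forall x, S x} -> {ae mu, forall x, T x}.
Proof. by move=> PQT hP hQ; apply: aeS2 (aeI hP hQ) => x [? ?]; exact: PQT. Qed.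

Lemma aeS4 P Q S T U : (forall x, P x -> Q x -> S x -> T x -> U x) ->
  {ae mu, forall x, P x} -> {ae mu, forall x, Q x} ->
  {ae mu, forall x, S x} -> {ae mu, forall x, T x} -> {ae mu, forall x, U x}.
Proof. by move=> PQT hP hQ; apply: aeS3 (aeI hP hQ) => x [? ?]; exact: PQT. Qed.

Lemma aeE (D : set X) : measurable D -> mu D = 0%E -> {ae mu, forall x, ~ D x}.
Proof. by move=> mD D0; exists D; split=> // x /contrapT. Qed.

Lemma integrable_ae_eq (f g : X -> \bar R) : measurable_fun setT g ->
  ae_eq mu setT f g -> mu.-integrable setT f -> mu.-integrable setT g.
Proof.
move=> mg fg /integrableP[mf fi]; apply/integrableP; split => //.
rewrite (_ : \int[mu]_x `|g x| = \int[mu]_x `|f x|)%E//.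
apply: ge0_ae_eq_integral => //.
- exact: measurableT_comp.
- exact: measurableT_comp.
- by apply: aeS fg => x fg _; rewrite fg.
Qed.

End almost_everywhere_rules.

(** * Sub-sigma-algebras and Radon-Nikodym densities *)

Section subalgebra.
Context {d : measure_display} {X : measurableType d} {R : realType}.
Variables (mu : {measure set X -> \bar R}) (A : set (set X)).
Local Open Scope ereal_scope.
Local Notation XA := (g_sigma_algebraType A).

(** The restriction of [mu] to the subalgebra, as a measure on a different measurable
    type. The hypothesis is an argument so that instances can be attached to this head
    symbol. *)
Definition subalg_measure (hA : sigma_finite_subalgebra mu A) : set XA -> \bar R :=
  pushforward mu (idfun : X -> XA).

Hypothesis hA : sigma_finite_subalgebra mu A.

Lemma subalg_measurableE (B : set X) : (measurable (B : set XA)) <-> A B.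
Proof.
case: hA => sA _ _; rewrite -[X in _ <-> X B](sigma_algebra_id sA).
by [].
Qed.

Lemma subalg_measurable (B : set XA) : measurable B -> measurable (B : set X).
Proof. by case: hA => _ AS _ /subalg_measurableE /AS. Qed.

Lemma subalg_sub (B : set X) : A B -> measurable B.
Proof. by case: hA => _ + _; exact. Qed.

Lemma subalg_measurable_fun d' (Y : measurableType d') (f : X -> Y) :
  measurable_fun [set: XA] f -> measurable_fun [set: X] f.
Proof.
move=> mf _ B mB; apply: subalg_measurable.
exact: (mf measurableT _ mB).
Qed.

Lemma measurable_id_subalg : measurable_fun [set: X] (idfun : X -> XA).
Proof. by move=> _ B mB; rewrite setTI; exact: subalg_measurable. Qed.

Let subalg_measure0 : subalg_measure hA set0 = 0.
Proof. exact: (measure0 mu). Qed.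

Let subalg_measure_ge0 B : 0 <= subalg_measure hA B.
Proof. exact: (measure_ge0 mu B). Qed.

Let subalg_measure_sigma_additive : semi_sigma_additive (subalg_measure hA).
Proof.
move=> F mF tF mUF.
apply: (@measure_semi_sigma_additive _ _ _ mu F) => //.
- by move=> n; exact: subalg_measurable.
- exact: subalg_measurable mUF.
Qed.

HB.instance Definition _ := isMeasure.Build _ _ _ (subalg_measure hA)
  subalg_measure0 subalg_measure_ge0 subalg_measure_sigma_additive.

Let subalg_measure_sigma_finite : sigma_finite [set: XA] (subalg_measure hA).
Proof. by case: hA. Qed.

HB.instance Definition _ := Measure_isSigmaFinite.Build _ _ _ (subalg_measure hA)
  subalg_measure_sigma_finite.

Lemma subalg_exhaustion : exists F : (set X)^nat,
  [/\ forall n, measurable (F n : set XA), forall n, mu (F n) < +oo,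
      nondecreasing_seq F & \bigcup_n F n = setT].
Proof.
have /sigma_finiteP[F [uF nF mF]] :=
  @sigma_finiteT _ _ _ [the {sigma_finite_measure set XA -> \bar R} of subalg_measure hA].
by exists F; split=> //; move=> n; have [] := mF n.
Qed.

Lemma subalg_integral (B : set X) (f : X -> \bar R) : A B ->
  measurable_fun [set: XA] f -> (forall x, 0 <= f x) ->
  \int[subalg_measure hA]_(x in (B : set XA)) f x = \int[mu]_(x in B) f x.
Proof.
move=> AB mf f0.
rewrite ge0_integral_pushforward//.
- exact: measurable_id_subalg.
- exact/subalg_measurableE.
- exact: measurable_funTS.
Qed.

End subalgebra.

Section induced_measure.
Context {d : measure_display} {X : measurableType d} {R : realType}.
Variables (mu : {measure set X -> \bar R}) (A : set (set X)).
Hypothesis hA : sigma_finite_subalgebra mu A.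
Local Open Scope ereal_scope.
Local Notation XA := (g_sigma_algebraType A).
Variable f : X -> \bar R.
Hypotheses (mf : measurable_fun setT f) (f0 : forall x, 0 <= f x)
  (fi : \int[mu]_x f x < +oo).

(** The integral of [f], as a finite measure on the subalgebra; again the hypotheses are
    arguments only to let instances be declared. *)
Definition density_on_subalg of sigma_finite_subalgebra mu A &
  measurable_fun setT f & (forall x, 0 <= f x) & (\int[mu]_x f x < +oo) :
   set XA -> \bar R := fun B => \int[mu]_(x in B) f x.

Local Notation nu := (density_on_subalg hA mf f0 fi).

Let nu0 : nu set0 = 0. Proof. exact: integral_set0. Qed.

Let nu_ge0 B : 0 <= nu B. Proof. exact: integral_ge0. Qed.

Let nu_sigma_additive : semi_sigma_additive nu.
Proof.
move=> F mF tF mUF.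
apply: (semi_sigma_additive_nng_induced mf f0) => //.
- by move=> n; exact: (subalg_measurable hA).
- exact: (subalg_measurable hA) mUF.
Qed.

HB.instance Definition _ := isMeasure.Build _ _ _ nu
  nu0 nu_ge0 nu_sigma_additive.

Let nu_fin : fin_num_fun nu.
Proof.
move=> B mB; rewrite ge0_fin_numE// (le_lt_trans _ fi)//.
apply: ge0_subset_integral => //.
exact: (subalg_measurable hA).
Qed.

HB.instance Definition _ := Measure_isFinite.Build _ _ _ nu nu_fin.

(** The Radon-Nikodym density with respect to the restriction of [mu]. *)
Lemma integrable_is_cond_exp : exists g, is_cond_exp mu A f g.
Proof.
have dom : nu `<< subalg_measure hA.
  apply/null_content_dominatesP => B mB B0.
  have mB' := subalg_measurable hA mB.
  have mfB : measurable_fun (B : set X) f by apply: measurable_funS mf.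
  exact: (@null_set_integral _ _ _ mu B f mB' mfB B0).
have [g [g0 gf gi gE]] := radon_nikodym_sigma_finite dom.
have mg : measurable_fun [set: XA] g by exact: (measurable_int _ gi).
exists g; split => // B AB.
rewrite -(subalg_integral hA AB mg g0) -gE//.
exact/(subalg_measurableE hA).
Qed.

End induced_measure.

(** * Existence and uniqueness of conditional expectations *)

Section cond_exp_nonneg.
Context {d : measure_display} {X : measurableType d} {R : realType}.
Variables (mu : {measure set X -> \bar R}) (A : set (set X)).
Hypothesis hA : sigma_finite_subalgebra mu A.
Local Open Scope ereal_scope.
Local Notation XA := (g_sigma_algebraType A).

(** Where [g' + 1/k <= g] and [g' <= n], inside a set of finite measure, the integral of
    [g'] is finite, so the integrals can only be ordered if that set is null. Countably
    many such sets cover the points where [g <= g'] fails. *)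
Lemma ae_le_of_subalg_integral (g g' : X -> \bar R) :
  measurable_fun [set: XA] g -> measurable_fun [set: XA] g' ->
  (forall x, 0 <= g x) -> (forall x, 0 <= g' x) ->
  (forall B, A B -> \int[mu]_(x in B) g x <= \int[mu]_(x in B) g' x) ->
  {ae mu, forall x, g x <= g' x}.
Proof.
move=> mg mg' g0 g'0 gg'.
have [F [mF Ffin ndF UF]] := subalg_exhaustion hA.
pose B n k : set XA := F n `&` ([set: XA] `&` [set x | g' x <= n%:R%:E]) `&`
  ([set: XA] `&` [set x | g' x + k.+1%:R^-1%:E <= g x]).
have mB n k : measurable (B n k).
  apply: measurableI.
    by apply: measurableI => //; exact: emeasurable_fun_infty_c.
  apply: emeasurable_fun_le => //.
  by apply: emeasurable_funD => //; exact: measurable_cst.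
have mBX n k : measurable (B n k : set X) by exact: (subalg_measurable hA).
have mgX := subalg_measurable_fun hA mg.
have mg'X := subalg_measurable_fun hA mg'.
have Bfin n k : mu (B n k) < +oo.
  apply: le_lt_trans (Ffin n); apply: le_measure; rewrite ?inE//.
    exact: (subalg_measurable hA).
  by move=> x [[]].
have B0 n k : mu (B n k) = 0.
  have Ig' : \int[mu]_(x in B n k) g' x \is a fin_num.
    rewrite ge0_fin_numE; last exact: integral_ge0.
    apply: (@le_lt_trans _ _ (\int[mu]_(x in B n k) (cst n%:R%:E) x)).
      apply: ge0_le_integral => //; first exact: measurable_funTS.
      by move=> x [[_ [_ ]]].
    by rewrite integral_cst// lte_mul_pinfty// lee_fin.
  have : \int[mu]_(x in B n k) g' x + k.+1%:R^-1%:E * mu (B n k)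
      <= \int[mu]_(x in B n k) g' x.
    apply: le_trans (gg' (B n k) ((subalg_measurableE hA _).1 (mB n k))).
    rewrite -integral_cst// -ge0_integralD//; [|exact: measurable_funTS|by move=> x _; rewrite lee_fin].
    apply: ge0_le_integral => //.
    - by move=> x Bx; rewrite adde_ge0//= lee_fin.
    - apply: emeasurable_funD => //; exact: measurable_funTS.
    - exact: measurable_funTS.
    - by move=> x [_ [_ ]].
  rewrite -[leRHS]adde0 leeD2lE// => h.
  apply/eqP; rewrite eq_le measure_ge0 andbT.
  by rewrite -(@pmule_rle0 _ (k.+1%:R^-1%:E)).
have : {ae mu, forall x, forall n k, ~ B n k x}.
  by apply: ae_foralln => n; apply: ae_foralln => k; exact: aeE.
apply: aeS => x nB.
rewrite leNgt; apply/negP => lt.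
have [N _ FN] : (\bigcup_n F n) x by rewrite UF.
have g'fin : g' x \is a fin_num.
  by rewrite ge0_fin_numE//; apply: lt_le_trans (leey (g x)).
have [k hk] : exists k, g' x + k.+1%:R^-1%:E <= g x.
  have {lt} := lt; move: g'fin; case: (g' x) => // r _.
  case: (g x) => [s||]//; last by exists 0%N; rewrite leey.
  rewrite lte_fin => rs.
  exists (Num.truncn (s - r)^-1).
  rewrite -EFinD lee_fin -lerBrDl invf_ple ?posrE ?subr_gt0//.
  by apply/ltW/truncnS_gt.
pose M := (maxn N (Num.truncn (fine (g' x))).+1).
apply: (nB M k); split; first split.
- have : F N `<=` F M by apply/subsetPset/ndF; exact: leq_maxl.
  exact.
- split => //=.
  rewrite -(fineK g'fin) lee_fin.
  apply: (le_trans (ltW (truncnS_gt _))).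
  by rewrite ler_nat leq_maxr.
- by split.
Qed.

Lemma ae_eq_of_subalg_integral (g g' : X -> \bar R) :
  measurable_fun [set: XA] g -> measurable_fun [set: XA] g' ->
  (forall x, 0 <= g x) -> (forall x, 0 <= g' x) ->
  (forall B, A B -> \int[mu]_(x in B) g x = \int[mu]_(x in B) g' x) ->
  {ae mu, forall x, g x = g' x}.
Proof.
move=> mg mg' g0 g'0 gg'.
apply: (@aeS2 _ _ _ _ (fun x => g x <= g' x) (fun x => g' x <= g x)).
- by move=> x ? ?; apply/eqP; rewrite eq_le; apply/andP.
- by apply: ae_le_of_subalg_integral => // B /gg' ->.
- by apply: ae_le_of_subalg_integral => // B /gg' ->.
Qed.

(** A finite function splits into countably many pieces with disjoint supports and
    finite integrals; the conditional expectations of the pieces add up to one for the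
    whole. *)
Lemma exists_cond_exp (f : X -> R) : measurable_fun setT f ->
  (forall x, 0 <= f x)%R -> exists g, is_cond_exp mu A (EFin \o f) g.
Proof.
move=> mf f0.
have [F [mF Ffin ndF UF]] := subalg_exhaustion hA.
have mFX n : measurable (F n : set X) by exact: (subalg_measurable hA).
have mEf : measurable_fun [set: X] (EFin \o f) by exact/measurable_EFinP.
(* on the disjoint pieces [D n] cut out of the [G n] the function is integrable *)
pose G n : set X := F n `&` [set x | (EFin \o f) x <= n%:R%:E].
have mG n : measurable (G n).
  apply: measurableI => //.
  by rewrite -[X in measurable X]setTI; exact: emeasurable_fun_infty_c.
pose D := seqDU G.
have mD n : measurable (D n) by exact: seqDU_measurable.
have UD : \bigcup_n D n = setT.
  rewrite -seqDU_bigcup_eq -subTset => x _.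
  have [N _ FN] : (\bigcup_n F n) x by rewrite UF.
  exists (maxn N (Num.truncn (f x)).+1) => //; split.
    have : F N `<=` F (maxn N (Num.truncn (f x)).+1).
      by apply/subsetPset/ndF; exact: leq_maxl.
    exact.
  rewrite /= lee_fin; apply: (le_trans (ltW (truncnS_gt _))).
  by rewrite ler_nat leq_maxr.
pose phi n : X -> \bar R := (EFin \o f) \_ (D n).
have phi0 n x : 0 <= phi n x by rewrite /phi patchE; case: ifPn => //= _; rewrite lee_fin.
have mphi n : measurable_fun setT (phi n).
  by apply/(measurable_restrictT _ _).1 => //; exact: measurable_funTS.
have phi_fin n : \int[mu]_x phi n x < +oo.
  rewrite -integral_mkcond.
  have DG : D n `<=` G n by exact: subset_seqDU.
  apply: (@le_lt_trans _ _ (\int[mu]_(x in G n) (EFin \o f) x)).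
    apply: ge0_subset_integral => //; first exact: measurable_funTS.
    by move=> x _; rewrite lee_fin.
  apply: (@le_lt_trans _ _ (\int[mu]_(x in G n) (cst n%:R%:E) x)).
    apply: ge0_le_integral => //; first by move=> x _; rewrite lee_fin.
      exact: measurable_funTS.
    by move=> x [].
  rewrite integral_cst// lte_mul_pinfty// ?lee_fin//.
  by apply: le_lt_trans (Ffin n); apply: le_measure; rewrite ?inE// => x [].
have [e eP] : {e : nat -> X -> \bar R & forall n, is_cond_exp mu A (phi n) (e n)}.
  exact: (@choice _ _ (fun n g => is_cond_exp mu A (phi n) g) (fun n =>
    integrable_is_cond_exp hA (mphi n) (phi0 n) (phi_fin n))).
exists (fun x => \sum_(n <oo) e n x); split.
- apply: ge0_emeasurable_sum => n.
    by move=> x _ _; case: (eP n).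
  by move=> _; case: (eP n).
- by move=> x; apply: nneseries_ge0 => n _ _; case: (eP n).
- move=> B AB.
  have mB : measurable B by exact: (subalg_sub hA).
  rewrite integral_nneseries//; last 2 first.
  + move=> n; apply: measurable_funTS.
    by apply: (subalg_measurable_fun hA); case: (eP n).
  + by move=> n x _; case: (eP n).
  have -> : \int[mu]_(x in B) (EFin \o f) x =
      \int[mu]_(x in \bigcup_n (B `&` D n)) (EFin \o f) x.
    by rewrite -setI_bigcupr UD setIT.
  rewrite ge0_integral_bigcup//; last 4 first.
  + by move=> k; exact: measurableI.
  + exact: measurable_funTS.
  + by move=> x _; rewrite lee_fin.
  + apply: trivIset_setIl; exact: trivIset_seqDU.
  apply: eq_eseriesr => n _.
  case: (eP n) => _ _ <- //.
  rewrite [RHS]integral_mkcond [LHS]integral_mkcond; apply: eq_integral => x _.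
  by rewrite /phi -patch_setI setIC.
Qed.

End cond_exp_nonneg.

(** * Pulling factors out of integrals *)

Section pull_out_integral.
Context {d : measure_display} {X : measurableType d} {R : realType}.
Variables (mu : {measure set X -> \bar R}) (A : set (set X)).
Hypothesis hA : sigma_finite_subalgebra mu A.
Local Open Scope ereal_scope.
Local Notation XA := (g_sigma_algebraType A).
Import HBNNSimple.

Lemma subalg_integral_simpleM (f : X -> \bar R) (s : {nnsfun XA >-> R}) (B : set X) :
  A B -> measurable_fun [set: X] f -> (forall x, 0 <= f x) ->
  \int[mu]_(x in B) ((s x)%:E * f x) =
  \sum_(y \in range s) y%:E * \int[mu]_(x in B `&` (s @^-1` [set y])) f x.
Proof.
move=> AB mf f0.
have mB : measurable B by exact: (subalg_sub hA).
have ms y : measurable (s @^-1` [set y] : set X).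
  apply: (subalg_measurable hA).
  exact: (measurable_funPTI s).
transitivity (\int[mu]_(x in B)
    (\sum_(y \in range s) (y%:E * (f \_ (s @^-1` [set y])) x))).
  apply: eq_integral => x _; rewrite [s x]fimfunE -fsumEFin//.
  rewrite ge0_mule_fsuml; last first.
    move=> y; rewrite lee_fin.
    exact: nnfun_muleindic_ge0.
  apply: eq_fsbigr => y _; rewrite patchE indicE.
  by case: ifPn => _; rewrite ?mulr1 ?mulr0 ?mule0 ?mul0e.
rewrite ge0_integral_fsum//.
- apply: eq_fsbigr => y /[!inE] -[x _ <-].
  rewrite ge0_integralZl_EFin//.
  + by rewrite -integral_mkcondr.
  + by move=> z _; apply: erestrict_ge0.
  + apply: measurable_funTS; apply/(measurable_restrictT _ _).1 => //.
    exact: measurable_funTS.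
- move=> y; apply: measurable_funeM; apply: measurable_funTS.
  by apply/(measurable_restrictT _ _).1 => //; exact: measurable_funTS.
- move=> y x _; rewrite patchE; case: ifPn => [|_]; last by rewrite mule0.
  by rewrite inE => /= <-; rewrite mule_ge0// lee_fin.
Qed.

(** Simple functions reduce this to indicators, and monotone convergence does the rest. *)
Lemma subalg_integralM_eq (f g m : X -> \bar R) :
  measurable_fun [set: X] f -> (forall x, 0 <= f x) ->
  measurable_fun [set: X] g -> (forall x, 0 <= g x) ->
  measurable_fun [set: XA] m -> (forall x, 0 <= m x) ->
  (forall B, A B -> \int[mu]_(x in B) f x = \int[mu]_(x in B) g x) ->
  forall B, A B -> \int[mu]_(x in B) (m x * f x) = \int[mu]_(x in B) (m x * g x).
Proof.
move=> mf f0 mg g0 mm m0 fg B AB.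
have mB : measurable B by exact: (subalg_sub hA).
pose s := nnsfun_approx measurableT mm.
have nds n k x : (n <= k)%N -> (s n x)%:E <= (s k x)%:E.
  by move=> nk; rewrite lee_fin; apply/lefP; exact: nd_nnsfun_approx.
have s0 n x : 0 <= (s n x)%:E by rewrite lee_fin.
have key (h : X -> \bar R) : measurable_fun [set: X] h -> (forall x, 0 <= h x) ->
    \int[mu]_(x in B) (m x * h x) = limn (fun n => \int[mu]_(x in B) ((s n x)%:E * h x)).
  move=> mh h0; rewrite -monotone_convergence//.
  - apply: eq_integral => x _; apply/esym/cvg_lim => //.
    have hs : (s n x)%:E @[n --> \oo] --> m x by exact: cvg_nnsfun_approx.
    have [h00|h00] := eqVneq (h x) 0.
      rewrite h00 mule0; rewrite (_ : (fun n => _) = cst 0); first exact: cvg_cst.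
      by apply/funext => n; rewrite mule0.
    have [m00|m00] := eqVneq (m x) 0.
      rewrite m00 mul0e (_ : (fun n => _) = cst 0); first exact: cvg_cst.
      apply/funext => n.
      suff -> : (s n x)%:E = 0 by rewrite mul0e.
      apply/eqP; rewrite eq_le s0 andbT -m00.
      by apply: (cvge_ge _ hs); exists n => // k /= nk; exact: nds.
    apply: cvgeM hs (cvg_cst _).
    by rewrite mule_defE (negbTE h00) (negbTE m00).
  - move=> n; apply: emeasurable_funM; last exact: measurable_funTS.
    apply/measurable_EFinP/measurable_funTS/(subalg_measurable_fun hA).
    exact: measurable_funP.
  - by move=> n x _; rewrite mule_ge0// lee_fin.
  - by move=> x _ n k nk; apply: lee_pmul => //; exact: nds.
rewrite !key//; congr (limn _); apply/funext => n.
rewrite !subalg_integral_simpleM//; apply: eq_fsbigr => y _; congr (_ * _).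
apply: fg; apply/(subalg_measurableE hA); apply: measurableI.
  exact/(subalg_measurableE hA).
exact: (measurable_funPTI (s n)).
Qed.

End pull_out_integral.

(** * Conditional expectation of real functions *)

Lemma measurable_invr_ge0 {d} {X : measurableType d} {R : realType} (f : X -> R) : measurable_fun setT f ->
  (forall x, 0 <= f x) -> measurable_fun setT (fun x => (f x)^-1).
Proof.
move=> mf f0; rewrite (_ : (fun x => _) = (fun x => f x `^ (-1))).
  exact: (measurableT_comp (@measurable_powR R (-1)) mf).
by apply/funext => x; rewrite powR_inv1.
Qed.

Lemma measurable_sqrtr {d} {X : measurableType d} {R : realType} (f : X -> R) : measurable_fun setT f ->
  measurable_fun setT (fun x => Num.sqrt (f x)).
Proof.
move=> mf; apply: measurableT_comp mf; apply: nondecreasing_measurable => //.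
by move=> x y; exact: ler_wsqrtr.
Qed.

Section cond_exp_theory.
Context {d : measure_display} {X : measurableType d} {R : realType}.
Variables (mu : {measure set X -> \bar R}) (A : set (set X)).
Hypothesis hA : sigma_finite_subalgebra mu A.
Local Open Scope ereal_scope.
Local Notation XA := (g_sigma_algebraType A).
Local Notation E f := (cond_exp mu A (EFin \o f%R)).

Lemma cond_exp_ge0 (f : X -> \bar R) x : 0 <= cond_exp mu A f x.
Proof.
rewrite /cond_exp; set S := [set g | _].
by have [[g Sg]|nS] := pselect (S !=set0); [case: (xgetPex (cst 0) (ex_intro _ g Sg))|
  rewrite xgetPN// => g Sg; apply: nS; exists g].
Qed.

Lemma measurable_cond_exp (f : X -> \bar R) :
  measurable_fun [set: XA] (cond_exp mu A f).
Proof.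
rewrite /cond_exp; set S := [set g | _].
by have [[g Sg]|nS] := pselect (S !=set0); [case: (xgetPex (cst 0) (ex_intro _ g Sg))|
  rewrite xgetPN// => g Sg; apply: nS; exists g].
Qed.

Lemma is_cond_exp_cond_exp (f : X -> R) : measurable_fun setT f ->
  (forall x, 0 <= f x)%R -> is_cond_exp mu A (EFin \o f) (E f).
Proof. by move=> mf f0; apply: xgetPex; exact: exists_cond_exp. Qed.

Lemma cond_exp_integral (f : X -> R) B : measurable_fun setT f ->
  (forall x, 0 <= f x)%R -> A B ->
  \int[mu]_(x in B) (f x)%:E = \int[mu]_(x in B) E f x.
Proof. by move=> mf f0 AB; case: (is_cond_exp_cond_exp mf f0) => _ _; exact. Qed.

Lemma cond_exp_integralT (f : X -> R) : measurable_fun setT f ->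
  (forall x, 0 <= f x)%R -> \int[mu]_x (f x)%:E = \int[mu]_x E f x.
Proof.
move=> mf f0; apply: cond_exp_integral => //.
exact/(subalg_measurableE hA).
Qed.

Lemma cond_exp_unique (f : X -> R) g : measurable_fun setT f ->
  (forall x, 0 <= f x)%R -> is_cond_exp mu A (EFin \o f) g ->
  {ae mu, forall x, E f x = g x}.
Proof.
move=> mf f0 [mg g0 fg]; apply: (ae_eq_of_subalg_integral hA) => //.
- exact: measurable_cond_exp.
- exact: cond_exp_ge0.
- by move=> B AB; rewrite -fg// -cond_exp_integral.
Qed.

Let AM B : A B -> measurable B.
Proof. by move=> AB; apply: (subalg_measurable hA); exact/(subalg_measurableE hA). Qed.

Lemma cond_exp_le (f g : X -> R) : measurable_fun setT f -> measurable_fun setT g ->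
  (forall x, 0 <= f x)%R -> (forall x, 0 <= g x)%R ->
  {ae mu, forall x, (f x <= g x)%R} -> {ae mu, forall x, E f x <= E g x}.
Proof.
move=> mf mg f0 g0 fg; apply: (ae_le_of_subalg_integral hA).
- exact: measurable_cond_exp.
- exact: measurable_cond_exp.
- exact: cond_exp_ge0.
- exact: cond_exp_ge0.
- move=> B AB; rewrite -!cond_exp_integral//.
  apply: ae_ge0_le_integral => //.
  + exact: AM.
  + by move=> x _; rewrite lee_fin.
  + by apply/measurable_EFinP; exact: measurable_funTS.
  + by move=> x _; rewrite lee_fin.
  + by apply/measurable_EFinP; exact: measurable_funTS.
  + by apply: aeS fg => x fg _; rewrite lee_fin.
Qed.

Lemma cond_expD (f g : X -> R) : measurable_fun setT f -> measurable_fun setT g ->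
  (forall x, 0 <= f x)%R -> (forall x, 0 <= g x)%R ->
  {ae mu, forall x, E (fun x => f x + g x)%R x = E f x + E g x}.
Proof.
move=> mf mg f0 g0; apply: cond_exp_unique.
- exact: measurable_funD.
- by move=> x; rewrite addr_ge0.
- split.
  + by apply: emeasurable_funD; exact: measurable_cond_exp.
  + by move=> x; rewrite adde_ge0// cond_exp_ge0.
  + move=> B AB; rewrite ge0_integralD//.
    * rewrite -!cond_exp_integral// -ge0_integralD//.
      - exact: AM.
      - by move=> x _; rewrite lee_fin.
      - by apply/measurable_EFinP; exact: measurable_funTS.
      - by move=> x _; rewrite lee_fin.
      - by apply/measurable_EFinP; exact: measurable_funTS.
    * exact: AM.
    * by move=> x _; exact: cond_exp_ge0.
    * by apply/measurable_funTS/(subalg_measurable_fun hA); exact: measurable_cond_exp.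
    * by move=> x _; exact: cond_exp_ge0.
    * by apply/measurable_funTS/(subalg_measurable_fun hA); exact: measurable_cond_exp.
Qed.

Lemma cond_expM (m f : X -> R) : measurable_fun [set: XA] m -> measurable_fun setT f ->
  (forall x, 0 <= m x)%R -> (forall x, 0 <= f x)%R ->
  {ae mu, forall x, E (fun x => m x * f x)%R x = (m x)%:E * E f x}.
Proof.
move=> mm mf m0 f0.
have mmX := subalg_measurable_fun hA mm.
apply: cond_exp_unique.
- exact: measurable_funM.
- by move=> x; rewrite mulr_ge0.
- split.
  + apply: emeasurable_funM; last exact: measurable_cond_exp.
    exact/measurable_EFinP.
  + by move=> x; rewrite mule_ge0 ?lee_fin// cond_exp_ge0.
  + move=> B AB.
    rewrite -(subalg_integralM_eq hA (f := EFin \o f) (g := E f) (m := EFin \o m))//.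
    * exact/measurable_EFinP.
    * by apply: (subalg_measurable_fun hA); exact: measurable_cond_exp.
    * exact: cond_exp_ge0.
    * exact/measurable_EFinP.
    * by move=> C AC; rewrite -cond_exp_integral.
Qed.

Lemma cond_exp_ae_congr (f g : X -> \bar R) : measurable_fun setT f ->
  measurable_fun setT g -> (forall x, 0 <= f x) -> (forall x, 0 <= g x) ->
  {ae mu, forall x, f x = g x} -> cond_exp mu A f = cond_exp mu A g.
Proof.
move=> mf mg f0 g0 fg; rewrite /cond_exp; congr (xget _ _).
have I B : A B -> \int[mu]_(x in B) f x = \int[mu]_(x in B) g x.
  move=> AB; apply: ge0_ae_eq_integral => //.
  - exact: AM.
  - exact: measurable_funTS.
  - exact: measurable_funTS.
  - by apply: aeS fg => x ->.
apply/seteqP; split => h [mh h0 hI]; split=> // B AB.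
  by rewrite -I// hI.
by rewrite I// hI.
Qed.

End cond_exp_theory.

Section cond_expR_theory.
Context {d : measure_display} {X : measurableType d} {R : realType}.
Variables (mu : {measure set X -> \bar R}) (A : set (set X)).
Hypothesis hA : sigma_finite_subalgebra mu A.
Local Notation XA := (g_sigma_algebraType A).
Local Notation E f := (cond_exp mu A (EFin \o f%R)).
Local Notation ER := (cond_expR mu A).

Definition conditionableR (f : X -> R) : Prop :=
  measurable_fun setT f /\ {ae mu, forall x, (E (fun x => `|f x|) x < +oo)%E}.

Definition fexp (f : X -> R) x : R := fine (E f x).

Lemma fexpE (f : X -> R) x : fexp f x = fine (E f x). Proof. by []. Qed.

Lemma fexpK (f : X -> R) x : (E f x < +oo)%E -> E f x = (fexp f x)%:E.
Proof. by move=> h; rewrite fineK// ge0_fin_numE// cond_exp_ge0. Qed.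

Lemma fexp_ge0 (f : X -> R) x : 0 <= fexp f x.
Proof. by rewrite fine_ge0// cond_exp_ge0. Qed.

Lemma measurable_fexp (f : X -> R) : measurable_fun [set: XA] (fexp f).
Proof. by apply: measurableT_comp => //; exact: measurable_cond_exp. Qed.

Lemma measurable_cond_expR (f : X -> R) : measurable_fun [set: XA] (ER f).
Proof. by apply: measurable_funB; exact: measurable_fexp. Qed.

Lemma cond_exp_lty_le (f g : X -> R) : measurable_fun setT f -> measurable_fun setT g ->
  (forall x, 0 <= f x) -> (forall x, f x <= g x) ->
  {ae mu, forall x, (E g x < +oo)%E} -> {ae mu, forall x, (E f x < +oo)%E}.
Proof.
move=> mf mg f0 fg.
have g0 x : 0 <= g x by exact: le_trans (fg x).
apply: aeS2 (cond_exp_le hA mf mg f0 g0 _) => [x|]; last exact: aeW.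
exact: le_lt_trans.
Qed.

Lemma cond_exp_ltyD (f g : X -> R) : measurable_fun setT f -> measurable_fun setT g ->
  (forall x, 0 <= f x) -> (forall x, 0 <= g x) ->
  {ae mu, forall x, (E f x < +oo)%E} -> {ae mu, forall x, (E g x < +oo)%E} ->
  {ae mu, forall x, (E (fun x => f x + g x) x < +oo)%E}.
Proof.
move=> mf mg f0 g0; apply: aeS3 (cond_expD hA mf mg f0 g0) => x -> fo go.
exact: lte_add_pinfty.
Qed.

Lemma fexpD (f g : X -> R) : measurable_fun setT f -> measurable_fun setT g ->
  (forall x, 0 <= f x) -> (forall x, 0 <= g x) ->
  {ae mu, forall x, (E f x < +oo)%E} -> {ae mu, forall x, (E g x < +oo)%E} ->
  {ae mu, forall x, fexp (fun x => f x + g x) x = fexp f x + fexp g x}.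
Proof.
move=> mf mg f0 g0; apply: aeS3 (cond_expD hA mf mg f0 g0) => x + fo go.
by rewrite /fexp => ->; rewrite fineD// ge0_fin_numE// cond_exp_ge0.
Qed.

(** Since [f^+ + f2 = f^- + f1], additivity on nonnegative functions gives the result.
    Additivity and the pull-out rule for signed functions both reduce to it. *)
Lemma cond_expR_of_parts (f f1 f2 : X -> R) :
  measurable_fun setT f1 -> measurable_fun setT f2 ->
  (forall x, 0 <= f1 x) -> (forall x, 0 <= f2 x) ->
  {ae mu, forall x, (E f1 x < +oo)%E} -> {ae mu, forall x, (E f2 x < +oo)%E} ->
  f = (fun x => f1 x - f2 x) ->
  {ae mu, forall x, ER f x = fexp f1 x - fexp f2 x}.
Proof.
move=> m1 m2 p1 p2 i1 i2 ff.
have mf : measurable_fun setT f by rewrite ff; exact: measurable_funB.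
have mfp : measurable_fun setT f^\+ by exact: measurable_funrpos.
have mfn : measurable_fun setT f^\- by exact: measurable_funrneg.
have fp0 x : 0 <= f^\+ x by exact: funrpos_ge0.
have fn0 x : 0 <= f^\- x by exact: funrneg_ge0.
have i12 := cond_exp_ltyD m1 m2 p1 p2 i1 i2.
have ip : {ae mu, forall x, (E f^\+ x < +oo)%E}.
  apply: cond_exp_lty_le i1 => // x; rewrite /funrpos ff ge_max p1 andbT.
  by rewrite lerBlDr lerDl.
have in' : {ae mu, forall x, (E f^\- x < +oo)%E}.
  apply: cond_exp_lty_le i2 => // x; rewrite /funrneg ff ge_max p2 andbT.
  by rewrite opprB lerBlDr lerDl.
have := fexpD mfp m2 fp0 p2 ip i2.
have -> : (fun x => f^\+ x + f2 x) = (fun x => f1 x + f^\- x).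
  apply/funext => x.
  have /eqP : f x = f^\+ x - f^\- x by rewrite -[in LHS](funrposBneg f).
  by rewrite ff; lra.
apply: aeS2 (fexpD m1 mfn p1 fn0 i1 in') => x -> e.
rewrite /cond_expR -/(fexp f^\+ x) -/(fexp f^\- x).
by move: e; lra.
Qed.

Lemma conditionableR_parts (f : X -> R) : conditionableR f ->
  {ae mu, forall x, (E f^\+ x < +oo)%E} /\ {ae mu, forall x, (E f^\- x < +oo)%E}.
Proof.
move=> [mf fi]; split.
- apply: cond_exp_lty_le fi.
  + exact: measurable_funrpos.
  + exact: measurableT_comp.
  + exact: funrpos_ge0.
  + by move=> x; rewrite /funrpos ge_max ler_norm normr_ge0.
- apply: cond_exp_lty_le fi.
  + exact: measurable_funrneg.
  + exact: measurableT_comp.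
  + exact: funrneg_ge0.
  + by move=> x; rewrite /funrneg ge_max -normrN ler_norm normr_ge0.
Qed.

Lemma cond_expRD (f g : X -> R) : conditionableR f -> conditionableR g ->
  {ae mu, forall x, ER (fun x => f x + g x) x = ER f x + ER g x}.
Proof.
move=> cf cg.
have [fp fn] := conditionableR_parts cf; have [gp gn] := conditionableR_parts cg.
have [mf _] := cf; have [mg _] := cg.
have mfp : measurable_fun setT f^\+ by exact: measurable_funrpos.
have mfn : measurable_fun setT f^\- by exact: measurable_funrneg.
have mgp : measurable_fun setT g^\+ by exact: measurable_funrpos.
have mgn : measurable_fun setT g^\- by exact: measurable_funrneg.
have := @cond_expR_of_parts (fun x => f x + g x) (fun x => f^\+ x + g^\+ x)
  (fun x => f^\- x + g^\- x).
move=> /(_ (measurable_funD mfp mgp) (measurable_funD mfn mgn)).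
move=> /(_ (fun x => addr_ge0 (funrpos_ge0 f x) (funrpos_ge0 g x))).
move=> /(_ (fun x => addr_ge0 (funrneg_ge0 f x) (funrneg_ge0 g x))).
move=> /(_ (cond_exp_ltyD mfp mgp (funrpos_ge0 f) (funrpos_ge0 g) fp gp)).
move=> /(_ (cond_exp_ltyD mfn mgn (funrneg_ge0 f) (funrneg_ge0 g) fn gn)).
have e : (fun x => f x + g x) = (fun x => f^\+ x + g^\+ x - (f^\- x + g^\- x)).
  apply/funext => x; rewrite -[in LHS](funrposBneg f) -[in LHS](funrposBneg g) /= !fctE; lra.
move=> /(_ e).
apply: aeS3 (fexpD mfp mgp (funrpos_ge0 f) (funrpos_ge0 g) fp gp)
  (fexpD mfn mgn (funrneg_ge0 f) (funrneg_ge0 g) fn gn) => x -> -> ->.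
rewrite /cond_expR -!/(fexp _ _); lra.
Qed.

Lemma cond_expRN (f : X -> R) x : ER (fun x => - f x) x = - ER f x.
Proof.
rewrite /cond_expR opprB.
have -> : (fun x => - f x)^\+ = f^\- by [].
have -> // : (fun x => - f x)^\- = f^\+.
by apply/funext => y; rewrite /funrpos /funrneg opprK.
Qed.

Lemma conditionableRM (m f : X -> R) : measurable_fun [set: XA] m ->
  conditionableR f -> conditionableR (fun x => m x * f x).
Proof.
move=> mm [mf fi]; have mmX := subalg_measurable_fun hA mm; split.
  exact: measurable_funM.
have -> : (fun x => `|m x * f x|) = (fun x => `|m x| * `|f x|).
  by apply/funext => x; rewrite normrM.
apply: aeS2 (cond_expM hA (m := fun x => `|m x|) (f := fun x => `|f x|) _ _ _ _) fi => //.
- by move=> x -> fo; rewrite lte_mul_pinfty// lee_fin.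
- exact: measurableT_comp.
- exact: measurableT_comp.
Qed.

Lemma conditionableRD (f g : X -> R) : conditionableR f -> conditionableR g ->
  conditionableR (fun x => f x + g x).
Proof.
move=> [mf fi] [mg gi]; split; first exact: measurable_funD.
apply: cond_exp_lty_le (cond_exp_ltyD _ _ _ _ fi gi) => //.
- by apply: measurableT_comp => //; exact: measurable_funD.
- by apply: measurable_funD; exact: measurableT_comp.
- by move=> x; exact: ler_normD.
- exact: measurableT_comp.
- exact: measurableT_comp.
Qed.

Lemma conditionableRN (f : X -> R) : conditionableR f ->
  conditionableR (fun x => - f x).
Proof.
move=> [mf fi]; split; first exact: measurableT_comp.
by rewrite [X in EFin \o X](_ : _ = (fun x => `|f x|))//; apply/funext => x; rewrite normrN.
Qed.

Lemma fexpM (m f : X -> R) : measurable_fun [set: XA] m -> measurable_fun setT f ->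
  (forall x, 0 <= m x) -> (forall x, 0 <= f x) ->
  {ae mu, forall x, (E f x < +oo)%E} ->
  {ae mu, forall x, (E (fun x => m x * f x) x < +oo)%E /\
     fexp (fun x => m x * f x) x = m x * fexp f x}.
Proof.
move=> mm mf m0 f0; apply: aeS2 (cond_expM hA mm mf m0 f0) => x e fo.
rewrite /fexp e; split; first by rewrite lte_mul_pinfty// lee_fin.
by rewrite fineM// ge0_fin_numE// cond_exp_ge0.
Qed.

Lemma cond_expRM (m f : X -> R) : measurable_fun [set: XA] m -> conditionableR f ->
  {ae mu, forall x, ER (fun x => m x * f x) x = m x * ER f x}.
Proof.
move=> mm cf.
have [fp fn] := conditionableR_parts cf; have [mf _] := cf.
have mfp : measurable_fun setT f^\+ by exact: measurable_funrpos.
have mfn : measurable_fun setT f^\- by exact: measurable_funrneg.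
have mmp : measurable_fun [set: XA] m^\+ by exact: measurable_funrpos.
have mmn : measurable_fun [set: XA] m^\- by exact: measurable_funrneg.
have mmpX := subalg_measurable_fun hA mmp.
have mmnX := subalg_measurable_fun hA mmn.
have pp := fexpM mmp mfp (funrpos_ge0 m) (funrpos_ge0 f) fp.
have pn := fexpM mmp mfn (funrpos_ge0 m) (funrneg_ge0 f) fn.
have np := fexpM mmn mfp (funrneg_ge0 m) (funrpos_ge0 f) fp.
have nn := fexpM mmn mfn (funrneg_ge0 m) (funrneg_ge0 f) fn.
have Mpp := measurable_funM mmpX mfp.
have Mpn := measurable_funM mmpX mfn.
have Mnp := measurable_funM mmnX mfp.
have Mnn := measurable_funM mmnX mfn.
have Gpp x := mulr_ge0 (funrpos_ge0 m x) (funrpos_ge0 f x).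
have Gpn x := mulr_ge0 (funrpos_ge0 m x) (funrneg_ge0 f x).
have Gnp x := mulr_ge0 (funrneg_ge0 m x) (funrpos_ge0 f x).
have Gnn x := mulr_ge0 (funrneg_ge0 m x) (funrneg_ge0 f x).
have Fpp := aeS (fun x => @proj1 _ _) pp.
have Fpn := aeS (fun x => @proj1 _ _) pn.
have Fnp := aeS (fun x => @proj1 _ _) np.
have Fnn := aeS (fun x => @proj1 _ _) nn.
have := @cond_expR_of_parts (fun x => m x * f x)
  (fun x => m^\+ x * f^\+ x + m^\- x * f^\- x)
  (fun x => m^\+ x * f^\- x + m^\- x * f^\+ x)
  (measurable_funD Mpp Mnn) (measurable_funD Mpn Mnp)
  (fun x => addr_ge0 (Gpp x) (Gnn x)) (fun x => addr_ge0 (Gpn x) (Gnp x))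
  (cond_exp_ltyD Mpp Mnn Gpp Gnn Fpp Fnn) (cond_exp_ltyD Mpn Mnp Gpn Gnp Fpn Fnp).
have e : (fun x => m x * f x) = (fun x => m^\+ x * f^\+ x + m^\- x * f^\- x -
    (m^\+ x * f^\- x + m^\- x * f^\+ x)).
  by apply/funext => x; rewrite -[in LHS](funrposBneg f) -[in LHS](funrposBneg m) /= !fctE; ring.
move=> /(_ e).
have D1 := fexpD Mpp Mnn Gpp Gnn Fpp Fnn.
have D2 := fexpD Mpn Mnp Gpn Gnp Fpn Fnp.
apply: aeS2 (aeI (aeI pp pn) (aeI (aeI np nn) (aeI D1 D2))) => x.
move=> [[[_ e1] [_ e2]] [[[_ e3] [_ e4]] [-> ->]]] ->.
rewrite e1 e2 e3 e4 /cond_expR -!/(fexp _ _) -[X in _ = X x * _](funrposBneg m) !fctE; ring.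
Qed.

Lemma cond_expR_le (f : X -> R) : conditionableR f ->
  {ae mu, forall x, `|ER f x| <= fexp (fun x => `|f x|) x}.
Proof.
move=> cf; have [fp fn] := conditionableR_parts cf; have [mf _] := cf.
have mfp : measurable_fun setT f^\+ by exact: measurable_funrpos.
have mfn : measurable_fun setT f^\- by exact: measurable_funrneg.
have := fexpD mfp mfn (funrpos_ge0 f) (funrneg_ge0 f) fp fn.
have -> : (fun x => f^\+ x + f^\- x) = (fun x => `|f x|).
  by rewrite -[RHS]/(Num.norm \o f) -funrposDneg.
apply: aeS => x ->; rewrite /cond_expR -!/(fexp _ _).
apply: le_trans (ler_normB _ _) _.
by rewrite !ger0_norm// fexp_ge0.
Qed.

(** The version chosen for the zero function vanishes only almost everywhere, hence the
    correction term. *)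
Lemma cond_expR_ge0E (f : X -> R) x : (forall x, 0 <= f x) -> measurable_fun setT f ->
  ER f x = fexp f x - fexp (cst 0) x.
Proof.
move=> f0 mf; rewrite /cond_expR.
have -> : f^\+ = f by apply/funext => y; rewrite /funrpos; exact/max_idPl.
have -> // : f^\- = cst 0.
by apply/funext => y; rewrite /funrneg; apply/max_idPr; rewrite oppr_le0.
Qed.

Lemma integrable_cond_exp_lty (f : X -> R) : measurable_fun setT f ->
  (forall x, 0 <= f x) -> mu.-integrable setT (EFin \o f) ->
  {ae mu, forall x, (E f x < +oo)%E} /\ mu.-integrable setT (EFin \o fexp f) /\
  (\int[mu]_x (f x)%:E = \int[mu]_x (fexp f x)%:E)%E.
Proof.
move=> mf f0 fi.
have mE := subalg_measurable_fun hA (@measurable_cond_exp _ _ _ mu A (EFin \o f)).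
have iE : mu.-integrable setT (E f).
  apply/integrableP; split => //.
  under eq_integral do rewrite gee0_abs ?cond_exp_ge0//.
  by rewrite -(cond_exp_integralT hA)//; exact: integrable_lty.
have fin : {ae mu, forall x, (E f x < +oo)%E}.
  apply: aeS (integrable_ae measurableT iE) => x /(_ I).
  by rewrite ge0_fin_numE// cond_exp_ge0.
have mfe : measurable_fun setT (EFin \o fexp f).
  by apply/measurable_EFinP/(subalg_measurable_fun hA); exact: measurable_fexp.
have e : ae_eq mu setT (E f) (EFin \o fexp f).
  by apply: aeS fin => x fo _; rewrite fexpK.
split => //; split.
  exact: integrable_ae_eq iE.
by rewrite (cond_exp_integralT hA)//; apply: ae_eq_integral.
Qed.

Lemma integrable_cond_expR (f : X -> R) : mu.-integrable setT (EFin \o f) ->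
  conditionableR f /\ mu.-integrable setT (EFin \o ER f) /\
  (\int[mu]_x (ER f x)%:E = \int[mu]_x (f x)%:E)%E.
Proof.
move=> fi.
have mf : measurable_fun setT f by apply/measurable_EFinP; exact: measurable_int fi.
have mfp : measurable_fun setT f^\+ by exact: measurable_funrpos.
have mfn : measurable_fun setT f^\- by exact: measurable_funrneg.
have fpi : mu.-integrable setT (EFin \o f^\+) by exact: integrable_funrpos.
have fni : mu.-integrable setT (EFin \o f^\-) by exact: integrable_funrneg.
have [_ [pi pI]] := integrable_cond_exp_lty mfp (funrpos_ge0 f) fpi.
have [_ [ni nI]] := integrable_cond_exp_lty mfn (funrneg_ge0 f) fni.
split.
  split => //.
  have [] // := @integrable_cond_exp_lty (fun x => `|f x|) _ _ _.
  - exact: measurableT_comp.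
  - exact: integrable_norm.
have e : EFin \o ER f = (fun x => (fexp f^\+ x)%:E - (fexp f^\- x)%:E)%E by [].
split.
  by rewrite e; exact: integrableB.
rewrite [LHS](_ : _ = \int[mu]_x ((fexp f^\+ x)%:E - (fexp f^\- x)%:E))%E//.
rewrite integralB_EFin// -pI -nI -integralB_EFin//.
by apply: eq_integral => x _; rewrite -EFinB -[in RHS](funrposBneg f).
Qed.

End cond_expR_theory.

(** * Conditional expectation of complex functions *)

Section complex_facts.
Context {R : realType}.
Implicit Types z w : R[i].
Local Notation Re := complex.Re.
Local Notation Im := complex.Im.

Lemma normc_sqr z : Normc.normc z ^+ 2 = Re z ^+ 2 + Im z ^+ 2.
Proof. by case: z => a b /=; rewrite sqr_sqrtr// addr_ge0// sqr_ge0. Qed.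

Lemma normc_ge0' z : 0 <= Normc.normc z.
Proof. by case: z => a b /=; exact: sqrtr_ge0. Qed.

Lemma normr_Re_le z : `|Re z| <= Normc.normc z.
Proof.
rewrite -(@ler_pXn2r _ 2)// ?nnegrE ?normc_ge0'// normc_sqr real_normK ?num_real//.
by rewrite lerDl sqr_ge0.
Qed.

Lemma normr_Im_le z : `|Im z| <= Normc.normc z.
Proof.
rewrite -(@ler_pXn2r _ 2)// ?nnegrE ?normc_ge0'// normc_sqr real_normK ?num_real//.
by rewrite lerDr sqr_ge0.
Qed.

Lemma normc_le_ReIm z : Normc.normc z <= `|Re z| + `|Im z|.
Proof.
rewrite -(@ler_pXn2r _ 2)// ?nnegrE ?normc_ge0' ?addr_ge0// normc_sqr.
rewrite -[Re z ^+ 2]real_normK ?num_real// -[Im z ^+ 2]real_normK ?num_real//.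
have := normr_ge0 (Re z); have := normr_ge0 (Im z); nra.
Qed.

Lemma normcM' z w : Normc.normc (z * w) = Normc.normc z * Normc.normc w.
Proof. exact: Normc.normcM. Qed.

Lemma conjcE z : z^* = conjc z. Proof. by []. Qed.

Lemma normc_conjc z : Normc.normc (z^*) = Normc.normc z.
Proof. by rewrite conjcE; case: z => a b /=; rewrite sqrrN. Qed.

Lemma normc_real (r : R) : Normc.normc r%:C = `|r|.
Proof. by rewrite /= expr0n addr0 sqrtr_sqr. Qed.

Lemma normc_eq0P z : Normc.normc z = 0 <-> z = 0.
Proof. by split; [exact: Normc.eq0_normc|move=> ->; exact: Normc.normc0]. Qed.

Lemma Re_mulc z w : Re (z * w) = Re z * Re w - Im z * Im w.
Proof. by case: z w => a b [c e]. Qed.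

Lemma Im_mulc z w : Im (z * w) = Re z * Im w + Im z * Re w.
Proof. by case: z w => a b [c e]. Qed.

Lemma Re_addc z w : Re (z + w) = Re z + Re w.
Proof. by case: z w => a b [c e]. Qed.

Lemma Im_addc z w : Im (z + w) = Im z + Im w.
Proof. by case: z w => a b [c e]. Qed.

Lemma Re_conjc z : Re z^* = Re z. Proof. by rewrite conjcE; case: z. Qed.

Lemma Im_conjc z : Im z^* = - Im z. Proof. by rewrite conjcE; case: z. Qed.

Lemma eqc_ReIm z w : Re z = Re w -> Im z = Im w -> z = w.
Proof. by case: z w => a b [c e] /= -> ->. Qed.

Lemma conjcM z w : (z * w)^* = z^* * w^*.
Proof. exact: rmorphM. Qed.

Lemma mulc_conj z : z * z^* = (Normc.normc z ^+ 2)%:C.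
Proof.
rewrite normc_sqr; apply: eqc_ReIm; rewrite ?Re_mulc ?Im_mulc ?Re_conjc ?Im_conjc /=; ring.
Qed.

Lemma normcD_sqr_le z w :
  Normc.normc (z + w) ^+ 2 <= 2 * Normc.normc z ^+ 2 + 2 * Normc.normc w ^+ 2.
Proof.
rewrite !normc_sqr Re_addc Im_addc.
have := sqr_ge0 (Re z - Re w); have := sqr_ge0 (Im z - Im w); nra.
Qed.

End complex_facts.

Section cmeasurable_theory.
Context {d : measure_display} {X : measurableType d} {R : realType}.
Implicit Types f g : X -> R[i].

Lemma cmeasurable_cst (c : R[i]) : cmeasurable (fun _ : X => c).
Proof. by split; exact: measurable_cst. Qed.

Lemma cmeasurableD f g : cmeasurable f -> cmeasurable g ->
  cmeasurable (fun x => f x + g x).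
Proof.
move=> [f1 f2] [g1 g2]; split.
  by under eq_fun do rewrite Re_addc; exact: measurable_funD.
by under eq_fun do rewrite Im_addc; exact: measurable_funD.
Qed.

Lemma cmeasurableM f g : cmeasurable f -> cmeasurable g ->
  cmeasurable (fun x => f x * g x).
Proof.
move=> [f1 f2] [g1 g2]; split.
  by under eq_fun do rewrite Re_mulc; apply: measurable_funB; exact: measurable_funM.
by under eq_fun do rewrite Im_mulc; apply: measurable_funD; exact: measurable_funM.
Qed.

Lemma cmeasurable_conj f : cmeasurable f -> cmeasurable (fun x => (f x)^*).
Proof.
move=> [f1 f2]; split; first by under eq_fun do rewrite Re_conjc.
by under eq_fun do rewrite Im_conjc; exact: measurableT_comp.
Qed.

Lemma cmeasurable_real (r : X -> R) : measurable_fun setT r ->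
  cmeasurable (fun x => (r x)%:C).
Proof. by move=> mr; split => //=; exact: measurable_cst. Qed.

Lemma cmeasurableN f : cmeasurable f -> cmeasurable (fun x => - f x).
Proof.
move=> mf; under eq_fun do rewrite -mulN1r.
by apply: cmeasurableM => //; exact: cmeasurable_cst.
Qed.

Lemma cmeasurableB f g : cmeasurable f -> cmeasurable g ->
  cmeasurable (fun x => f x - g x).
Proof. by move=> mf mg; apply: cmeasurableD => //; exact: cmeasurableN. Qed.

Lemma measurable_cmod_sqr f : cmeasurable f -> measurable_fun setT (fun x => cmod f x ^+ 2).
Proof.
move=> [f1 f2]; under eq_fun do rewrite /cmod normc_sqr.
by apply: measurable_funD; apply: measurable_funX.
Qed.

Lemma measurable_cmod f : cmeasurable f -> measurable_fun setT (cmod f).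
Proof.
move=> mf; rewrite (_ : cmod f = (fun x => Num.sqrt (cmod f x ^+ 2))).
  apply: measurableT_comp; last exact: measurable_cmod_sqr.
  apply: nondecreasing_measurable => //.
  by move=> x y; exact: ler_wsqrtr.
by apply/funext => x; rewrite sqrtr_sqr ger0_norm// normc_ge0'.
Qed.

End cmeasurable_theory.

Section cond_expC_theory.
Context {d : measure_display} {X : measurableType d} {R : realType}.
Variables (mu : {measure set X -> \bar R}) (A : set (set X)).
Hypothesis hA : sigma_finite_subalgebra mu A.
Local Notation XA := (g_sigma_algebraType A).
Local Notation Re := complex.Re.
Local Notation Im := complex.Im.
Local Notation E f := (cond_exp mu A (EFin \o f%R)).
Local Notation EC := (cond_expC mu A).
Local Notation "'Acmeasurable' f" := (@cmeasurable _ XA R f) (at level 10).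
Implicit Types f g m : X -> R[i].

Lemma subalg_cmeasurable f : Acmeasurable f -> cmeasurable f.
Proof. by move=> [? ?]; split; exact: (subalg_measurable_fun hA). Qed.

Lemma conditionable_ReIm f : conditionable mu A f ->
  conditionableR mu A (fun x => Re (f x)) /\ conditionableR mu A (fun x => Im (f x)).
Proof.
move=> [mf fi]; have [f1 f2] := mf; split; split => //; apply: cond_exp_lty_le fi => //.
- exact: measurableT_comp.
- exact: measurable_cmod.
- by move=> x; exact: normr_Re_le.
- exact: measurableT_comp.
- exact: measurable_cmod.
- by move=> x; exact: normr_Im_le.
Qed.

Lemma conditionable_of_ReIm f : conditionableR mu A (fun x => Re (f x)) ->
  conditionableR mu A (fun x => Im (f x)) -> conditionable mu A f.
Proof.
move=> [f1 i1] [f2 i2]; split => //.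
apply: cond_exp_lty_le (cond_exp_ltyD hA _ _ _ _ i1 i2) => //.
- by apply: measurable_cmod.
- by apply: measurable_funD; exact: measurableT_comp.
- by move=> x; exact: normc_ge0'.
- by move=> x; exact: normc_le_ReIm.
- exact: measurableT_comp.
- exact: measurableT_comp.
Qed.

Lemma measurable_cond_expC f : Acmeasurable (EC f).
Proof. by split; exact: measurable_cond_expR. Qed.

Lemma conditionableD f g : conditionable mu A f -> conditionable mu A g ->
  conditionable mu A (fun x => f x + g x).
Proof.
move=> /conditionable_ReIm[f1 f2] /conditionable_ReIm[g1 g2].
apply: conditionable_of_ReIm.
  by under eq_fun do rewrite Re_addc; exact: conditionableRD.
by under eq_fun do rewrite Im_addc; exact: conditionableRD.
Qed.

Lemma conditionableM m f : Acmeasurable m -> conditionable mu A f ->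
  conditionable mu A (fun x => m x * f x).
Proof.
move=> [m1 m2] /conditionable_ReIm[f1 f2].
apply: conditionable_of_ReIm.
  under eq_fun do rewrite Re_mulc; apply: conditionableRD; first exact: hA.
    exact: conditionableRM.
  by apply: conditionableRN; apply: conditionableRM.
by under eq_fun do rewrite Im_mulc; apply: conditionableRD; first exact: hA;
  apply: conditionableRM.
Qed.

Lemma conditionable_conj f : conditionable mu A f ->
  conditionable mu A (fun x => (f x)^*).
Proof.
move=> [mf fi]; split; first exact: cmeasurable_conj.
rewrite (_ : cmod _ = cmod f)//.
by apply/funext => x; rewrite /cmod normc_conjc.
Qed.

Lemma conditionable_le f (b : X -> R) : cmeasurable f -> measurable_fun setT b ->
  (forall x, cmod f x <= b x) -> {ae mu, forall x, (E b x < +oo)%E} ->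
  conditionable mu A f.
Proof.
move=> mf mb fb bi; split => //; apply: cond_exp_lty_le bi => //.
  exact: measurable_cmod.
by move=> x; exact: normc_ge0'.
Qed.

Lemma cond_expCD f g : conditionable mu A f -> conditionable mu A g ->
  {ae mu, forall x, EC (fun x => f x + g x) x = EC f x + EC g x}.
Proof.
move=> /conditionable_ReIm[f1 f2] /conditionable_ReIm[g1 g2].
apply: aeS2 (cond_expRD hA f1 g1) (cond_expRD hA f2 g2) => x e1 e2.
rewrite /cond_expC; apply: eqc_ReIm => /=.
  by under eq_fun do rewrite Re_addc.
by under eq_fun do rewrite Im_addc.
Qed.

Lemma cond_expCM m f : Acmeasurable m -> conditionable mu A f ->
  {ae mu, forall x, EC (fun x => m x * f x) x = m x * EC f x}.
Proof.
move=> [m1 m2] /conditionable_ReIm[f1 f2].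
have D1 := cond_expRD hA (conditionableRM hA m1 f1) (conditionableRN (conditionableRM hA m2 f2)).
have D2 := cond_expRD hA (conditionableRM hA m1 f2) (conditionableRM hA m2 f1).
apply: aeS3 (aeI D1 D2) (aeI (cond_expRM hA m1 f1) (cond_expRM hA m2 f2))
  (aeI (cond_expRM hA m1 f2) (cond_expRM hA m2 f1)) => x [d1 d2] [e11 e22] [e12 e21].
rewrite /cond_expC; apply: eqc_ReIm.
  rewrite Re_mulc /=; under eq_fun do rewrite Re_mulc.
  by rewrite d1 cond_expRN e11 e22.
rewrite Im_mulc /=; under eq_fun do rewrite Im_mulc.
by rewrite d2 e12 e21.
Qed.

Lemma cond_expC_conj f x : EC (fun x => (f x)^*) x = (EC f x)^*.
Proof.
rewrite /cond_expC; apply: eqc_ReIm => /=.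
  by under eq_fun do rewrite Re_conjc.
by under eq_fun do rewrite Im_conjc; rewrite cond_expRN.
Qed.

(** The factor 2 comes from estimating the real and imaginary parts separately. *)
Lemma cond_expC_le f : conditionable mu A f ->
  {ae mu, forall x, cmod (EC f) x <= 2 * fexp mu A (cmod f) x}.
Proof.
move=> cf; have [mf fi] := cf; have [f1 f2] := mf.
have [c1 c2] := conditionable_ReIm cf.
have mm := measurable_cmod mf.
have L1 := cond_exp_le hA (f := fun x => `|Re (f x)|) (g := cmod f)
  (measurableT_comp (@normr_measurable _ _) f1) mm
  (fun x => normr_ge0 _) (fun x => normc_ge0' _) (aeW mu (fun x => normr_Re_le (f x))).
have L2 := cond_exp_le hA (f := fun x => `|Im (f x)|) (g := cmod f)
  (measurableT_comp (@normr_measurable _ _) f2) mm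
  (fun x => normr_ge0 _) (fun x => normc_ge0' _) (aeW mu (fun x => normr_Im_le (f x))).
apply: aeS3 (aeI L1 L2) (aeI (cond_expR_le hA c1) (cond_expR_le hA c2)) fi.
move=> x [l1 l2] [b1 b2] fo.
have up (h : X -> R) : (E h x <= E (cmod f) x)%E -> fexp mu A h x <= fexp mu A (cmod f) x.
  by move=> le; apply: fine_le; rewrite ?ge0_fin_numE ?cond_exp_ge0//; exact: le_lt_trans fo.
apply: le_trans (normc_le_ReIm _) _; rewrite mulr_natl mulr2n.
by apply: lerD; [exact: le_trans b1 (up _ l1)|exact: le_trans b2 (up _ l2)].
Qed.

Lemma fexp_cst0 : {ae mu, forall x, fexp mu A (cst 0) x = 0}.
Proof.
apply: aeS (cond_expM hA (m := cst 0) (f := cst 0) _ _ _ _) => //.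
move=> x; rewrite /fexp.
by rewrite (_ : (fun x => _) = cst 0) => [->|]; rewrite ?mul0e//; apply/funext => y; rewrite /= mul0r.
Qed.

Lemma cond_expC_real (r : X -> R) : measurable_fun setT r -> (forall x, 0 <= r x) ->
  {ae mu, forall x, EC (fun x => (r x)%:C) x = (fexp mu A r x)%:C}.
Proof.
move=> mr r0; apply: aeS fexp_cst0 => x z.
rewrite /cond_expC /=; apply: eqc_ReIm => /=.
  by rewrite cond_expR_ge0E// z subr0.
by rewrite -[fun=> 0]/(cst 0) cond_expR_ge0E// z subr0.
Qed.

Lemma conditionable_ae_congr f g : cmeasurable f -> cmeasurable g ->
  {ae mu, forall x, f x = g x} -> conditionable mu A f -> conditionable mu A g.
Proof.
move=> mf mg fg [_ fi]; split => //.
rewrite -(cond_exp_ae_congr hA (f := EFin \o cmod f))//.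
- by apply/measurable_EFinP; exact: measurable_cmod.
- by apply/measurable_EFinP; exact: measurable_cmod.
- by move=> x; rewrite lee_fin normc_ge0'.
- by move=> x; rewrite lee_fin normc_ge0'.
- by apply: aeS fg => x fg; rewrite /= /cmod fg.
Qed.

Lemma cond_expR_ae_congr (f g : X -> R) : measurable_fun setT f -> measurable_fun setT g ->
  {ae mu, forall x, f x = g x} -> cond_expR mu A f = cond_expR mu A g.
Proof.
move=> mf mg fg; rewrite /cond_expR.
rewrite (cond_exp_ae_congr hA (f := EFin \o f^\+) (g := EFin \o g^\+)).
rewrite (cond_exp_ae_congr hA (f := EFin \o f^\-) (g := EFin \o g^\-))//.
- by apply/measurable_EFinP; exact: measurable_funrneg.
- by apply/measurable_EFinP; exact: measurable_funrneg.
- by move=> x; rewrite lee_fin funrneg_ge0.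
- by move=> x; rewrite lee_fin funrneg_ge0.
- by apply: aeS fg => x fg; rewrite /funrneg /= fg.
- by apply/measurable_EFinP; exact: measurable_funrpos.
- by apply/measurable_EFinP; exact: measurable_funrpos.
- by move=> x; rewrite lee_fin funrpos_ge0.
- by move=> x; rewrite lee_fin funrpos_ge0.
- by apply: aeS fg => x fg; rewrite /funrpos /= fg.
Qed.

Lemma cond_expC_ae_congr f g : cmeasurable f -> cmeasurable g ->
  {ae mu, forall x, f x = g x} -> EC f = EC g.
Proof.
move=> [f1 f2] [g1 g2] fg; rewrite /cond_expC.
rewrite (cond_expR_ae_congr f1 g1); last by apply: aeS fg => x ->.
by rewrite (cond_expR_ae_congr f2 g2)//; apply: aeS fg => x ->.
Qed.

Definition cintegrable f : Prop :=
  mu.-integrable setT (fun x => (Re (f x))%:E) /\ mu.-integrable setT (fun x => (Im (f x))%:E).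

Lemma cintegrable_cond_expC f : cintegrable f ->
  conditionable mu A f /\ cintegrable (EC f) /\ cintegral mu (EC f) = cintegral mu f.
Proof.
move=> [i1 i2].
have [c1 [e1 I1]] := integrable_cond_expR hA i1.
have [c2 [e2 I2]] := integrable_cond_expR hA i2.
split; first exact: conditionable_of_ReIm.
split; first by [].
by rewrite /cintegral /Rintegral I1 I2.
Qed.

End cond_expC_theory.

(** * Square-integrable functions *)

Section L2_theory.
Context {d : measure_display} {X : measurableType d} {R : realType}.
Variable mu : {measure set X -> \bar R}.
Local Notation Re := complex.Re.
Local Notation Im := complex.Im.
Implicit Types f g h : X -> R[i].
Local Notation L2 := (L2 mu).
Local Notation dot := (dot mu).
Local Notation cintegrable := (cintegrable mu).

Definition sqnorm f : R := \int[mu]_x (cmod f x) ^+ 2.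

Lemma L2_cmeasurable f : L2 f -> cmeasurable f. Proof. by case. Qed.

Lemma cmod_sqr_ge0 f x : (0 <= ((cmod f x) ^+ 2)%:E)%E.
Proof. by rewrite lee_fin sqr_ge0. Qed.

Lemma L2_integrable f : L2 f -> mu.-integrable setT (fun x => ((cmod f x) ^+ 2)%:E).
Proof.
move=> [mf fi]; apply/integrableP; split.
  by apply/measurable_EFinP; exact: measurable_cmod_sqr.
by under eq_integral do rewrite gee0_abs ?cmod_sqr_ge0//.
Qed.

Lemma sqnorm_ge0 f : 0 <= sqnorm f.
Proof. by rewrite fine_ge0//; apply: integral_ge0 => x _; exact: cmod_sqr_ge0. Qed.

Lemma sqnormE f : L2 f -> (\int[mu]_x ((cmod f x) ^+ 2)%:E = (sqnorm f)%:E)%E.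
Proof.
move=> Lf; rewrite /sqnorm /Rintegral fineK//.
by apply: integrable_fin_num => //; exact: L2_integrable.
Qed.

Lemma sqnorm_congr f g : (\int[mu]_x ((cmod f x) ^+ 2)%:E = \int[mu]_x ((cmod g x) ^+ 2)%:E)%E ->
  sqnorm f = sqnorm g.
Proof. by rewrite /sqnorm /Rintegral => ->. Qed.

Lemma sqnorm_integral0 f : (\int[mu]_x ((cmod f x) ^+ 2)%:E = 0)%E -> sqnorm f = 0.
Proof. by rewrite /sqnorm /Rintegral => ->. Qed.

Lemma l2norm_sqr f : l2norm mu f ^+ 2 = sqnorm f.
Proof. by rewrite /l2norm sqr_sqrtr// sqnorm_ge0. Qed.

Lemma L2_le_integrable f (b : X -> R) : cmeasurable f ->
  mu.-integrable setT (EFin \o b) ->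
  {ae mu, forall x, cmod f x ^+ 2 <= b x} -> L2 f.
Proof.
move=> mf bi fb; split => //.
have mb : measurable_fun setT (EFin \o b) by exact: measurable_int bi.
apply: (@le_lt_trans _ _ (\int[mu]_x `|(b x)%:E|)%E).
  apply: ae_ge0_le_integral => //.
  - by move=> x _; exact: cmod_sqr_ge0.
  - by apply/measurable_EFinP; exact: measurable_cmod_sqr.
  - exact: measurableT_comp.
  - apply: aeS fb => x fb _; rewrite lee_fin.
    exact: le_trans (ler_norm _).
by case/integrableP : bi.
Qed.

Lemma L2_le (c : R) f g : cmeasurable f -> L2 g ->
  {ae mu, forall x, cmod f x ^+ 2 <= c * cmod g x ^+ 2} -> L2 f.
Proof.
move=> mf Lg; apply: (L2_le_integrable mf).
have := integrableZl measurableT c (L2_integrable Lg).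
by apply: eq_integrable => // x _; rewrite -EFinM.
Qed.

Lemma L2_ae_congr f g : cmeasurable g -> {ae mu, forall x, f x = g x} -> L2 f -> L2 g.
Proof.
move=> mg fg Lf; apply: (@L2_le 1 g f mg Lf).
by apply: aeS fg => x fg; rewrite /cmod fg mul1r.
Qed.

Lemma L2D f g : L2 f -> L2 g -> L2 (fun x => f x + g x).
Proof.
move=> Lf Lg.
have i1 := integrableZl measurableT 2 (L2_integrable Lf).
have i2 := integrableZl measurableT 2 (L2_integrable Lg).
apply: (@L2_le_integrable _ (fun x => 2 * cmod f x ^+ 2 + 2 * cmod g x ^+ 2)).
- by apply: cmeasurableD; [case: Lf|case: Lg].
- have := integrableD measurableT i1 i2.
  by apply: eq_integrable => // x _ /=; rewrite -!EFinM -EFinD.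
- by apply: aeW => x; exact: normcD_sqr_le.
Qed.

Lemma L2Z (c : R[i]) f : L2 f -> L2 (fun x => c * f x).
Proof.
move=> Lf; apply: (@L2_le (Normc.normc c ^+ 2) _ f) => //.
  by apply: cmeasurableM; [exact: cmeasurable_cst|case: Lf].
by apply: aeW => x; rewrite /cmod normcM' exprMn.
Qed.

Lemma L2N f : L2 f -> L2 (fun x => - f x).
Proof. by move=> Lf; under eq_fun do rewrite -mulN1r; exact: L2Z. Qed.

Lemma L2B f g : L2 f -> L2 g -> L2 (fun x => f x - g x).
Proof. by move=> Lf Lg; apply: L2D => //; exact: L2N. Qed.

Lemma L20 : L2 (cst 0).
Proof.
split; first exact: cmeasurable_cst.
rewrite integral0_eq// => x _.
by rewrite /cmod Normc.normc0 expr0n.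
Qed.

Lemma L2_bounded_mul (c : R) (m f : X -> R[i]) : cmeasurable m -> L2 f ->
  (forall x, Normc.normc (m x) <= c) -> L2 (fun x => m x * f x).
Proof.
move=> mm Lf mc; apply: (@L2_le (c ^+ 2) _ f) => //.
  by apply: cmeasurableM => //; case: Lf.
apply: aeW => x; rewrite /cmod normcM' exprMn ler_wpM2r ?sqr_ge0//.
by rewrite ler_sqr ?nnegrE ?normc_ge0'//; exact: le_trans (normc_ge0' _) (mc x).
Qed.

Lemma L2_indic (B : set X) f : measurable B -> L2 f ->
  L2 (fun x => (\1_B x)%:C * f x).
Proof.
move=> mB Lf; apply: (@L2_bounded_mul 1) => //.
  exact/cmeasurable_real/measurable_indic.
by move=> x; rewrite normc_real ger0_norm// indicE; case: (_ \in _) => //.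
Qed.

Lemma cintegrable_le f (b : X -> R) : cmeasurable f ->
  mu.-integrable setT (EFin \o b) -> (forall x, cmod f x <= b x) -> cintegrable f.
Proof.
move=> [f1 f2] bi fb; split.
  apply: le_integrable bi => //; first exact/measurable_EFinP.
  move=> x _ /=; rewrite lee_fin (le_trans (normr_Re_le _))//.
  by rewrite (le_trans (fb x))// ler_norm.
apply: le_integrable bi => //; first exact/measurable_EFinP.
move=> x _ /=; rewrite lee_fin (le_trans (normr_Im_le _))//.
by rewrite (le_trans (fb x))// ler_norm.
Qed.

Lemma cintegrable_mul_conj f g : L2 f -> L2 g -> cintegrable (fun x => f x * (g x)^*).
Proof.
move=> Lf Lg.
apply: (@cintegrable_le _ (fun x => cmod f x ^+ 2 + cmod g x ^+ 2)).
- by apply: cmeasurableM; [case: Lf|apply: cmeasurable_conj; case: Lg].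
- have := integrableD measurableT (L2_integrable Lf) (L2_integrable Lg).
  by apply: eq_integrable => // x _ /=; rewrite -EFinD.
- move=> x; rewrite /cmod normcM' normc_conjc.
  have := normc_ge0' (f x); have := normc_ge0' (g x).
  have := sqr_ge0 (Normc.normc (f x) - Normc.normc (g x)); nra.
Qed.

Lemma cintegrable_cmeasurable f : cintegrable f -> cmeasurable f.
Proof. by move=> [/measurable_int/measurable_EFinP ? /measurable_int/measurable_EFinP ?]. Qed.

Lemma cintegralD f g : cintegrable f -> cintegrable g ->
  cintegral mu (fun x => f x + g x) = cintegral mu f + cintegral mu g.
Proof.
move=> [f1 f2] [g1 g2]; apply: eqc_ReIm => /=.
  by under eq_Rintegral do rewrite Re_addc; rewrite RintegralD.
by under eq_Rintegral do rewrite Im_addc; rewrite RintegralD.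
Qed.

Lemma cintegralZ (c : R[i]) f : cintegrable f ->
  cintegral mu (fun x => c * f x) = c * cintegral mu f.
Proof.
move=> [f1 f2]; have Z (r : R) (h : X -> R) : mu.-integrable setT (EFin \o h) ->
  mu.-integrable setT (EFin \o (fun x => r * h x)).
  by move=> ih; apply: eq_integrable (integrableZl measurableT r ih) => // x _.
apply: eqc_ReIm; rewrite ?Re_mulc ?Im_mulc /=.
  under eq_Rintegral do rewrite Re_mulc.
  by rewrite RintegralB ?RintegralZl//; exact: Z.
under eq_Rintegral do rewrite Im_mulc.
by rewrite RintegralD ?RintegralZl//; exact: Z.
Qed.

Lemma cintegral_ae_congr f g : cmeasurable f -> cmeasurable g ->
  {ae mu, forall x, f x = g x} -> cintegral mu f = cintegral mu g.
Proof.
move=> [f1 f2] [g1 g2] fg; rewrite /cintegral /Rintegral.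
congr (fine _ +i* fine _); apply: ae_eq_integral => //.
- exact/measurable_EFinP.
- exact/measurable_EFinP.
- by apply: aeS fg => x ->.
- exact/measurable_EFinP.
- exact/measurable_EFinP.
- by apply: aeS fg => x ->.
Qed.

Lemma cintegral_conj f : cintegrable f ->
  cintegral mu (fun x => (f x)^*) = (cintegral mu f)^*.
Proof.
move=> [f1 f2]; apply: eqc_ReIm => /=.
  by under eq_Rintegral do rewrite Re_conjc.
under eq_Rintegral do rewrite Im_conjc -mulN1r.
by rewrite RintegralZl// mulN1r.
Qed.

Lemma dotDl f g h : L2 f -> L2 g -> L2 h ->
  dot (fun x => f x + g x) h = dot f h + dot g h.
Proof.
move=> Lf Lg Lh; rewrite /dot -cintegralD; try exact: cintegrable_mul_conj.
by congr cintegral; apply/funext => x; rewrite mulrDl.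
Qed.

Lemma dotZl (c : R[i]) f g : L2 f -> L2 g -> dot (fun x => c * f x) g = c * dot f g.
Proof.
move=> Lf Lg; rewrite /dot -cintegralZ; last exact: cintegrable_mul_conj.
by congr cintegral; apply/funext => x; rewrite mulrA.
Qed.

Lemma dotC f g : L2 f -> L2 g -> dot g f = (dot f g)^*.
Proof.
move=> Lf Lg; rewrite /dot -cintegral_conj; last exact: cintegrable_mul_conj.
by congr cintegral; apply/funext => x; rewrite rmorphM/= conjCK mulrC.
Qed.

Lemma dotDr f g h : L2 f -> L2 g -> L2 h ->
  dot h (fun x => f x + g x) = dot h f + dot h g.
Proof.
move=> Lf Lg Lh; rewrite (dotC (L2D Lf Lg) Lh) dotDl// (dotC Lf Lh) (dotC Lg Lh).
exact: rmorphD.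
Qed.

Lemma dotZr (c : R[i]) f g : L2 f -> L2 g -> dot f (fun x => c * g x) = c^* * dot f g.
Proof.
move=> Lf Lg; by rewrite (dotC (L2Z c Lg) Lf) dotZl// rmorphM/= (dotC Lg Lf).
Qed.

Lemma dotBl f g h : L2 f -> L2 g -> L2 h ->
  dot (fun x => f x - g x) h = dot f h - dot g h.
Proof.
move=> Lf Lg Lh; under eq_fun do rewrite -mulN1r.
by rewrite dotDl ?dotZl ?mulN1r//; exact: L2Z.
Qed.

Lemma dotBr f g h : L2 f -> L2 g -> L2 h ->
  dot h (fun x => f x - g x) = dot h f - dot h g.
Proof.
move=> Lf Lg Lh; under eq_fun do rewrite -mulN1r.
by rewrite dotDr ?dotZr ?rmorphN1 ?mulN1r//; exact: L2Z.
Qed.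

Lemma dot_self f : L2 f -> dot f f = (sqnorm f)%:C.
Proof.
move=> Lf; rewrite /dot; under eq_fun do rewrite mulc_conj.
by rewrite /cintegral /= /sqnorm Rintegral_cst// mul0r.
Qed.

Lemma sqnorm_ae_congr f g : cmeasurable f -> cmeasurable g ->
  {ae mu, forall x, f x = g x} -> sqnorm f = sqnorm g.
Proof.
move=> mf mg fg; rewrite /sqnorm /Rintegral; congr fine; apply: ae_eq_integral => //.
- by apply/measurable_EFinP; exact: measurable_cmod_sqr.
- by apply/measurable_EFinP; exact: measurable_cmod_sqr.
- by apply: aeS fg => x fg _; rewrite /cmod fg.
Qed.

Lemma sqnorm_eq0 f : L2 f -> sqnorm f = 0 -> {ae mu, forall x, f x = 0}.
Proof.
move=> Lf f0; have := sqnormE Lf; rewrite f0 => I0.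
have mf : measurable_fun setT (fun x => ((cmod f x) ^+ 2)%:E).
  by apply/measurable_EFinP/measurable_cmod_sqr; case: Lf.
have : (\int[mu]_x `|((cmod f x) ^+ 2)%:E| = 0)%E.
  by under eq_integral do rewrite gee0_abs ?cmod_sqr_ge0//.
move=> /(ae_eq_integral_abs mu measurableT mf); apply: aeS => x /(_ I) [] /eqP.
by rewrite sqrf_eq0 => /eqP /normc_eq0P.
Qed.

Lemma sqnormZ (c : R[i]) f : L2 f ->
  sqnorm (fun x => c * f x) = Normc.normc c ^+ 2 * sqnorm f.
Proof.
move=> Lf; rewrite /sqnorm -RintegralZl//; last exact: L2_integrable.
by apply: eq_Rintegral => x _; rewrite /cmod normcM' exprMn.
Qed.

Lemma sqnorm0 : sqnorm (cst 0) = 0.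
Proof.
rewrite /sqnorm /cmod; under eq_Rintegral do rewrite Normc.normc0 expr0n.
by rewrite Rintegral_cst// mul0r.
Qed.

Lemma sqnormN f : sqnorm (fun x => - f x) = sqnorm f.
Proof. by apply: eq_Rintegral => x _; rewrite /cmod normcN. Qed.

Lemma le_sqnorm (c : R) f g : L2 f -> L2 g ->
  {ae mu, forall x, cmod f x ^+ 2 <= c * cmod g x ^+ 2} -> sqnorm f <= c * sqnorm g.
Proof.
move=> Lf Lg fg.
have ig := integrableZl measurableT c (L2_integrable Lg).
rewrite -lee_fin EFinM -!sqnormE// -integralZl//; last exact: L2_integrable.
pose b x := `|c * cmod g x ^+ 2|.
have mc : measurable_fun setT (fun x => (cmod g x ^+ 2)%:E).
  by apply/measurable_EFinP/measurable_cmod_sqr; case: Lg.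
rewrite (@ae_eq_integral _ _ _ mu setT (fun x => (b x)%:E)
    (fun x => (c%:E * (cmod g x ^+ 2)%:E)%E)) //.
- apply: ae_ge0_le_integral => //.
  + by move=> x _; exact: cmod_sqr_ge0.
  + by apply/measurable_EFinP/measurable_cmod_sqr; case: Lf.
  + by move=> x _; rewrite lee_fin normr_ge0.
  + apply/measurable_EFinP; apply: measurableT_comp => //.
    by apply: measurable_funM => //; exact/measurable_EFinP.
  + by apply: aeS fg => x fg _; rewrite lee_fin (le_trans fg)// ler_norm.
- exact: measurable_funeM.
- apply/measurable_EFinP; apply: measurableT_comp => //.
  by apply: measurable_funM => //; exact/measurable_EFinP.
- apply: aeS fg => x fg _; rewrite /b -EFinM ger0_norm//.
  exact: le_trans (sqr_ge0 _) fg.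
Qed.

Lemma sqnormD f g : L2 f -> L2 g ->
  sqnorm (fun x => f x + g x) = sqnorm f + 2 * Re (dot f g) + sqnorm g.
Proof.
move=> Lf Lg; have Lfg := L2D Lf Lg.
have := dot_self Lfg; rewrite dotDl// !dotDr// !dot_self// (dotC Lf Lg).
move=> /(congr1 (@complex.Re R)); rewrite !Re_addc Re_conjc /= => <-; ring.
Qed.

Lemma sqnormD_le f g : L2 f -> L2 g ->
  sqnorm (fun x => f x + g x) <= 2 * sqnorm f + 2 * sqnorm g.
Proof.
move=> Lf Lg; rewrite sqnormD//.
have := sqnorm_ge0 (fun x => f x - g x).
under [X in sqnorm X]eq_fun do rewrite -mulN1r.
rewrite sqnormD ?sqnormZ ?dotZr ?rmorphN1 ?mulN1r//; last exact: L2Z.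
rewrite normcN Normc.normc1 expr1n mul1r.
by case: (dot f g) => a b /=; lra.
Qed.

(** Nonnegativity of the squared norm of [f - t <f, g> g], for the best real [t]. *)
Lemma cauchy_schwarz f g : L2 f -> L2 g ->
  Normc.normc (dot f g) ^+ 2 <= sqnorm f * sqnorm g.
Proof.
move=> Lf Lg; set c := dot f g.
have key (t : R) : 0 <= sqnorm f - 2 * t * Normc.normc c ^+ 2 +
    t ^+ 2 * Normc.normc c ^+ 2 * sqnorm g.
  have := sqnorm_ge0 (fun x => f x + (- t%:C * c) * g x).
  rewrite sqnormD ?sqnormZ ?dotZr//; last exact: L2Z.
  rewrite -/c normcM' normcN normc_real exprMn real_normK ?num_real//.
  have -> : Re ((- t%:C * c)^* * c) = - t * Normc.normc c ^+ 2.
    by rewrite normc_sqr; case: (c) => a b /=; ring.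
  by move=> h; move: h; rewrite !mulrA; lra.
have n0 := sqnorm_ge0 f; have c0 := sqr_ge0 (Normc.normc c).
have [g0|g0] := eqVneq (sqnorm g) 0.
  have := key ((sqnorm f + 1) / Normc.normc c ^+ 2).
  have [->|cn] := eqVneq (Normc.normc c ^+ 2) 0; first by move=> _; rewrite g0 mulr0.
  by rewrite g0 mulr0 addr0 -mulrA divfK// => h; exfalso; lra.
have gpos : 0 < sqnorm g by rewrite lt_neqAle eq_sym g0 sqnorm_ge0.
have := key (sqnorm g)^-1.
have -> : (sqnorm g)^-1 ^+ 2 * Normc.normc c ^+ 2 * sqnorm g =
    (sqnorm g)^-1 * Normc.normc c ^+ 2 by field.
move=> h.
have {}h : 0 <= sqnorm f - Normc.normc c ^+ 2 / sqnorm g by move: h; lra.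
by move: h; rewrite subr_ge0 ler_pdivrMr.
Qed.

Lemma l2norm_ge0 f : 0 <= l2norm mu f. Proof. exact: sqrtr_ge0. Qed.

Lemma normc_dot_le f g : L2 f -> L2 g ->
  Normc.normc (dot f g) <= l2norm mu f * l2norm mu g.
Proof.
move=> Lf Lg; rewrite -(@ler_pXn2r _ 2)// ?nnegrE ?normc_ge0' ?mulr_ge0 ?l2norm_ge0//.
by rewrite exprMn !l2norm_sqr; exact: cauchy_schwarz.
Qed.

Lemma l2norm_triangle f g : L2 f -> L2 g ->
  l2norm mu (fun x => f x + g x) <= l2norm mu f + l2norm mu g.
Proof.
move=> Lf Lg; rewrite -(@ler_pXn2r _ 2)// ?nnegrE ?addr_ge0 ?l2norm_ge0//.
rewrite l2norm_sqr sqnormD// -!l2norm_sqr.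
have := normc_dot_le Lf Lg; have := normr_Re_le (dot f g); have := ler_norm (Re (dot f g)).
move=> h1 h2 h3; rewrite sqrrD; lra.
Qed.

Lemma l2distC f g : l2dist mu f g = l2dist mu g f.
Proof.
rewrite /l2dist /l2norm -!/(sqnorm _) -sqnormN; congr (Num.sqrt (sqnorm _)).
by apply/funext => x; rewrite opprB.
Qed.

(** Continuity of the scalar product, in the form that makes adjoints closed. *)
Lemma dot_limit (fs gs : nat -> X -> R[i]) f g a b :
  (forall n, L2 (fs n)) -> (forall n, L2 (gs n)) -> L2 f -> L2 g -> L2 a -> L2 b ->
  l2dist mu (fs n) f @[n --> \oo] --> (0 : R) ->
  l2dist mu (gs n) g @[n --> \oo] --> (0 : R) ->
  (forall n, dot a (fs n) = dot b (gs n)) -> dot a f = dot b g.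
Proof.
move=> Lfs Lgs Lf Lg La Lb cf cg e.
apply/subr0_eq/normc_eq0P/eqP; rewrite eq_le normc_ge0' andbT.
have bnd n : Normc.normc (dot a f - dot b g) <=
    l2norm mu a * l2dist mu (fs n) f + l2norm mu b * l2dist mu (gs n) g.
  have -> : dot a f - dot b g =
      dot b (fun x => gs n x - g x) - dot a (fun x => fs n x - f x).
    rewrite !dotBr// e; ring.
  rewrite addrC; apply: le_trans (le_normcD _ _) _; rewrite normcN.
  by apply: lerD; apply: normc_dot_le => //; exact: L2B.
have lim : l2norm mu a * l2dist mu (fs n) f + l2norm mu b * l2dist mu (gs n) g
    @[n --> \oo] --> (l2norm mu a * 0 + l2norm mu b * 0 : R).
  by apply: cvgD; apply: cvgZr.
rewrite !mulr0 addr0 in lim.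
by apply: (cvgr_to_ge lim); apply: nearW.
Qed.

Lemma l2closure_seq V f : l2closure mu V f -> exists fs : nat -> X -> R[i],
  (forall n, V (fs n)) /\ l2dist mu (fs n) f @[n --> \oo] --> (0 : R).
Proof.
move=> [Lf H].
have [fs fsP] : {fs : nat -> X -> R[i] & forall n, V (fs n) /\ l2dist mu f (fs n) < n.+1%:R^-1}.
  apply: (@choice _ _ (fun n g => V g /\ l2dist mu f g < n.+1%:R^-1)) => n.
  by have [g Vg fg] := H n.+1%:R^-1 ltac:(by rewrite invr_gt0); exists g.
exists fs; split; first by move=> n; have [] := fsP n.
apply: (@squeeze_cvgr _ _ _ _ (cst 0) (fun n => n.+1%:R^-1)).
- near=> n; rewrite sqrtr_ge0/= l2distC.
  by have [_ /ltW] := fsP n.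
- exact: cvg_cst.
- exact: cvg_harmonic.
Unshelve. all: by end_near. Qed.

Lemma l2closure_of_seq V f (fs : nat -> X -> R[i]) : L2 f -> (forall n, V (fs n)) ->
  l2dist mu (fs n) f @[n --> \oo] --> (0 : R) -> l2closure mu V f.
Proof.
move=> Lf Vfs cf; split => // e e0.
have [N _ HN] : \forall n \near \oo, l2dist mu (fs n) f < e by exact: (cvgr_lt _ cf).
by exists (fs N) => //; rewrite l2distC; apply: HN => /=.
Qed.

Lemma dense_orthogonal_eq0 V f : V `<=` L2 -> l2dense mu V -> L2 f ->
  (forall g, V g -> dot f g = 0) -> {ae mu, forall x, f x = 0}.
Proof.
move=> VL dV Lf Vf.
have [fs [Vfs cfs]] := l2closure_seq (dV _ Lf).
apply: sqnorm_eq0 => //.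
have c0 : l2dist mu (cst 0) (cst 0) @[n --> \oo] --> (0 : R).
  rewrite (_ : (fun _ : nat => _) = cst 0); first exact: cvg_cst.
  apply/funext => n; rewrite /l2dist /l2norm -/(sqnorm _).
  rewrite (_ : (fun x => _) = cst 0) ?sqnorm0 ?sqrtr0//.
  by apply/funext => x /=; rewrite subrr.
have := @dot_limit fs (fun=> cst 0) f (cst 0) f f (fun n => VL _ (Vfs n)) (fun=> L20)
  Lf L20 Lf Lf cfs c0.
have d0 : dot f (cst 0) = 0.
  rewrite (_ : cst 0 = (fun x => 0 * f x)); last by apply/funext => x; rewrite mul0r.
  by rewrite dotZr// rmorph0 mul0r.
rewrite d0 dot_self// => /(_ (fun n => Vf _ (Vfs n))).
by case.
Qed.

Lemma l2_dominated (fs : nat -> X -> R[i]) f (b : X -> R) :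
  (forall n, cmeasurable (fs n)) -> cmeasurable f ->
  mu.-integrable setT (EFin \o b) ->
  {ae mu, forall x, forall n, cmod (fun y => fs n y - f y) x ^+ 2 <= b x} ->
  {ae mu, forall x, cmod (fun y => fs n y - f y) x ^+ 2 @[n --> \oo] --> (0 : R)} ->
  l2dist mu (fs n) f @[n --> \oo] --> (0 : R).
Proof.
move=> mfs mf ib fb fc.
have mn n : cmeasurable (fun y => fs n y - f y) by exact: cmeasurableB.
have [] := @dominated_convergence _ _ _ mu setT measurableT
  (fun n x => (cmod (fun y => fs n y - f y) x ^+ 2)%:E) (cst 0%E) (EFin \o b).
- by move=> n; apply/measurable_EFinP; exact: measurable_cmod_sqr.
- exact: measurable_cst.
- by apply: aeS fc => x c _; apply/fine_cvgP; split; [exact: nearW|exact: c].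
- exact: ib.
- by apply: aeS fb => x c n _; rewrite gee0_abs ?cmod_sqr_ge0// lee_fin.
move=> _ _; rewrite integral0 => c.
have c' : sqnorm (fun y => fs n y - f y) @[n --> \oo] --> (0 : R).
  by case/fine_cvgP : c.
rewrite -[X in _ --> X](sqrtr0 R).
by apply: (cvg_comp _ _ c'); exact: sqrt_continuous.
Qed.

Lemma l2norm_cvg0 (fs : nat -> X -> R[i]) : sqnorm (fs n) @[n --> \oo] --> (0 : R) ->
  l2norm mu (fs n) @[n --> \oo] --> (0 : R).
Proof.
move=> c; rewrite -[X in _ --> X](sqrtr0 R).
by apply: (cvg_comp _ _ c); exact: sqrt_continuous.
Qed.

(** Dominated convergence, with [|f|^2] as the dominating function. *)
Lemma l2_cvg_indic (D : nat -> set X) f : (forall n, measurable (D n)) -> L2 f ->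
  {ae mu, forall x, f x = 0 \/ exists N, forall n, (N <= n)%N -> D n x} ->
  l2dist mu (fun x => (\1_(D n) x)%:C * f x) f @[n --> \oo] --> (0 : R).
Proof.
move=> mD Lf Dx; apply: (@l2_dominated _ _ (fun x => cmod f x ^+ 2)).
- by move=> n; have [] := L2_indic (mD n) Lf.
- by case: Lf.
- exact: L2_integrable.
- apply: aeW => x n; rewrite /cmod indicE; case: (_ \in _); rewrite ?mul1r ?mul0r.
    by rewrite subrr Normc.normc0 expr0n sqr_ge0.
  by rewrite sub0r normcN.
- apply: aeS Dx => x [f0|[N HN]].
    rewrite (_ : (fun n => _) = cst 0); first exact: cvg_cst.
    by apply/funext => n; rewrite /cmod f0 mulr0 subrr Normc.normc0 expr0n.
  apply: cvg_near_cst; exists N => // n Nn /=.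
  by rewrite /cmod indicE mem_set ?mul1r ?subrr ?Normc.normc0 ?expr0n//; exact: HN.
Qed.

Lemma l2_cvg_perturb (fs hs : nat -> X -> R[i]) f :
  (forall n, L2 (fs n)) -> (forall n, L2 (hs n)) -> L2 f ->
  l2dist mu (fs n) f @[n --> \oo] --> (0 : R) ->
  l2norm mu (hs n) @[n --> \oo] --> (0 : R) ->
  l2dist mu (fun x => fs n x + hs n x) f @[n --> \oo] --> (0 : R).
Proof.
move=> Lfs Lhs Lf cf ch.
apply: (@squeeze_cvgr _ _ _ _ (cst 0) (fun n => l2dist mu (fs n) f + l2norm mu (hs n))).
- apply: nearW => n; rewrite sqrtr_ge0/=.
  rewrite /l2dist (_ : (fun x => _) = (fun x => (fs n x - f x) + hs n x)).
    by apply: l2norm_triangle => //; exact: L2B.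
  by apply/funext => x; ring.
- exact: cvg_cst.
- by rewrite -[X in _ --> X](addr0 (0 : R)); exact: cvgD.
Qed.

End L2_theory.

(** * Weighted conditional expectation operators and their adjoints *)

Section weighted_operators.
Context {d : measure_display} {X : measurableType d} {R : realType}.
Variables (mu : {measure set X -> \bar R}) (A : set (set X)).
Hypothesis hA : sigma_finite_subalgebra mu A.
Local Notation XA := (g_sigma_algebraType A).
Local Notation E f := (cond_exp mu A (EFin \o f%R)).
Local Notation dot := (dot mu).
Local Notation EC := (cond_expC mu A).
Local Notation Esq f := (cond_exp_sq mu A f%R).
Local Notation "'Acmeasurable' f" := (@cmeasurable _ XA R f) (at level 10).
Implicit Types f g m a b u w : X -> R[i].
Local Notation L2 := (L2 mu).
Local Notation cintegrable := (cintegrable mu).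
Local Notation MEM := (MEM mu A).

Lemma aeTP (Y : Type) (f g : X -> Y) :
  f = g %[ae mu] <-> {ae mu, forall x, f x = g x}.
Proof. by split; apply: aeS => x; [apply|]. Qed.

(** Finiteness of [E |f|^2]: by Cauchy-Schwarz the condition under which products of two
    such functions are conditionable. *)
Definition sq_conditionable f : Prop :=
  cmeasurable f /\ {ae mu, forall x, (Esq f x < +oo)%E}.

Definition fexp_sq f : X -> R := fexp mu A (fun x => cmod f x ^+ 2).

Lemma fexp_sqK f x : (Esq f x < +oo)%E -> Esq f x = (fexp_sq f x)%:E.
Proof. exact: fexpK. Qed.

Lemma fexp_sq_ge0 f x : 0 <= fexp_sq f x. Proof. exact: fexp_ge0. Qed.

Lemma measurable_fexp_sq f : measurable_fun [set: XA] (fexp_sq f).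
Proof. exact: measurable_fexp. Qed.

Lemma measurable_Esq f : measurable_fun [set: XA] (Esq f).
Proof. exact: measurable_cond_exp. Qed.

Lemma Esq_ge0 f x : (0 <= Esq f x)%E. Proof. exact: cond_exp_ge0. Qed.

Lemma L2_sq_conditionable f : L2 f -> sq_conditionable f.
Proof.
move=> Lf; split; first by case: Lf.
have [] // := integrable_cond_exp_lty hA (f := fun x => cmod f x ^+ 2).
- by apply: measurable_cmod_sqr; case: Lf.
- by move=> x; exact: sqr_ge0.
- exact: L2_integrable.
Qed.

Lemma sq_conditionableM a b : sq_conditionable a -> sq_conditionable b ->
  conditionable mu A (fun x => a x * b x).
Proof.
move=> [ma ai] [mb bi].
have m1 := measurable_cmod_sqr ma; have m2 := measurable_cmod_sqr mb.
apply: (conditionable_le hA (b := fun x => cmod a x ^+ 2 + cmod b x ^+ 2)).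
- exact: cmeasurableM.
- exact: measurable_funD.
- move=> x; rewrite /cmod normcM'.
  have := sqr_ge0 (Normc.normc (a x) - Normc.normc (b x)).
  have := normc_ge0' (a x); have := normc_ge0' (b x); nra.
- by apply: cond_exp_ltyD => // x; exact: sqr_ge0.
Qed.

Lemma Esq_mul m a : Acmeasurable m -> cmeasurable a ->
  {ae mu, forall x, Esq (fun x => m x * a x) x = ((cmod m x) ^+ 2)%:E * Esq a x}%E.
Proof.
move=> mm ma.
have -> : Esq (fun x => m x * a x) = E (fun x => cmod m x ^+ 2 * cmod a x ^+ 2).
  rewrite /cond_exp_sq; congr (cond_exp _ _ _); apply/funext => x /=.
  by rewrite /cmod normcM' exprMn.
apply: (cond_expM hA (m := fun x => cmod m x ^+ 2) (f := fun x => cmod a x ^+ 2)).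
- exact: (@measurable_cmod_sqr _ XA).
- exact: measurable_cmod_sqr.
- by move=> x; exact: sqr_ge0.
- by move=> x; exact: sqr_ge0.
Qed.

Lemma sq_conditionable_mul m a : Acmeasurable m -> sq_conditionable a ->
  sq_conditionable (fun x => m x * a x).
Proof.
move=> mm [ma ai]; split.
  by apply: cmeasurableM => //; exact: (subalg_cmeasurable hA).
apply: aeS2 (Esq_mul mm ma) ai => x -> fo.
by rewrite lte_mul_pinfty// lee_fin sqr_ge0.
Qed.

Lemma sq_conditionable_conj a : sq_conditionable a ->
  sq_conditionable (fun x => (a x)^*).
Proof.
move=> [ma ai]; split; first exact: cmeasurable_conj.
rewrite /cond_exp_sq (_ : cmod _ = cmod a)//.
by apply/funext => x; rewrite /cmod normc_conjc.
Qed.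

(** As [|m|^2] is measurable for the subalgebra, [|a|^2] may be replaced by its
    conditional expectation: norms see a weight only through its conditional second
    moment. *)
Lemma integral_sq_mul m a : Acmeasurable m -> cmeasurable a ->
  (\int[mu]_x ((cmod (fun x => m x * a x)%R x) ^+ 2)%:E =
   \int[mu]_x (((cmod m x) ^+ 2)%:E * Esq a x))%E.
Proof.
move=> mm ma.
have mmX := subalg_cmeasurable hA mm.
have ms : measurable_fun setT (fun x => cmod (fun x => m x * a x) x ^+ 2).
  exact/measurable_cmod_sqr/cmeasurableM.
rewrite (cond_exp_integralT hA ms); last by move=> x; exact: sqr_ge0.
apply: ge0_ae_eq_integral => //.
- by apply: (subalg_measurable_fun hA); exact: measurable_cond_exp.
- apply: emeasurable_funM; first exact/measurable_EFinP/measurable_cmod_sqr.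
  by apply: (subalg_measurable_fun hA); exact: measurable_Esq.
- by move=> x _; exact: cond_exp_ge0.
- by move=> x _; rewrite mule_ge0 ?cmod_sqr_ge0 ?Esq_ge0.
- by apply: aeS (Esq_mul mm ma) => x.
Qed.

Lemma cintegral_pull_out m v : Acmeasurable m -> conditionable mu A v ->
  cintegrable (fun x => m x * v x) ->
  cintegral mu (fun x => m x * v x) = cintegral mu (fun x => m x * EC v x).
Proof.
move=> mm cv i; have [_ [i' <-]] := cintegrable_cond_expC hA i.
apply: cintegral_ae_congr.
- exact: cintegrable_cmeasurable i'.
- apply: cmeasurableM; apply: (subalg_cmeasurable hA) => //.
  exact: measurable_cond_expC.
- exact: cond_expCM.
Qed.

(** A truncation device: on these sets indicators are integrable and weights with finite
    conditional moments become bounded, so that test functions cut to them are square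
    integrable. *)
Lemma subalg_level_exhaustion (phi : X -> \bar R) :
  measurable_fun [set: XA] phi -> {ae mu, forall x, (phi x < +oo)%E} ->
  exists B : nat -> set X,
    [/\ forall n, A (B n), forall n, (mu (B n) < +oo)%E,
        forall n x, B n x -> (phi x <= n%:R%:E)%E &
        {ae mu, forall x, exists N, forall n, (N <= n)%N -> B n x}].
Proof.
move=> mphi phio.
have [F [mF Ffin ndF UF]] := subalg_exhaustion hA.
pose B n : set XA := F n `&` ([set: XA] `&` [set x | (phi x <= n%:R%:E)%E]).
have mB n : measurable (B n).
  by apply: measurableI => //; exact: emeasurable_fun_infty_c.
exists B; split.
- by move=> n; exact/(subalg_measurableE hA).
- move=> n; apply: le_lt_trans (Ffin n); apply: le_measure; rewrite ?inE//.
  + exact: (subalg_measurable hA).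
  + exact: (subalg_measurable hA).
  + by move=> x [].
- by move=> n x [_ [_]].
- apply: aeS phio => x phix.
  have [N _ FN] : (\bigcup_n F n) x by rewrite UF.
  exists (maxn N (Num.truncn (fine (phi x))).+1) => n; rewrite geq_max => /andP[Nn tn].
  split; first by have : F N `<=` F n by [apply/subsetPset/ndF]; exact.
  split => //=.
  have [p0|p0] := leP (phi x) 0%E; first by rewrite (le_trans p0)// lee_fin.
  rewrite -[phi x]fineK; last by rewrite fin_numElt phix (lt_trans _ p0)// ltNyr.
  by rewrite lee_fin (le_trans (ltW (truncnS_gt _)))// ler_nat.
Qed.

Lemma sq_conditionableD f g : sq_conditionable f -> sq_conditionable g ->
  sq_conditionable (fun x => f x + g x).
Proof.
move=> [mf fi] [mg gi]; split; first exact: cmeasurableD.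
have m1 := measurable_cmod_sqr mf; have m2 := measurable_cmod_sqr mg.
have f0 x : 0 <= cmod f x ^+ 2 by exact: sqr_ge0.
have g0 x : 0 <= cmod g x ^+ 2 by exact: sqr_ge0.
have i1 := cond_exp_ltyD hA m1 m2 f0 g0 fi gi.
have m12 := measurable_funD m1 m2.
have p12 x : 0 <= cmod f x ^+ 2 + cmod g x ^+ 2 by exact: addr_ge0.
have i2 := cond_exp_ltyD hA m12 m12 p12 p12 i1 i1.
apply: cond_exp_lty_le i2 => //.
- exact/measurable_cmod_sqr/cmeasurableD.
- exact: measurable_funD.
- by move=> x; exact: sqr_ge0.
- by move=> x; apply: le_trans (normcD_sqr_le _ _) _; rewrite /cmod /=; lra.
Qed.

Lemma sq_conditionableB f g : sq_conditionable f -> sq_conditionable g ->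
  sq_conditionable (fun x => f x - g x).
Proof.
move=> sf [mg gi]; apply: (sq_conditionableD sf); split; first exact: cmeasurableN.
rewrite /cond_exp_sq (_ : cmod _ = cmod g)//.
by apply/funext => x; rewrite /cmod normcN.
Qed.

(** The average of [2 t |a b| <= t^2 |a|^2 + |b|^2]. The parameter may depend on the
    point, as long as it is measurable for the subalgebra, so it can be optimised
    afterwards. *)
Lemma fexp_young a b (t : X -> R) : sq_conditionable a -> sq_conditionable b ->
  measurable_fun [set: XA] (t : X -> R) -> (forall x, 0 <= t x) ->
  {ae mu, forall x, 2 * t x * fexp mu A (cmod (fun y => a y * b y)) x <=
                    t x ^+ 2 * fexp_sq a x + fexp_sq b x}.
Proof.
move=> sa sb mt t0; have cab := sq_conditionableM sa sb.
have [ma ai] := sa; have [mb bi] := sb; have [mab abi] := cab.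
have m1 := measurable_cmod_sqr ma; have m2 := measurable_cmod_sqr mb.
have m3 := measurable_cmod mab.
have a0 x : 0 <= cmod a x ^+ 2 by exact: sqr_ge0.
have b0 x : 0 <= cmod b x ^+ 2 by exact: sqr_ge0.
have ab0 x : 0 <= cmod (fun y => a y * b y) x by exact: normc_ge0'.
have mt2 : measurable_fun [set: XA] (fun x => t x ^+ 2) by exact: measurable_funX.
have t20 x : 0 <= t x ^+ 2 by exact: sqr_ge0.
have mt' : measurable_fun [set: XA] (fun x => 2 * t x) by exact: measurable_funM.
have t'0 x : 0 <= 2 * t x by exact: mulr_ge0.
have e1 := fexpM hA mt' m3 t'0 ab0 abi.
have e2 := fexpM hA mt2 m1 t20 a0 ai.
have i2 : {ae mu, forall x, (E (fun x => t x ^+ 2 * cmod a x ^+ 2) x < +oo)%E}.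
  by apply: aeS e2 => x [].
have m4 : measurable_fun setT (fun x => t x ^+ 2 * cmod a x ^+ 2).
  by apply: measurable_funM m1; exact: (subalg_measurable_fun hA).
have p4 x : 0 <= t x ^+ 2 * cmod a x ^+ 2 by exact: mulr_ge0.
have m5 : measurable_fun setT (fun x => 2 * t x * cmod (fun y => a y * b y) x).
  by apply: measurable_funM m3; exact: (subalg_measurable_fun hA).
have p5 x : 0 <= 2 * t x * cmod (fun y => a y * b y) x by exact: mulr_ge0.
have L : {ae mu, forall x, 2 * t x * cmod (fun y => a y * b y) x <=
    t x ^+ 2 * cmod a x ^+ 2 + cmod b x ^+ 2}.
  apply: aeW => x; rewrite /cmod normcM'.
  have := sqr_ge0 (t x * Normc.normc (a x) - Normc.normc (b x)); rewrite sqrrB; nra.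
have L' := cond_exp_le hA m5 (measurable_funD m4 m2) p5 (fun x => addr_ge0 (p4 x) (b0 x)) L.
have e3 := fexpD hA m4 m2 p4 b0 i2 bi.
have i3 := cond_exp_ltyD hA m4 m2 p4 b0 i2 bi.
apply: aeS3 (aeI L' i3) (aeI e1 e2) e3 => x [l i] [[_ e1x] [_ e2x]] e3x.
rewrite -e1x -e2x -e3x /fexp; apply: (fine_le _ _ l).
- by rewrite ge0_fin_numE ?cond_exp_ge0// (le_lt_trans l i).
- by rewrite ge0_fin_numE ?cond_exp_ge0.
Qed.

(** The best parameter in [fexp_young] is [E |a b| / E |a|^2]; where the denominator
    vanishes, a large parameter forces [E |a b|] to vanish too. *)
Lemma cond_cauchy_schwarz a b : sq_conditionable a -> sq_conditionable b ->
  {ae mu, forall x, fexp mu A (cmod (fun y => a y * b y)) x ^+ 2 <= fexp_sq a x * fexp_sq b x}.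
Proof.
move=> sa sb; pose c x := fexp mu A (cmod (fun y => a y * b y)) x.
have c0 x : 0 <= c x by exact: fexp_ge0.
have p0 x := fexp_sq_ge0 a x; have e0 x := fexp_sq_ge0 b x.
have mc : measurable_fun [set: XA] c by exact: measurable_fexp.
have mp : measurable_fun [set: XA] (fexp_sq a) by exact: measurable_fexp_sq.
have me : measurable_fun [set: XA] (fexp_sq b) by exact: measurable_fexp_sq.
have mt1 : measurable_fun [set: XA] (fun x => c x * (fexp_sq a x)^-1).
  by apply: measurable_funM mc _; exact: (@measurable_invr_ge0 _ XA _).
have mt2 : measurable_fun [set: XA] (fun x => (fexp_sq b x + 1) * (c x)^-1).
  apply: measurable_funM; first by apply: measurable_funD me _; exact: measurable_cst.
  exact: (@measurable_invr_ge0 _ XA _).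
have t10 x : 0 <= c x * (fexp_sq a x)^-1 by rewrite mulr_ge0 ?invr_ge0.
have t20 x : 0 <= (fexp_sq b x + 1) * (c x)^-1 by rewrite mulr_ge0 ?invr_ge0 ?addr_ge0.
apply: aeS2 (fexp_young sa sb mt1 t10) (fexp_young sa sb mt2 t20) => x.
rewrite -!/(c x); have := c0 x; have := p0 x; have := e0 x.
move: (c x) (fexp_sq a x) (fexp_sq b x) => y p e e1 p1 y1.
have [->|pn] := eqVneq p 0.
  move=> _; rewrite !mulr0 add0r mul0r.
  have [->|yn] := eqVneq y 0; first by rewrite expr0n.
  by rewrite -mulrA divfK// => h; exfalso; lra.
have pp : 0 < p by rewrite lt_neqAle eq_sym pn.
have -> : 2 * (y * p^-1) * y = 2 * (y ^+ 2 / p) by field.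
have -> : (y * p^-1) ^+ 2 * p = y ^+ 2 / p by field.
move=> h _; have {}h : y ^+ 2 / p <= e by lra.
by move: h; rewrite ler_pdivrMr// mulrC.
Qed.

Lemma cond_expC_cauchy_schwarz a b : sq_conditionable a -> sq_conditionable b ->
  {ae mu, forall x, cmod (EC (fun y => a y * b y)) x ^+ 2 <= 4 * (fexp_sq a x * fexp_sq b x)}.
Proof.
move=> sa sb; have cab := sq_conditionableM sa sb.
apply: aeS2 (cond_cauchy_schwarz sa sb) (cond_expC_le hA cab) => x l1 l2.
apply: le_trans (_ : (2 * fexp mu A (cmod (fun y => a y * b y)) x) ^+ 2 <= _).
  by rewrite ler_sqr ?nnegrE ?normc_ge0' ?mulr_ge0 ?fexp_ge0.
by rewrite exprMn -natrX ler_pM2l.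
Qed.

Lemma L2_mul_bounded m a (c : R) (B : set X) : Acmeasurable m -> cmeasurable a ->
  A B -> (mu B < +oo)%E -> 0 <= c ->
  {ae mu, forall x, (((cmod m x) ^+ 2)%:E * Esq a x <= (c * \1_B x)%:E)%E} ->
  L2 (fun x => m x * a x).
Proof.
move=> mm ma AB Bfin c0 le.
have mB : measurable B by exact: (subalg_sub hA).
split; first by apply: cmeasurableM => //; exact: (subalg_cmeasurable hA).
rewrite integral_sq_mul//.
apply: (@le_lt_trans _ _ (\int[mu]_x (c * \1_B x)%:E)%E).
  apply: ae_ge0_le_integral => //.
  - by move=> x _; rewrite mule_ge0 ?cmod_sqr_ge0 ?Esq_ge0.
  - apply: emeasurable_funM.
      by apply/measurable_EFinP/measurable_cmod_sqr; exact: (subalg_cmeasurable hA).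
    by apply: (subalg_measurable_fun hA); exact: measurable_Esq.
  - by move=> x _; rewrite lee_fin mulr_ge0// indicE ler0n.
  - by apply/measurable_EFinP; apply: measurable_funM => //; exact: measurable_indic.
  - by apply: aeS le => x + _.
under eq_integral do rewrite EFinM.
have -> : (\int[mu]_x (c%:E * (\1_B x)%:E) = c%:E * \int[mu]_x (\1_B x)%:E)%E.
  by apply: ge0_integralZl_EFin => //; exact/measurable_EFinP/measurable_indic.
by rewrite integral_indic// setIT lte_mul_pinfty// lee_fin.
Qed.

Lemma indic_Acmeasurable (B : set X) : A B -> Acmeasurable (fun x => (\1_B x)%:C).
Proof.
move=> AB; apply: (@cmeasurable_real _ XA); apply: (@measurable_indic _ XA).
exact/(subalg_measurableE hA).
Qed.

Let EC0 : {ae mu, forall x, EC (cst 0) x = 0}.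
Proof.
apply: aeS2 (cond_expC_real hA (r := cst 0) _ _) (fexp_cst0 hA) => //.
by move=> x -> ->.
Qed.

Lemma conditionable0 : conditionable mu A (cst 0).
Proof.
have [_ L] := L2_sq_conditionable (L20 mu).
split; first exact: cmeasurable_cst.
apply: aeS L => x; rewrite /cond_exp_sq.
rewrite (_ : (fun x => _) = EFin \o cmod (cst 0))//.
apply/funext => y; rewrite -[RHS]/((cmod (cst 0 : X -> R[i]) y)%:E).
by rewrite (_ : cmod _ y = 0) ?expr0n//; exact: Normc.normc0.
Qed.

Lemma MEMP a b f g : MEM a b (f, g) <->
  [/\ L2 f, conditionable mu A (fun x => b x * f x), L2 g &
      {ae mu, forall x, g x = a x * EC (fun y => b y * f y) x}].
Proof.
split=> -[Lf cf Lg e].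
  by split; [exact: Lf|exact: cf|exact: Lg|exact/aeTP].
by split; [exact: Lf|exact: cf|exact: Lg|exact/aeTP].
Qed.

Lemma MEM_linear a b : cmeasurable a -> cmeasurable b -> linear_operator mu (MEM a b).
Proof.
move=> ma mb; split.
- by move=> f g /MEMP[].
- move=> f g f' g' /MEMP[Lf cf Lg ge] Lf' Lg' /aeTP ff' /aeTP gg'.
  have e : {ae mu, forall x, b x * f x = b x * f' x} by apply: aeS ff' => x ->.
  have m1 : cmeasurable (fun x => b x * f x) by apply: cmeasurableM => //; case: Lf.
  have m2 : cmeasurable (fun x => b x * f' x) by apply: cmeasurableM => //; case: Lf'.
  apply/MEMP; split; [exact: Lf'|exact: (conditionable_ae_congr hA m1 m2 e cf)|exact: Lg'|].
  rewrite -(cond_expC_ae_congr hA m1 m2 e).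
  by apply: aeS2 gg' ge => x ->.
- move=> f g g' /MEMP[_ _ _ e1] /MEMP[_ _ _ e2]; apply/aeTP.
  by apply: aeS2 e1 e2 => x -> ->.
  have e : (fun x => b x * cst 0 x) = cst 0 by apply/funext => x; rewrite mulr0.
  apply/MEMP; rewrite e; split; [exact: L20|exact: conditionable0|exact: L20|].
  by apply: aeS EC0 => x ->; rewrite mulr0.
- move=> c f g f' g' /MEMP[Lf cf Lg ge] /MEMP[Lf' cf' Lg' ge'].
  have mc : Acmeasurable (fun _ : XA => c) by exact: cmeasurable_cst.
  have e : (fun x => b x * (c * f x + f' x)) = (fun x => c * (b x * f x) + b x * f' x).
    by apply/funext => x; ring.
  apply/MEMP; rewrite e; split.
  + exact: L2D (L2Z c Lf) Lf'.
  + exact: (conditionableD hA (conditionableM hA mc cf) cf').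
  + exact: L2D (L2Z c Lg) Lg'.
  + have D := cond_expCD hA (conditionableM hA mc cf) cf'.
    apply: aeS4 D (cond_expCM hA mc cf) ge ge' => x -> -> -> ->; ring.
Qed.

(** Composition merges the two inner weights into the multiplier [E (b' a)]. *)
Lemma MEM_compP a b a' b' f g :
  cmeasurable a' -> sq_conditionable b' -> sq_conditionable a -> 
  op_comp (MEM a' b') (MEM a b) (f, g) <->
  [/\ L2 f, conditionable mu A (fun x => b x * f x),
      L2 (fun x => a x * EC (fun y => b y * f y) x), L2 g &
      {ae mu, forall x, g x = a' x * (EC (fun y => b' y * a y) x *
                                      EC (fun y => b y * f y) x)}].
Proof.
move=> ma' sb' sa; have [mb' _] := sb'; have [ma _] := sa.
have mE : Acmeasurable (EC (fun y => b y * f y)) by exact: measurable_cond_expC.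
have mEX := subalg_cmeasurable hA mE.
have cba := sq_conditionableM sb' sa.
have key : {ae mu, forall x, EC (fun y => b' y * (a y * EC (fun y => b y * f y) y)) x =
    EC (fun y => b y * f y) x * EC (fun y => b' y * a y) x}.
  have -> : (fun y => b' y * (a y * EC (fun y => b y * f y) y)) =
      (fun y => EC (fun y => b y * f y) y * (b' y * a y)).
    by apply/funext => x; ring.
  exact: (cond_expCM hA).
split.
  move=> [v] /= /MEMP[Lf cf Lv ve] /MEMP[_ cv Lg ge].
  have Lv' : L2 (fun x => a x * EC (fun y => b y * f y) x).
    by apply: L2_ae_congr ve Lv; exact: cmeasurableM.
  split; [exact: Lf|exact: cf|exact: Lv'|exact: Lg|].
  have e : EC (fun y => b' y * v y) = EC (fun y => b' y * (a y * EC (fun y => b y * f y) y)).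
    apply: (cond_expC_ae_congr hA).
    - exact: cmeasurableM mb' (L2_cmeasurable Lv).
    - exact: cmeasurableM mb' (L2_cmeasurable Lv').
    - by apply: aeS ve => x ->.
  by rewrite e in ge; apply: aeS2 ge key => x -> ->; rewrite (mulrC (EC (fun y => b' y * a y) x)).
move=> [Lf cf Lv Lg ge].
exists (fun x => a x * EC (fun y => b y * f y) x) => /=.
  by apply/MEMP; split; [exact: Lf|exact: cf|exact: Lv|exact: aeW].
apply/MEMP; split; [exact: Lv| |exact: Lg|].
  exact: (sq_conditionableM sb' (L2_sq_conditionable Lv)).
by apply: aeS2 ge key => x -> ->; rewrite (mulrC (EC (fun y => b' y * a y) x)).
Qed.

Section adjoint.
Variables a b : X -> R[i].
Hypotheses (sa : sq_conditionable a) (sb : sq_conditionable b).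

Let ma : cmeasurable a. Proof. by case: sa. Qed.
Let mb : cmeasurable b. Proof. by case: sb. Qed.

Local Notation abar := (fun x => (a x)^*).
Local Notation bbar := (fun x => (b x)^*).

(** Both sides equal the integral of [E (b f)] times the conjugate of [E (conj a * g)]:
    in each of them one of the two factors can be averaged because the other is
    measurable for the subalgebra. *)
Lemma MEM_sub_adjoint f v g h : MEM a b (f, v) -> MEM bbar abar (g, h) ->
  dot v g = dot f h.
Proof.
move=> /MEMP[Lf cf Lv ve] /MEMP[Lg cg Lh he].
have mF : Acmeasurable (EC (fun y => b y * f y)) by exact: measurable_cond_expC.
have mG : Acmeasurable (EC (fun y => (a y)^* * g y)) by exact: measurable_cond_expC.
have mFX := subalg_cmeasurable hA mF; have mGX := subalg_cmeasurable hA mG.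
have mf : cmeasurable f by case: Lf.
have mg : cmeasurable g by case: Lg.
have mv : cmeasurable v by case: Lv.
have mh : cmeasurable h by case: Lh.
have mG' : Acmeasurable (fun x => (EC (fun y => (a y)^* * g y) x)^*).
  exact: (@cmeasurable_conj _ XA _ _ mG).
have mG'X := subalg_cmeasurable hA mG'.
have -> : dot v g = cintegral mu (fun x => EC (fun y => b y * f y) x *
    ((a x)^* * g x)^*).
  apply: cintegral_ae_congr.
  - by apply: cmeasurableM => //; exact: cmeasurable_conj.
  - by apply: cmeasurableM => //; apply: cmeasurable_conj; apply: cmeasurableM => //; exact: cmeasurable_conj.
  - by apply: aeS ve => x ->; rewrite conjcM conjCK; ring.
have -> : dot f h = cintegral mu (fun x => (EC (fun y => (a y)^* * g y) x)^* * (b x * f x)).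
  apply: cintegral_ae_congr.
  - by apply: cmeasurableM => //; exact: cmeasurable_conj.
  - by do ! apply: cmeasurableM => //.
  - by apply: aeS he => x ->; rewrite conjcM conjCK; ring.
have cg' : conditionable mu A (fun x => ((a x)^* * g x)^*) by exact: conditionable_conj.
have cintegrable_ae (y z : X -> R[i]) : cmeasurable z -> {ae mu, forall x, y x = z x} ->
    cintegrable y -> cintegrable z.
  move=> [z1 z2] e [i1 i2]; split.
    apply: integrable_ae_eq i1; first exact/measurable_EFinP.
    by apply: aeS e => x ->.
  apply: integrable_ae_eq i2; first exact/measurable_EFinP.
  by apply: aeS e => x ->.
have i1 : cintegrable (fun x => EC (fun y => b y * f y) x * ((a x)^* * g x)^*).
  apply: cintegrable_ae (cintegrable_mul_conj Lv Lg).
    exact: cmeasurableM mFX cg'.1.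
  by apply: aeS ve => x ->; rewrite conjcM conjCK; ring.
have i2 : cintegrable (fun x => (EC (fun y => (a y)^* * g y) x)^* * (b x * f x)).
  apply: cintegrable_ae (cintegrable_mul_conj Lf Lh).
    exact: cmeasurableM mG'X cf.1.
  by apply: aeS he => x ->; rewrite conjcM conjCK; ring.
rewrite (cintegral_pull_out mF cg' i1) (cintegral_pull_out mG' cf i2).
apply: f_equal; apply/funext => x.
by rewrite cond_expC_conj mulrC.
Qed.

(** For the inclusion that is not formal, let [h] be the value of the adjoint at [g] and
    [k = conj b * E (conj a * g)]. Testing the adjoint relation on [f = chi (h - k)],
    where [chi] cuts to a set on which all the weights are bounded, gives [<f, f> = 0]. *)
Lemma MEM_adjoint : adjoint mu (MEM a b) = MEM bbar abar.
Proof.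
apply/seteqP; split => -[g h]; last first.
  move=> gh; have /MEMP[Lg _ Lh _] := gh.
  by split; [exact: Lg|exact: Lh|move=> f v fv; exact: MEM_sub_adjoint fv gh].
move=> [/= Lg Lh H].
have sg := L2_sq_conditionable Lg; have sh := L2_sq_conditionable Lh.
have sabar := sq_conditionable_conj sa; have sbbar := sq_conditionable_conj sb.
have cg := sq_conditionableM sabar sg.
have mG : Acmeasurable (EC (fun y => (a y)^* * g y)) by exact: measurable_cond_expC.
pose k x := (b x)^* * EC (fun y => (a y)^* * g y) x.
have sk : sq_conditionable k.
  rewrite /k; under eq_fun do rewrite mulrC.
  exact: sq_conditionable_mul mG sbbar.
have shk := sq_conditionableB sh sk.
pose phi x := (Esq a x + Esq b x + Esq (fun y => h y - k y) x)%E.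
have mphi : measurable_fun [set: XA] phi.
  by do ! apply: emeasurable_funD; exact: measurable_Esq.
have phio : {ae mu, forall x, (phi x < +oo)%E}.
  by apply: aeS3 sa.2 sb.2 shk.2 => x ? ? ?; do ! apply: lte_add_pinfty.
have [B [AB Bfin Bphi Bex]] := subalg_level_exhaustion mphi phio.
suff HB n : {ae mu, forall x, B n x -> h x = k x}.
  apply/MEMP; split; [exact: Lg|exact: cg|exact: Lh|].
  by apply: aeS2 (ae_foralln HB) Bex => x hx [N /(_ N (leqnn N))]; exact: hx.
have mB : measurable (B n).
  exact: (subalg_sub hA).
pose chi x : R[i] := (\1_(B n) x)%:C.
have chi2 x : chi x * chi x = chi x.
  by rewrite /chi -rmorphM/= indicE; case: (_ \in _); rewrite ?mulr1 ?mulr0.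
have chiJ x : (chi x)^* = chi x by rewrite /chi conjcE; apply: eqc_ReIm => //=; rewrite oppr0.
have mchi : Acmeasurable chi by exact: indic_Acmeasurable.
have cmchi x : cmod chi x ^+ 2 = \1_(B n) x.
  by rewrite /cmod normc_real indicE; case: (_ \in _); rewrite ?normr1 ?normr0 ?expr1n ?expr0n.
have Bb x : B n x -> fexp_sq a x <= n%:R /\ fexp_sq b x <= n%:R /\
    fexp_sq (fun y => h y - k y) x <= n%:R /\ (Esq a x < +oo)%E.
  move=> Bx; have := Bphi n x Bx; rewrite /phi /fexp_sq /fexp.
  have := Esq_ge0 a x; have := Esq_ge0 b x; have := Esq_ge0 (fun y => h y - k y) x.
  rewrite -!/(Esq _).
  case: (Esq a x) => [r||]//; case: (Esq b x) => [s||]//;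
    case: (Esq (fun y => h y - k y) x) => [t||]//=.
  rewrite -!EFinD !lee_fin => t0 s0 r0 rst.
  by rewrite ltry; split; [lra|split; [lra|split; [lra|]]].
(* the graph contains [f], with value [m * a], and [gk] below is the adjoint relation that
   the formula for the adjoint provides *)
pose f x := chi x * (h x - k x).
have Lf : L2 f.
  apply: (L2_mul_bounded (c := n%:R) (B := B n) mchi shk.1) => //.
  apply: aeS shk.2 => x fo; rewrite cmchi indicE.
  case: (boolP (x \in B n)) => [/set_mem Bx|_]; last by rewrite mul0e mulr0.
  rewrite mul1e mulr1 fexp_sqK// lee_fin.
  by have [_ [_ []]] := Bb x Bx.
have sf := L2_sq_conditionable Lf.
have cf := sq_conditionableM sb sf.
have mF : Acmeasurable (EC (fun y => b y * f y)) by exact: measurable_cond_expC.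
pose m x := chi x * EC (fun y => b y * f y) x.
have mm : Acmeasurable m by exact: (@cmeasurableM _ XA _ _ _ mchi mF).
have me : {ae mu, forall x, m x = EC (fun y => b y * f y) x}.
  have := cond_expCM hA mchi cf.
  have -> : (fun x => chi x * (b x * f x)) = (fun x => b x * f x).
    by apply/funext => x; rewrite /f -[in RHS]chi2; ring.
  by apply: aeS => x ->.
have Ef : {ae mu, forall x, B n x -> fexp_sq f x <= n%:R}.
  apply: aeS2 (Esq_mul mchi shk.1) shk.2 => x e fo Bx.
  rewrite /fexp_sq /fexp -/(Esq f) /f e cmchi indicE mem_set// mul1e.
  by have [_ [_ []]] := Bb x Bx.
have Lm : L2 (fun x => m x * a x).
  have c0 : 0 <= 4 * (n%:R * n%:R) * n%:R :> R by rewrite !mulr_ge0.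
  apply: (L2_mul_bounded mm ma (AB n) (Bfin n) c0).
  apply: aeS2 (cond_expC_cauchy_schwarz sb sf) Ef => x l1 l2.
  rewrite /cmod /m normcM' exprMn -/(cmod chi x) cmchi indicE.
  case: (boolP (x \in B n)) => [/set_mem Bx|_]; last by rewrite !mul0r mul0e mulr0.
  have [b1 [b2 [b3 b4]]] := Bb x Bx.
  rewrite mul1r mulr1 fexp_sqK// -EFinM lee_fin.
  apply: ler_pM => //; [exact: sqr_ge0|exact: fexp_sq_ge0|].
  by apply: le_trans l1 _; rewrite ler_pM2l// ler_pM ?fexp_sq_ge0 ?l2.
have fv : MEM a b (f, fun x => m x * a x).
  apply/MEMP; split; [exact: Lf|exact: cf|exact: Lm|].
  by apply: aeS me => x ->; rewrite mulrC.
have Lchik : L2 (fun x => chi x * k x).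
  have -> : (fun x => chi x * k x) = (fun x => chi x * h x - f x).
    by apply/funext => x; rewrite /f; ring.
  by apply: L2B => //; exact: L2_indic.
have Lchig : L2 (fun x => chi x * g x) by exact: L2_indic.
have Lchih : L2 (fun x => chi x * h x) by exact: L2_indic.
have gk : MEM bbar abar (fun x => chi x * g x, fun x => chi x * k x).
  apply/MEMP; split; [exact: Lchig| |exact: Lchik|].
    exact: (sq_conditionableM sabar (L2_sq_conditionable Lchig)).
  have -> : (fun y => (a y)^* * (chi y * g y)) = (fun y => chi y * ((a y)^* * g y)).
    by apply/funext => x; ring.
  by apply: aeS (cond_expCM hA mchi cg) => x ->; rewrite /k; ring.
have e1 := MEM_sub_adjoint fv gk.
have e2 := H _ _ fv.
have e3 : dot (fun x => m x * a x) (fun x => chi x * g x) = dot (fun x => m x * a x) g.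
  rewrite /dot; congr cintegral; apply/funext => x.
  by rewrite conjcM chiJ /m -[in RHS]chi2; ring.
have e4 : dot f (fun x => chi x * h x) = dot f h.
  rewrite /dot; congr cintegral; apply/funext => x.
  by rewrite conjcM chiJ /f -[in RHS]chi2; ring.
have f0 : {ae mu, forall x, f x = 0}.
  apply: (sqnorm_eq0 Lf).
  have := dot_self Lf.
  have {2}-> : f = (fun x => chi x * h x - chi x * k x).
    by apply/funext => x; rewrite /f; ring.
  rewrite dotBr// e4 -e2 -e3 e1 subrr => /(congr1 (@complex.Re R)).
  by move=> /= /esym.
apply: aeS f0 => x + Bx; rewrite /f /chi indicE mem_set//= mul1r.
exact: subr0_eq.
Qed.

End adjoint.

End weighted_operators.

(** * Weights and supports *)

Section weights.
Context {d : measure_display} {X : measurableType d} {R : realType}.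
Variables (mu : {measure set X -> \bar R}) (A : set (set X)).
Hypothesis hA : sigma_finite_subalgebra mu A.
Local Notation XA := (g_sigma_algebraType A).
Local Notation EC := (cond_expC mu A).
Local Notation Esq f := (cond_exp_sq mu A f%R).
Local Notation "'Acmeasurable' f" := (@cmeasurable _ XA R f) (at level 10).
Local Notation "'Ameasurable' f" := (measurable_fun [set: XA] (f : X -> R)) (at level 10).
Local Notation L2 := (L2 mu).
Local Notation MEM := (MEM mu A).
Local Notation sqnorm := (sqnorm mu).
Local Notation sq_conditionable := (sq_conditionable mu A).

Lemma Acmeasurable_real (r : X -> R) : Ameasurable r -> Acmeasurable (fun x => (r x)%:C).
Proof. exact: (@cmeasurable_real _ XA). Qed.

Lemma MEM_ae_weight a a' b : {ae mu, forall x, a x = a' x} -> MEM a b = MEM a' b.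
Proof.
move=> aa; apply/seteqP; split => -[f g] /MEMP[Lf cf Lg e]; apply/MEMP; split;
  [exact: Lf|exact: cf|exact: Lg| |exact: Lf|exact: cf|exact: Lg| ];
  by apply: aeS2 aa e => x -> ->.
Qed.

(** Factors measurable for the subalgebra pass through the conditional expectation. *)
Lemma MEM_move_weight (s : X -> R[i]) a b : Acmeasurable s -> sq_conditionable b ->
  MEM a (fun x => s x * b x) = MEM (fun x => s x * a x) b.
Proof.
move=> ms sb; have ssb := sq_conditionable_mul hA ms sb.
apply/seteqP; split => -[f g] /MEMP[Lf cf Lg e]; apply/MEMP;
  have sf := L2_sq_conditionable hA Lf;
  have c := sq_conditionableM hA sb sf;
  have E := cond_expCM hA ms c.
  split; [exact: Lf|exact: c|exact: Lg|].
  apply: aeS2 e E => x ->; rewrite (_ : (fun y => s y * b y * f y) = (fun y => s y * (b y * f y))).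
    by move=> ->; ring.
  by apply/funext => y; ring.
split; [exact: Lf|exact: (sq_conditionableM hA ssb sf)|exact: Lg|].
apply: aeS2 e E => x ->; rewrite (_ : (fun y => s y * b y * f y) = (fun y => s y * (b y * f y))).
  by move=> ->; ring.
by apply/funext => y; ring.
Qed.

(** By [integral_sq_mul]; this is how the weight [w] is exchanged for multiples of [conj
    u]. *)
Lemma L2_mul_Esq_eq m a b : Acmeasurable m -> cmeasurable a -> cmeasurable b ->
  {ae mu, forall x, ((cmod m x ^+ 2)%:E * Esq a x = (cmod m x ^+ 2)%:E * Esq b x)%E} ->
  (L2 (fun x => m x * a x) <-> L2 (fun x => m x * b x)) /\
  sqnorm (fun x => m x * a x) = sqnorm (fun x => m x * b x).
Proof.
move=> mm ma mb e; have mmX := subalg_cmeasurable hA mm.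
have I : (\int[mu]_x ((cmod (fun x => m x * a x)%R x) ^+ 2)%:E =
  \int[mu]_x ((cmod (fun x => m x * b x)%R x) ^+ 2)%:E)%E.
  rewrite (integral_sq_mul hA mm ma) (integral_sq_mul hA mm mb); apply: ge0_ae_eq_integral => //.
  - apply: emeasurable_funM.
      by apply/measurable_EFinP/measurable_cmod_sqr.
    by apply: (subalg_measurable_fun hA); exact: measurable_Esq.
  - apply: emeasurable_funM.
      by apply/measurable_EFinP/measurable_cmod_sqr.
    by apply: (subalg_measurable_fun hA); exact: measurable_Esq.
  - by move=> x _; rewrite mule_ge0 ?cmod_sqr_ge0 ?Esq_ge0.
  - by move=> x _; rewrite mule_ge0 ?cmod_sqr_ge0 ?Esq_ge0.
  - by apply: aeS e => x.
split; last exact: sqnorm_congr I.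
split=> -[_ i]; split; [exact: cmeasurableM|by rewrite -I|exact: cmeasurableM|by rewrite I].
Qed.

(** Over [B], the integral of [|a|^2] is that of its conditional expectation. *)
Lemma ae_eq0_of_Esq a (B : set X) : A B -> cmeasurable a ->
  {ae mu, forall x, B x -> Esq a x = 0%E} -> {ae mu, forall x, B x -> a x = 0}.
Proof.
move=> AB ma e.
have mB : measurable B by exact: (subalg_sub hA).
have mchi := indic_Acmeasurable hA AB.
have I : (\int[mu]_x ((cmod (fun x => (\1_B x)%:C * a x)%R x) ^+ 2)%:E = 0)%E.
  rewrite (integral_sq_mul hA)//.
  rewrite (@ge0_ae_eq_integral _ _ _ mu setT _ (cst 0%E)) ?integral0//.
  - apply: emeasurable_funM.
      by apply/measurable_EFinP/measurable_cmod_sqr; exact: (subalg_cmeasurable hA).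
    by apply: (subalg_measurable_fun hA); exact: measurable_Esq.
  - by move=> x _; rewrite mule_ge0 ?cmod_sqr_ge0 ?Esq_ge0.
  - apply: aeS e => x + _; rewrite /cmod normc_real indicE.
    case: (boolP (x \in B)) => [/set_mem Bx /(_ Bx) ->|_ _].
      by rewrite mule0.
    by rewrite normr0 expr0n mul0e.
have Lc : L2 (fun x => (\1_B x)%:C * a x).
  split; last by rewrite I.
  by apply: cmeasurableM => //; exact: (subalg_cmeasurable hA).
have := sqnorm_integral0 I.
move=> /(sqnorm_eq0 Lc); apply: aeS => x + Bx.
by rewrite indicE mem_set// mul1r.
Qed.

Lemma measurable_esupport a : A (esupport (Esq a)).
Proof.
apply/(subalg_measurableE hA); rewrite /esupport.
rewrite -[X in measurable X]setTI; apply: emeasurable_neq => //.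
exact: measurable_Esq.
Qed.

Lemma ae_esupport a : cmeasurable a ->
  {ae mu, forall x, a x = (\1_(esupport (Esq a)) x)%:C * a x}.
Proof.
move=> ma; have AS := measurable_esupport a.
have AS' : A (~` esupport (Esq a)).
  by apply/(subalg_measurableE hA); apply: measurableC; exact/(subalg_measurableE hA).
have e : {ae mu, forall x, (~` esupport (Esq a)) x -> Esq a x = 0%E}.
  by apply: aeW => x /negP /negPn /eqP.
apply: aeS (ae_eq0_of_Esq AS' ma e) => x; rewrite indicE.
case: (boolP (x \in _)) => [_ _|]; first by rewrite mul1r.
by rewrite notin_setE => xS ->; rewrite ?mulr0.
Qed.

Lemma cond_expC_esupport a f : cmeasurable a -> conditionable mu A (fun x => a x * f x) ->
  cmeasurable f ->
  {ae mu, forall x, EC (fun y => a y * f y) x =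
     (\1_(esupport (Esq a)) x)%:C * EC (fun y => a y * f y) x}.
Proof.
move=> ma cf mf.
have mchi := indic_Acmeasurable hA (measurable_esupport a).
have e : {ae mu, forall x, a x * f x = (\1_(esupport (Esq a)) x)%:C * (a x * f x)}.
  by apply: aeS (ae_esupport ma) => x {1}->; rewrite mulrA.
have c := conditionableM hA mchi cf.
rewrite [X in {ae mu, forall x, X x = _}](cond_expC_ae_congr hA cf.1 c.1 e).
exact: (cond_expCM hA mchi cf).
Qed.

End weights.

(** * The Abel-Dini theorem *)

Section abel_dini.
Context {R : realType}.
Variable e : nat -> R.
Hypothesis e0 : forall k, 0 <= e k.

Definition psum n : R := \sum_(k < n) e k.

Lemma psumS n : psum n.+1 = psum n + e n.
Proof. by rewrite /psum big_ord_recr. Qed.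

Lemma psum_ge0 n : 0 <= psum n.
Proof. by apply: sumr_ge0. Qed.

Lemma psum_mono m n : (m <= n)%N -> psum m <= psum n.
Proof.
move=> /subnK <-; elim: (n - m)%N => [|i IH]; first by rewrite add0n.
by rewrite addSn psumS; apply: le_trans IH _; rewrite lerDl.
Qed.

(** With [s k = 1 + psum k], each term is at most [1 / s k - 1 / s k.+1], and these
    differences telescope. *)
Lemma sum_div_sqr_psum_le n : \sum_(k < n) (1 + psum k.+1)^-1 ^+ 2 * e k <= 1.
Proof.
suff H : \sum_(k < n) (1 + psum k.+1)^-1 ^+ 2 * e k <= 1 - (1 + psum n)^-1.
  apply: le_trans H _; rewrite gerBl invr_ge0 addr_ge0//; exact: psum_ge0.
elim: n => [|n IH]; first by rewrite big_ord0 /psum big_ord0 addr0 invr1 subrr.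
rewrite big_ord_recr/=; apply: (le_trans (lerD IH (lexx _))).
have s0 := psum_ge0 n; have en := e0 n.
have a0 : 0 < 1 + psum n by lra.
have b0 : 0 < 1 + psum n.+1 by rewrite psumS; lra.
have -> : e n = (1 + psum n.+1) - (1 + psum n) by rewrite psumS; ring.
have ab : 1 + psum n <= 1 + psum n.+1 by rewrite psumS; lra.
move: a0 b0 ab; move: (1 + psum n) (1 + psum n.+1) => a b a0 b0 ab.
have -> : b^-1 ^+ 2 * (b - a) = (a^-1 - b^-1) * (a / b) by field; rewrite !gt_eqF.
have d0 : 0 <= a^-1 - b^-1 by rewrite subr_ge0 lef_pV2.
have q1 : a / b <= 1 by rewrite ler_pdivrMr// mul1r.
have : (a^-1 - b^-1) * (a / b) <= (a^-1 - b^-1) by rewrite ler_piMr.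
lra.
Qed.

(** Each denominator is replaced by the largest one. *)
Lemma sum_div_psum_tail m n : (m <= n)%N ->
  1 - (1 + psum m) / (1 + psum n) <= \sum_(m <= k < n) (1 + psum k.+1)^-1 * e k.
Proof.
move=> mn; have sm := psum_ge0 m; have sn := psum_ge0 n.
have n0 : 0 < 1 + psum n by lra.
have -> : 1 - (1 + psum m) / (1 + psum n) = \sum_(m <= k < n) (1 + psum n)^-1 * e k.
  rewrite -big_distrr/=.
  have -> : \sum_(m <= k < n) e k = psum n - psum m.
    have E : \sum_(0 <= k < n) e k = \sum_(0 <= k < m) e k + \sum_(m <= k < n) e k.
      by rewrite (big_cat_nat (leq0n m) mn).
    by move: E; rewrite !big_mkord -!/(psum _) /= => ->; rewrite addrAC subrr add0r.
  by field; rewrite gt_eqF.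
rewrite big_nat_cond [leRHS]big_nat_cond; apply: ler_sum => k /andP[/andP[mk kn] _].
rewrite ler_wpM2r// lef_pV2 ?posrE//; last by have := psum_ge0 k.+1; lra.
by rewrite lerD2l psum_mono.
Qed.

(** By [sum_div_psum_tail], a block over which the partial sums more than double
    contributes at least one half, and divergence provides infinitely many disjoint
    blocks. *)
Lemma abel_dini : (\sum_(k <oo) (e k)%:E = +oo)%E ->
  (\sum_(k <oo) ((1 + psum k.+1)^-1 * e k)%:E = +oo)%E.
Proof.
move=> eoo.
have t0 k : 0 <= (1 + psum k.+1)^-1 * e k.
  by rewrite mulr_ge0// invr_ge0 addr_ge0// psum_ge0.
have unb (M : R) : exists n, M < psum n.
  apply: contrapT => /forallNP nM.
  suff : (\sum_(k <oo) (e k)%:E <= M%:E)%E by rewrite eoo.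
  apply: lime_le; first by apply: is_cvg_nneseries => k _ _; rewrite lee_fin.
  apply: nearW => n; rewrite sumEFin lee_fin leNgt.
  by rewrite big_mkord -/(psum n); apply/negP/nM.
have half (j : nat) : exists n, (j%:R / 2 <= \sum_(0 <= k < n) (1 + psum k.+1)^-1 * e k).
  elim: j => [|j [n jn]]; first by exists 0%N; rewrite big_geq// mul0r.
  have [m nm] := unb (1 + 2 * psum n).
  have sn := psum_ge0 n.
  have le : (n <= m)%N.
    rewrite leqNgt; apply/negP => mn; have := psum_mono (ltnW mn); lra.
  exists m; rewrite (big_cat_nat _ le)//=.
  apply: (@le_trans _ _ (j%:R / 2 + (1 - (1 + psum n) / (1 + psum m)))); last first.
    by apply: lerD => //; exact: sum_div_psum_tail.
  have m0 : 0 < 1 + psum m by lra.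
  have : (1 + psum n) / (1 + psum m) <= 2^-1 by rewrite ler_pdivrMr//; lra.
  rewrite -[j.+1%:R]natr1; lra.
apply/eqyP => M M0.
have [n nM] := half (Num.truncn (2 * M)).+1.
have := @nneseries_lim_ge _ (fun k => ((1 + psum k.+1)^-1 * e k)%:E) xpredT 0%N n
  (fun k _ _ => t0 k).
apply: le_trans; rewrite sumEFin lee_fin (le_trans _ nM)//.
have := truncnS_gt (2 * M); lra.
Qed.

End abel_dini.

(** * Closedness forces a finite second moment *)

Lemma l2dist_self_cvg {d} {X : measurableType d} {R : realType}
    (mu : {measure set X -> \bar R}) (f : X -> R[i]) :
  l2dist mu f f @[n --> \oo] --> (0 : R).
Proof.
rewrite (_ : l2dist mu f f = 0); first exact: cvg_cst.
rewrite /l2dist (_ : (fun x => _) = cst 0) ?/l2norm -?/(sqnorm mu _) ?sqnorm0 ?sqrtr0//.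
by apply/funext => x /=; rewrite subrr.
Qed.

Section cond_exp_series.
Context {d : measure_display} {X : measurableType d} {R : realType}.
Variables (mu : {measure set X -> \bar R}) (A : set (set X)).
Hypothesis hA : sigma_finite_subalgebra mu A.
Local Notation E f := (cond_exp mu A (EFin \o f%R)).

Lemma nneseries_single (f : nat -> \bar R) n : (forall k, (0 <= f k)%E) ->
  (forall k, k != n -> f k = 0%E) -> (\sum_(k <oo) f k = f n)%E.
Proof.
move=> f0 fn; rewrite (nneseriesD1 (n := n))//= [X in (_ + X)%E]eseries0 ?adde0//.
by move=> k _; exact: fn.
Qed.

Lemma cond_exp_series (phi : nat -> X -> R) (f : X -> R) :
  (forall k, measurable_fun setT (phi k)) -> (forall k x, 0 <= phi k x) ->
  measurable_fun setT f -> (forall x, 0 <= f x) ->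
  (forall x, (f x)%:E = \sum_(k <oo) (phi k x)%:E)%E ->
  {ae mu, forall x, E f x = \sum_(k <oo) E (phi k) x}%E.
Proof.
move=> mphi phi0 mf f0 fs; apply: (cond_exp_unique hA mf f0); split.
- apply: ge0_emeasurable_sum => k; first by move=> *; exact: cond_exp_ge0.
  by move=> _; exact: measurable_cond_exp.
- by move=> x; apply: nneseries_ge0 => k _ _; exact: cond_exp_ge0.
- move=> B AB.
  have mB : measurable B by exact: (subalg_sub hA).
  rewrite (eq_integral (fun x => \sum_(k <oo) (phi k x)%:E)%E); last first.
    by move=> x _; exact: fs.
  rewrite integral_nneseries//; last 2 first.
  + by move=> k; apply/measurable_EFinP/measurable_funTS.
  + by move=> k x _; rewrite lee_fin.
  rewrite integral_nneseries//; last 2 first.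
  + by move=> k; apply: measurable_funTS; apply: (subalg_measurable_fun hA); exact: measurable_cond_exp.
  + by move=> k x _; exact: cond_exp_ge0.
  by apply: eq_eseriesr => k _; exact: cond_exp_integral.
Qed.

End cond_exp_series.

Section finite_second_moment.
Context {d : measure_display} {X : measurableType d} {R : realType}.
Variables (mu : {measure set X -> \bar R}) (A : set (set X)).
Hypothesis hA : sigma_finite_subalgebra mu A.
Local Notation XA := (g_sigma_algebraType A).
Local Notation EC := (cond_expC mu A).
Local Notation E f := (cond_exp mu A (EFin \o f%R)).
Local Notation Esq f := (cond_exp_sq mu A f%R).
Local Notation "'Acmeasurable' f" := (@cmeasurable _ XA R f) (at level 10).
Local Notation "'Ameasurable' f" := (measurable_fun [set: XA] (f : X -> R)) (at level 10).
Local Notation L2 := (L2 mu).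
Local Notation MEM := (MEM mu A).
Local Notation sqnorm := (sqnorm mu).
Local Notation sq_conditionable := (sq_conditionable mu A).
Local Notation fexp := (fexp mu A).

Variables w u : X -> R[i].
Hypothesis cu : conditionable mu A u.

Let mu_ : cmeasurable u. Proof. by case: cu. Qed.

(** [|u|^2] is cut into the slices [phi k], supported where [kappa = k]. There [|u|] is
    bounded, so each slice has a finite conditional expectation [e k] although [E |u|^2]
    may be infinite; [pp] is the sequence of partial sums of [e]. *)
Let kappa x := Num.truncn (cmod u x).
Let phi k x : R := cmod u x ^+ 2 * (kappa x == k)%:R.
Let rho n x : R := (kappa x < n)%N%:R.
Let e k x : R := fexp (phi k) x.
Let pp n x : R := psum (fun k => e k x) n.

Let cmod0 x : 0 <= cmod u x. Proof. exact: normc_ge0'. Qed.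

Let mslice k : measurable [set x | kappa x == k].
Proof.
have -> : [set x | kappa x == k] = [set x | k%:R <= cmod u x] `&` [set x | cmod u x < k.+1%:R].
  apply/seteqP; split => x /=.
    by move=> /eqP <-; have /andP[] := truncn_itv (cmod0 x).
  by move=> [h1 h2]; apply/eqP/truncn_def; rewrite h1.
have mm := measurable_cmod mu_.
apply: measurableI.
  rewrite (_ : [set x | _] = cmod u @^-1` `[k%:R, +oo[%classic); last first.
    by apply/seteqP; split => x /=; rewrite in_itv/= andbT.
  by rewrite -[X in measurable X]setTI; exact: mm.
rewrite (_ : [set x | _] = cmod u @^-1` `]-oo, k.+1%:R[%classic); last first.
  by apply/seteqP; split => x /=; rewrite in_itv.
by rewrite -[X in measurable X]setTI; exact: mm.
Qed.

Let mind k : measurable_fun setT (fun x => (kappa x == k)%:R : R).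
Proof.
rewrite (_ : (fun x => _) = \1_[set x | kappa x == k]); first exact: measurable_indic.
apply/funext => x; rewrite indicE; congr (nat_of_bool _)%:R.
by apply/idP/idP => [h|/set_mem//]; exact/mem_set.
Qed.

Let mphi k : measurable_fun setT (phi k).
Proof. by apply: measurable_funM => //; exact: measurable_cmod_sqr. Qed.

Let phi0 k x : 0 <= phi k x.
Proof. by rewrite mulr_ge0// sqr_ge0. Qed.

Let mrho n : measurable_fun setT (rho n).
Proof.
have -> : rho n = (fun x => \sum_(k < n) (kappa x == k)%:R : R).
  apply/funext => x; rewrite /rho; elim: n => [|n IH]; first by rewrite big_ord0.
  rewrite big_ord_recr/= -IH ltnS leq_eqVlt; case: (ltngtP (kappa x) n) => //= _;
    by rewrite ?addr0 ?add0r.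
by apply: measurable_sum => k; exact: mind.
Qed.

Let phi_le k x : phi k x <= k.+1%:R * cmod u x.
Proof.
rewrite /phi; case: eqP => [<-|_]; last by rewrite mulr0 mulr_ge0.
by rewrite mulr1 expr2 ler_wpM2r// ltW// truncnS_gt.
Qed.

Let linfin (c : R) : 0 <= c -> {ae mu, forall x, (E (fun x => c * cmod u x) x < +oo)%E}.
Proof.
move=> c0; have mc : Ameasurable (fun _ => c) by exact: measurable_cst.
apply: aeS (fexpM hA mc (measurable_cmod mu_) (fun _ => c0) cmod0 cu.2) => x [] //.
Qed.

Let efin k : {ae mu, forall x, (E (phi k) x < +oo)%E}.
Proof.
apply: cond_exp_lty_le (linfin (ler0n R k.+1)) => //.
by apply: measurable_funM => //; exact: measurable_cmod.
Qed.

Let e0 k x : 0 <= e k x. Proof. exact: fexp_ge0. Qed.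

Let me k : Ameasurable (e k). Proof. exact: measurable_fexp. Qed.

Let mpp n : Ameasurable (pp n).
Proof. by apply: measurable_sum => k; exact: me. Qed.

Let pp0 n x : 0 <= pp n x. Proof. exact: psum_ge0. Qed.

Let rhoS n x : cmod u x ^+ 2 * rho n.+1 x = cmod u x ^+ 2 * rho n x + phi n x.
Proof.
rewrite /rho /phi -mulrDr ltnS leq_eqVlt; congr (_ * _).
by case: (ltngtP (kappa x) n) => //= _; rewrite ?addr0 ?add0r.
Qed.

Let Erho n : {ae mu, forall x, E (fun x => cmod u x ^+ 2 * rho n x) x = (pp n x)%:E}.
Proof.
elim: n => [|n IH].
  have := cond_expM hA (m := cst 0) (f := fun x => cmod u x) (@measurable_cst _ _ XA _ _ _)
    (measurable_cmod mu_) (fun=> lexx _) cmod0.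
  apply: aeS => x; rewrite mul0e => h.
  rewrite /pp /psum big_ord0; apply: etrans h; congr (cond_exp _ _ _ _); apply/funext => y.
  by rewrite /= /rho ltn0 mulr0 mul0r.
have m1 : measurable_fun setT (fun x => cmod u x ^+ 2 * rho n x).
  by apply: measurable_funM => //; exact: measurable_cmod_sqr.
have p1 x : 0 <= cmod u x ^+ 2 * rho n x by rewrite mulr_ge0 ?sqr_ge0// /rho ler0n.
apply: aeS3 (cond_expD hA m1 (mphi n) p1 (phi0 n)) IH (efin n) => x.
under eq_fun do rewrite -rhoS.
by move=> -> -> fo; rewrite /pp psumS EFinD /e -fexpK.
Qed.

Let series_pick (c : nat -> X -> R) x : (forall k, 0 <= c k x) ->
  ((c (kappa x) x * cmod u x ^+ 2)%:E = \sum_(k <oo) (c k x * phi k x)%:E)%E.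
Proof.
move=> c0; rewrite (nneseries_single (n := kappa x)).
- by rewrite /phi eqxx mulr1.
- by move=> k; rewrite lee_fin mulr_ge0.
- by move=> k; rewrite eq_sym /phi => /negbTE ->; rewrite !mulr0.
Qed.

Let mseries_pick (c : nat -> X -> R) : (forall k, measurable_fun setT (c k)) ->
  measurable_fun setT (fun x => c (kappa x) x).
Proof.
move=> mc; apply: (@measurable_fun_cvg _ _ _ setT
  (fun n x => \sum_(k < n) (c k x * (kappa x == k)%:R))).
  by move=> n; apply: measurable_sum => k; apply: measurable_funM.
move=> x _; apply: cvg_near_cst; exists (kappa x).+1 => // n kn /=.
rewrite (bigD1 (Ordinal kn))//= eqxx mulr1 big1 ?addr0// => i.
rewrite -val_eqE/= eq_sym => /negbTE ->; exact: mulr0.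
Qed.

(** The pull-out rule, slice by slice, for a factor that depends on the slice. *)
Let Epick (c : nat -> X -> R) : (forall k, Ameasurable (c k)) -> (forall k x, 0 <= c k x) ->
  {ae mu, forall x, (E (fun x => c (kappa x) x * cmod u x ^+ 2) x =
     \sum_(k <oo) (c k x * e k x)%:E)%E}.
Proof.
move=> mc c0.
have mcX k := subalg_measurable_fun hA (mc k).
have H k : {ae mu, forall x, E (fun x => c k x * phi k x) x = (c k x * e k x)%:E}.
  apply: aeS (fexpM hA (mc k) (mphi k) (c0 k) (phi0 k) (efin k)) => x [fo eq].
  by rewrite fexpK// eq.
have S := @cond_exp_series _ _ _ mu A hA (fun k x => c k x * phi k x)
  (fun x => c (kappa x) x * cmod u x ^+ 2) _ _ _ _ _.
apply: aeS2 (ae_foralln H) (S _ _ _ _ _) => [x h ->| | | | |].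
- by apply: eq_eseriesr => k _; exact: h.
- by move=> k; exact: measurable_funM.
- by move=> k x; rewrite mulr_ge0.
- by apply: measurable_funM; [exact: mseries_pick|exact: measurable_cmod_sqr].
- by move=> x; rewrite mulr_ge0// sqr_ge0.
- by move=> x; apply: series_pick => k.
Qed.

Let EsqE : {ae mu, forall x, (Esq u x = \sum_(k <oo) (e k x)%:E)%E}.
Proof.
have := Epick (c := fun _ _ => 1) (fun k => measurable_cst _) (fun _ _ => ler01).
apply: aeS => x; rewrite (_ : (fun x => 1 * _) = (fun x => cmod u x ^+ 2)).
  by rewrite /cond_exp_sq => ->; apply: eq_eseriesr => k _; rewrite mul1r.
by apply/funext => y; rewrite mul1r.
Qed.

Let pp_unbounded : {ae mu, forall x, Esq u x = +oo%E ->
  forall K, exists N, forall n, (N <= n)%N -> K <= pp n x}.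
Proof.
apply: aeS EsqE => x -> oo K.
apply: contrapT => /forallNP nK.
suff : (\sum_(k <oo) (e k x)%:E <= K%:E)%E by rewrite oo.
apply: lime_le; first by apply: is_cvg_nneseries => k _ _; rewrite lee_fin.
apply: nearW => n; rewrite sumEFin lee_fin big_mkord leNgt; apply/negP => Kn.
apply: (nK n) => k nk; apply: le_trans (ltW Kn) _.
exact: (@psum_mono _ (fun k => e k x) (fun k => e0 k x)).
Qed.

Hypothesis closedT : closed_operator mu (MEM w u).

(** Where [E |u|^2] is infinite, [E (u f)] can be cancelled at arbitrarily small cost:
    subtracting [conj u * E (u f) / pp N], restricted to [|u| < N], does it where [pp N
    >= 1], and the conditional second moment of this correction is [|E (u f)|^2 / pp N],
    which tends to 0. The corrected functions are sent to 0, and the operator is closed. *)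
Lemma MEM_vanish f (B : set X) (M : R) : L2 f -> conditionable mu A (fun x => u x * f x) ->
  A B -> (mu B < +oo)%E -> 0 <= M ->
  {ae mu, forall x, B x -> Esq u x = +oo%E} -> (forall x, ~ B x -> f x = 0) ->
  {ae mu, forall x, B x -> cmod (EC (fun y => u y * f y)) x <= M} ->
  MEM w u (f, cst 0).
Proof.
move=> Lf cf AB Bfin M0 Boo fB bM.
have mB : measurable B by exact: (subalg_sub hA).
pose D N : set XA := [set x | 1 <= pp N x].
have AD N : A (D N).
  apply/(subalg_measurableE hA).
  rewrite (_ : D N = pp N @^-1` `[1, +oo[%classic); last first.
    by apply/seteqP; split => x /=; rewrite /D /= in_itv/= andbT.
  by rewrite -[X in measurable X]setTI; exact: mpp.
have mD N : measurable (D N : set X).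
  exact: (subalg_sub hA).
pose chi N x : R[i] := (\1_(D N) x)%:C.
have mchi N : Acmeasurable (chi N) by exact: (indic_Acmeasurable hA (AD N)).
have mF : Acmeasurable (EC (fun y => u y * f y)) by exact: measurable_cond_expC.
pose m x : R[i] := (\1_B x)%:C * EC (fun y => u y * f y) x.
have mm : Acmeasurable m.
  exact: (@cmeasurableM _ XA _ _ _ (indic_Acmeasurable hA AB) mF).
have mE : {ae mu, forall x, EC (fun y => u y * f y) x = m x}.
  apply: aeS (cond_expCM hA (indic_Acmeasurable hA AB) cf) => x.
  have -> // : (fun y => (\1_B y)%:C * (u y * f y)) = (fun y => u y * f y).
  apply/funext => y; rewrite indicE; case: (boolP (y \in B)) => [_|]; first by rewrite mul1r.
  by rewrite notin_setE => /fB ->; rewrite !mulr0.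
have mbd : {ae mu, forall x, cmod m x ^+ 2 <= M ^+ 2 * \1_B x}.
  apply: aeS bM => x; rewrite /cmod /m normcM' normc_real exprMn indicE.
  case: (boolP (x \in B)) => [/set_mem Bx /(_ Bx) h|_ _].
    by rewrite normr1 expr1n mul1r mulr1 ler_sqr ?nnegrE ?normc_ge0'.
  by rewrite normr0 expr0n mul0r mulr0.
(* [s N * a N] is the correction; [chi N] cuts to [pp N >= 1], where dividing is safe *)
pose s N x : R[i] := chi N x * m x * ((pp N x)^-1)%:C.
have ms N : Acmeasurable (s N).
  apply: (@cmeasurableM _ XA); first exact: (@cmeasurableM _ XA).
  by apply: Acmeasurable_real; apply: (@measurable_invr_ge0 _ XA _) => // x; exact: pp0.
pose a N x : R[i] := (rho N x)%:C * (u x)^*.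
have ma N : cmeasurable (a N).
  by apply: cmeasurableM; [exact: cmeasurable_real|exact: cmeasurable_conj].
have sqa N x : cmod (a N) x ^+ 2 = cmod u x ^+ 2 * rho N x.
  rewrite /cmod /a normcM' normc_real normc_conjc exprMn mulrC; congr (_ * _).
  by rewrite /rho; case: (_ < _)%N; rewrite ?normr1 ?normr0 ?expr1n ?expr0n.
have Ea N : {ae mu, forall x, Esq (a N) x = (pp N x)%:E}.
  apply: aeS (Erho N) => x <-; rewrite /cond_exp_sq; congr (cond_exp _ _ _ _).
  by apply/funext => y /=; rewrite sqa.
have sbd N : {ae mu, forall x, cmod (s N) x ^+ 2 * pp N x <= M ^+ 2 * \1_B x * (pp N x)^-1 /\
    cmod (s N) x ^+ 2 * pp N x <= M ^+ 2 * \1_B x}.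
  apply: aeS mbd => x mx.
  have b0 : 0 <= M ^+ 2 * \1_B x by rewrite mulr_ge0 ?sqr_ge0// indicE ler0n.
  rewrite /cmod /s 2!normcM' /chi 2!normc_real 2!exprMn [\1_(D N) x]indicE -/(cmod m x).
  case: (boolP (x \in D N)) => [/set_mem Dx|_]; last first.
    rewrite normr0 expr0n/= !mul0r; split => //.
    by rewrite mulr_ge0// invr_ge0.
  have p1 : 1 <= pp N x by [].
  have ppos : 0 < pp N x by lra.
  rewrite normr1 expr1n mul1r ger0_norm ?invr_ge0//.
  have -> : cmod m x ^+ 2 * (pp N x)^-1 ^+ 2 * pp N x =
      cmod m x ^+ 2 * (pp N x)^-1 by field; rewrite gt_eqF.
  have pv0 : 0 <= (pp N x)^-1 by rewrite invr_ge0.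
  have pv1 : (pp N x)^-1 <= 1 by rewrite invf_le1.
  have le : cmod m x ^+ 2 * (pp N x)^-1 <= M ^+ 2 * \1_B x * (pp N x)^-1.
    by rewrite ler_wpM2r.
  split; first exact: le.
  by apply: le_trans le _; rewrite ler_piMr.
have Lc N : L2 (fun x => s N x * a N x).
  apply: (L2_mul_bounded hA (ms N) (ma N) AB Bfin (sqr_ge0 M)).
  apply: aeS2 (Ea N) (sbd N) => x -> [_ h].
  by rewrite -EFinM lee_fin.
have c0 : sqnorm (fun x => s N x * a N x) @[N --> \oo] --> (0 : R).
  have Ic N : (\int[mu]_x (cmod (fun x => s N x * a N x)%R x ^+ 2)%:E =
      \int[mu]_x (cmod (s N) x ^+ 2 * pp N x)%:E)%E.
    rewrite (integral_sq_mul hA (ms N) (ma N)); apply: ge0_ae_eq_integral => //.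
    - apply: emeasurable_funM.
        by apply/measurable_EFinP; exact: (measurable_cmod_sqr (subalg_cmeasurable hA (ms N))).
      by apply: (subalg_measurable_fun hA); exact: measurable_Esq.
    - apply/measurable_EFinP; apply: measurable_funM.
        exact: (measurable_cmod_sqr (subalg_cmeasurable hA (ms N))).
      exact: (subalg_measurable_fun hA).
    - by move=> x _; rewrite mule_ge0 ?cmod_sqr_ge0 ?Esq_ge0.
    - by move=> x _; rewrite lee_fin mulr_ge0// sqr_ge0.
    - by apply: aeS (Ea N) => x -> _; rewrite EFinM.
  have iB : mu.-integrable setT (EFin \o (fun x => M ^+ 2 * \1_B x)).
    apply/integrableP; split.
      by apply/measurable_EFinP; apply: measurable_funM => //; exact: measurable_indic.
    rewrite (eq_integral (fun x => (M ^+ 2)%:E * (\1_B x)%:E))%E; last first.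
      by move=> x _; rewrite gee0_abs -?EFinM// lee_fin mulr_ge0 ?sqr_ge0// indicE ler0n.
    rewrite ge0_integralZl_EFin ?sqr_ge0//; last exact/measurable_EFinP/measurable_indic.
    by rewrite integral_indic// setIT lte_mul_pinfty// lee_fin sqr_ge0.
  have [] := @dominated_convergence _ _ _ mu setT measurableT
    (fun N x => (cmod (s N) x ^+ 2 * pp N x)%:E) (cst 0%E)
    (EFin \o (fun x => M ^+ 2 * \1_B x)).
  - move=> N; apply/measurable_EFinP; apply: measurable_funM.
      exact: (measurable_cmod_sqr (subalg_cmeasurable hA (ms N))).
    exact: (subalg_measurable_fun hA).
  - exact: measurable_cst.
  - apply: aeS3 (ae_foralln sbd) Boo pp_unbounded => x h oo unb _.
    apply/fine_cvgP; split; first exact: nearW.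
    rewrite /=; apply/cvgrPdist_lt => eps eps0.
    have nn N : 0 <= cmod (s N) x ^+ 2 * pp N x by rewrite mulr_ge0// sqr_ge0.
    have [Bx|nBx] := pselect (B x); last first.
      apply: nearW => N; rewrite sub0r normrN (ger0_norm (nn N)).
      have [_] := h N; rewrite indicE memNset// mulr0 => /le_lt_trans; exact.
    have [N HN] := unb (oo Bx) (M ^+ 2 / eps + 1).
    exists N => // n Nn; rewrite /mkset sub0r normrN (ger0_norm (nn n)).
    have [le _] := h n; apply: le_lt_trans le _.
    rewrite indicE mem_set// mulr1.
    have K0 : 0 <= M ^+ 2 / eps by rewrite divr_ge0 ?sqr_ge0 ?ltW.
    have pn := HN n Nn; have ppos : 0 < pp n x by lra.
    rewrite ltr_pdivrMr// -ltr_pdivrMl// mulrC; lra.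
  - exact: iB.
  - apply: aeS (ae_foralln sbd) => x h N _ /=.
    rewrite ger0_norm; last by rewrite mulr_ge0// sqr_ge0.
    by have [_] := h N; rewrite lee_fin.
  move=> _ _; rewrite integral0 => cc.
  have -> : (fun N => sqnorm (fun x => s N x * a N x)) =
      (fun N => fine (\int[mu]_x (cmod (s N) x ^+ 2 * pp N x)%:E)%E).
    by apply/funext => N; rewrite -Ic.
  by case/fine_cvgP : cc.
have cua N : conditionable mu A (fun x => u x * a N x).
  apply: (conditionable_le hA (b := fun x => cmod u x ^+ 2 * rho N x)).
  - exact: cmeasurableM.
  - by apply: measurable_funM => //; exact: measurable_cmod_sqr.
  - move=> x; rewrite /cmod /a !normcM' normc_real normc_conjc ger0_norm ?ler0n//.
    by rewrite le_eqVlt; apply/orP; left; apply/eqP; ring.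
  - by apply: aeS (Erho N) => x ->; exact: ltry.
have Eua N : {ae mu, forall x, EC (fun x => u x * a N x) x = (pp N x)%:C}.
  have -> : (fun x => u x * a N x) = (fun x => (cmod u x ^+ 2 * rho N x)%:C).
    apply/funext => x; rewrite rmorphM/= -mulc_conj /a; ring.
  have m2 : measurable_fun setT (fun x => cmod u x ^+ 2 * rho N x).
    by apply: measurable_funM => //; exact: measurable_cmod_sqr.
  have p2 x : 0 <= cmod u x ^+ 2 * rho N x by rewrite mulr_ge0 ?sqr_ge0// /rho ler0n.
  by apply: aeS2 (cond_expC_real hA m2 p2) (Erho N) => x ->; rewrite fexpE => ->.
pose fs N x := chi N x * f x + - (s N x * a N x).
have Lfs N : L2 (fs N) by apply: L2D; [exact: L2_indic|exact: L2N].
have Tfs N : MEM w u (fs N, cst 0).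
  have mms : Acmeasurable (fun x => - s N x) by exact: (@cmeasurableN _ XA).
  have e1 : (fun x => u x * fs N x) = (fun x => chi N x * (u x * f x) + (- s N x) * (u x * a N x)).
    by apply/funext => x; rewrite /fs; ring.
  have c1 := conditionableM hA (mchi N) cf.
  have c2 := conditionableM hA mms (cua N).
  apply/MEMP; rewrite e1; split; [exact: Lfs|exact: (conditionableD hA c1 c2)|exact: L20|].
  apply: aeS4 (aeI (cond_expCD hA c1 c2) (cond_expCM hA (mchi N) cf))
    (cond_expCM hA mms (cua N)) (Eua N) mE => x [-> ->] -> -> ->.
  rewrite [LHS]/= /s /chi indicE; case: (boolP (x \in D N)) => [/set_mem Dx|_].
    have p1 : 1 <= pp N x by [].
    have pn0 : (pp N x)%:C != 0 :> R[i].
      by rewrite (_ : 0 = 0%:C)// (inj_eq (@complexI _)) gt_eqF//; lra.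
    rewrite fmorphV/=.
    have -> : 1%:C * m x + - (1%:C * m x * ((pp N x)%:C)^-1) * (pp N x)%:C = 0; last by rewrite mulr0.
    by rewrite mulNr divfK// subrr.
  have -> : (false%:R : R)%:C = 0 :> R[i] by [].
  by rewrite !mul0r oppr0 mul0r addr0 mulr0.
have cfs : l2dist mu (fs N) f @[N --> \oo] --> (0 : R).
  apply: (@l2_cvg_perturb _ _ _ mu (fun N x => chi N x * f x) (fun N x => - (s N x * a N x))).
  - by move=> N; exact: L2_indic.
  - by move=> N; exact: L2N.
  - exact: Lf.
  - apply: (l2_cvg_indic mD Lf).
    apply: aeS2 Boo pp_unbounded => x oo unb.
    have [Bx|/fB ->] := pselect (B x); last by left.
    by right; have [N HN] := unb (oo Bx) 1; exists N.
  - apply: l2norm_cvg0.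
    by rewrite (_ : (fun n => _) = (fun N => sqnorm (fun x => s N x * a N x)))//;
      apply/funext => N; rewrite sqnormN.
exact: (closedT Tfs Lf (L20 mu) cfs (l2dist_self_cvg mu (cst 0))).
Qed.

(** On a set where [E |u|^2] is infinite, let [G = conj u / (1 + pp (kappa + 1))]. At
    each point, [sum_div_sqr_psum_le] for the series of the [e k] gives [E |G|^2 <= 1]
    whereas [E |u G|] is infinite by [abel_dini]. The truncations of [G] to [|u| < m]
    satisfy [MEM_vanish], so by closedness [G] is in the domain, which requires [u G] to
    be conditionable. *)
Lemma closed_MEM_sq_conditionable : sq_conditionable u.
Proof.
split; first exact: mu_.
have [B0 [AB0 B0fin B0b B0ex]] := subalg_level_exhaustion hA
  (@measurable_cond_exp _ _ _ mu A (EFin \o cmod u)) cu.2.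
pose Z := [set x | Esq u x = +oo%E].
suff nB n : {ae mu, forall x, ~ (Z `&` B0 n) x}.
  apply: aeS2 (ae_foralln nB) B0ex => x nZ [N /(_ N (leqnn N)) Bx].
  by rewrite ltey; apply/eqP => Zx; apply: (nZ N).
pose B := Z `&` B0 n.
have AB : A B.
  apply/(subalg_measurableE hA); apply: measurableI; last exact/(subalg_measurableE hA).
  by have := @measurable_Esq _ _ _ mu A u measurableT _ (emeasurable_set1 +oo%E); rewrite setTI.
have mB : measurable B by exact: (subalg_sub hA).
have mB0 : measurable (B0 n) by exact: (subalg_sub hA).
have Bfin : (mu B < +oo)%E.
  by apply: le_lt_trans (B0fin n); apply: le_measure; rewrite ?inE// => x [].
pose sg k x : R := (1 + pp k.+1 x)^-1.
have sg0 k x : 0 <= sg k x by rewrite invr_ge0 addr_ge0.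
have sg1 k x : sg k x <= 1.
  by rewrite invf_le1 ?lerDl//; have := pp0 k.+1 x; lra.
have msg k : Ameasurable (sg k).
  apply: (@measurable_invr_ge0 _ XA _) => [|x]; last by rewrite addr_ge0.
  by apply: measurable_funD => //; exact: measurable_cst.
have m1 : Ameasurable (\1_B).
  by apply: (@measurable_indic _ XA); exact/(subalg_measurableE hA).
have ind01 x : 0 <= \1_B x :> R by rewrite indicE ler0n.
have ind1 x : \1_B x <= 1 :> R by rewrite indicE lern1 leq_b1.
have ind2 x : \1_B x ^+ 2 = \1_B x :> R.
  by rewrite indicE; case: (_ \in _); rewrite ?expr1n ?expr0n.
pose g x : R := \1_B x * sg (kappa x) x.
have mg : measurable_fun setT g.
  apply: measurable_funM; first exact: (subalg_measurable_fun hA).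
  by apply: mseries_pick => k; exact: (subalg_measurable_fun hA).
have g0 x : 0 <= g x by exact: mulr_ge0.
have g1 x : g x <= 1.
  by rewrite -[leRHS]mulr1; apply: ler_pM.
pose G x : R[i] := (g x)%:C * (u x)^*.
have mG : cmeasurable G.
  by apply: cmeasurableM; [exact: cmeasurable_real|exact: cmeasurable_conj].
have cG x : cmod G x = g x * cmod u x.
  by rewrite /cmod /G normcM' normc_real normc_conjc ger0_norm.
have LG : L2 G.
  split => //.
  have c0 k x : 0 <= \1_B x * sg k x ^+ 2 by rewrite mulr_ge0 ?sqr_ge0.
  have mc k : Ameasurable (fun x => \1_B x * sg k x ^+ 2).
    by apply: measurable_funM => //; exact: measurable_funX.
  have e2 x : cmod G x ^+ 2 = (\1_B x * sg (kappa x) x ^+ 2) * cmod u x ^+ 2.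
    by rewrite cG exprMn /g exprMn ind2.
  have m2 : measurable_fun setT (fun x => cmod G x ^+ 2) by exact: measurable_cmod_sqr.
  rewrite (cond_exp_integralT hA m2); last by move=> x; exact: sqr_ge0.
  apply: (@le_lt_trans _ _ (\int[mu]_x (\1_B x)%:E)%E); last first.
    by rewrite integral_indic// setIT.
  apply: ae_ge0_le_integral => //.
  - by move=> x _; exact: cond_exp_ge0.
  - by apply: (subalg_measurable_fun hA); exact: measurable_cond_exp.
  - by apply/measurable_EFinP; exact: (subalg_measurable_fun hA).
  - apply: aeS (Epick mc c0) => x h _.
    rewrite (_ : (fun x => cmod G x ^+ 2) =
      (fun x => (\1_B x * sg (kappa x) x ^+ 2) * cmod u x ^+ 2)); last first.
      by apply/funext => y; exact: e2.
    rewrite h; apply: lime_le.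
      by apply: is_cvg_nneseries => k _ _; rewrite lee_fin mulr_ge0.
    apply: nearW => m; rewrite sumEFin lee_fin big_mkord.
    under eq_bigr do rewrite -mulrA.
    rewrite -big_distrr/= -[leRHS]mulr1 ler_wpM2l//.
    exact: (@sum_div_sqr_psum_le _ (fun k => e k x) (fun k => e0 k x)).
have cuG x : cmod (fun y => u y * G y) x = g x * cmod u x ^+ 2.
  rewrite /cmod normcM' -/(cmod G x) cG /cmod; ring.
pose D m := [set x | (kappa x < m)%N].
have indD m x : \1_(D m) x = rho m x.
  by rewrite indicE /rho; congr (nat_of_bool _)%:R; apply/idP/idP => [/set_mem//|h]; exact/mem_set.
have mD m : measurable (D m).
  apply/(@measurable_indicP _ _ R); rewrite (_ : \1_(D m) = rho m :> (X -> R))//.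
  by apply/funext => x; rewrite indD.
pose Gn m x := (\1_(D m) x)%:C * G x.
have LGn m : L2 (Gn m) by exact: L2_indic.
have TGn m : MEM w u (Gn m, cst 0).
  have bnd x : cmod (fun y => u y * Gn m y) x <= m%:R * cmod u x.
    have -> : cmod (fun y => u y * Gn m y) x = rho m x * (g x * cmod u x ^+ 2).
      have eq : u x * Gn m x = (\1_(D m) x)%:C * (u x * G x) by rewrite /Gn; ring.
      by rewrite -cuG {1}/cmod eq normcM' normc_real indD ger0_norm ?ler0n.
    rewrite /rho; case: (ltnP (kappa x) m) => km; last by rewrite mul0r mulr_ge0.
    have um : cmod u x <= m%:R.
      by apply/ltW/(lt_le_trans (truncnS_gt _)); rewrite ler_nat.
    rewrite mul1r expr2 mulrA ler_wpM2r//.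
    by rewrite -[leRHS]mul1r; apply: ler_pM.
  have mc : Ameasurable (fun _ => m%:R) by exact: measurable_cst.
  have mbd : measurable_fun setT (fun x => m%:R * cmod u x).
    by apply: measurable_funM => //; exact: measurable_cmod.
  have muG : cmeasurable (fun y => u y * Gn m y).
    exact: cmeasurableM mu_ (L2_cmeasurable (LGn m)).
  have cuGn : conditionable mu A (fun y => u y * Gn m y).
    exact: (conditionable_le hA muG mbd bnd (linfin (ler0n R m))).
  have M0 : 0 <= 2 * (m%:R * n%:R) :> R by rewrite mulr_ge0// mulr_ge0.
  apply: (MEM_vanish (LGn m) cuGn AB Bfin M0).
  - by apply: aeW => x [].
  - by move=> x nBx; rewrite /Gn /G /g [\1_B x]indicE memNset// mul0r rmorph0 mul0r mulr0.
  - have L := cond_exp_le hA (measurable_cmod muG) mbd (fun x => normc_ge0' _)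
      (fun x => mulr_ge0 (ler0n R m) (cmod0 x)) (aeW mu bnd).
    have F := fexpM hA mc (measurable_cmod mu_) (fun _ => ler0n R m) cmod0 cu.2.
    apply: aeS4 (cond_expC_le hA cuGn) L F cu.2 => x h1 h2 [h3 h4] h5 [_ Bx].
    apply: le_trans h1 _; rewrite ler_pM2l//.
    apply: (@le_trans _ _ (fexp (fun x => m%:R * cmod u x) x)).
      rewrite !fexpE; apply: fine_le => //; rewrite ge0_fin_numE ?cond_exp_ge0//.
      exact: le_lt_trans h3.
    rewrite h4 ler_wpM2l// -lee_fin -fexpK//; exact: B0b.
have cGn : l2dist mu (Gn m) G @[m --> \oo] --> (0 : R).
  by apply: (l2_cvg_indic mD LG); apply: aeW => x; right; exists (kappa x).+1.
have /MEMP[_ [_ cEG] _ _] :=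
  closedT TGn LG (L20 mu) cGn (l2dist_self_cvg mu (cst 0)).
have c0 k x : 0 <= \1_B x * sg k x by exact: mulr_ge0.
have mc k : Ameasurable (fun x => \1_B x * sg k x) by exact: measurable_funM.
apply: aeS3 cEG (Epick mc c0) EsqE => x lty h oo Bx.
have Zx : Esq u x = +oo%E by case: Bx.
move: lty; rewrite (_ : EFin \o cmod (fun x => u x * G x) =
    EFin \o (fun x => (\1_B x * sg (kappa x) x) * cmod u x ^+ 2)); last first.
  by apply/funext => y /=; rewrite cuG.
rewrite h (eq_eseriesr (g := fun k => (sg k x * e k x)%:E)); last first.
  by move=> k _; rewrite indicE mem_set// mul1r.
by rewrite (@abel_dini _ (fun k => e k x) (fun k => e0 k x) (etrans (esym oo) Zx)).
Qed.

End finite_second_moment.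

(** * Density of the domain controls the outer weight *)

Section dense_domain.
Context {d : measure_display} {X : measurableType d} {R : realType}.
Variables (mu : {measure set X -> \bar R}) (A : set (set X)).
Hypothesis hA : sigma_finite_subalgebra mu A.
Local Notation XA := (g_sigma_algebraType A).
Local Notation EC := (cond_expC mu A).
Local Notation Esq f := (cond_exp_sq mu A f%R).
Local Notation "'Acmeasurable' f" := (@cmeasurable _ XA R f) (at level 10).
Local Notation L2 := (L2 mu).
Local Notation dot := (dot mu).
Local Notation MEM := (MEM mu A).
Local Notation sq_conditionable := (sq_conditionable mu A).

Lemma Esq_conj (a : X -> R[i]) : Esq (fun x => (a x)^*) = Esq a.
Proof.
rewrite /cond_exp_sq; congr (cond_exp _ _ _); apply/funext => x.
by rewrite /cmod normc_conjc.
Qed.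

Lemma Esq_eq0_of_ae (a : X -> R[i]) (B : set X) : A B -> cmeasurable a ->
  {ae mu, forall x, B x -> a x = 0} -> {ae mu, forall x, B x -> Esq a x = 0%E}.
Proof.
move=> AB ma a0; have mchi := indic_Acmeasurable hA AB.
have mchiX := subalg_cmeasurable hA mchi.
have mf : measurable_fun setT (fun x => ((cmod (fun y => (\1_B y)%:C : R[i]) x ^+ 2)%:E * Esq a x)%E).
  apply: emeasurable_funM.
    by apply/measurable_EFinP; exact: measurable_cmod_sqr.
  by apply: (subalg_measurable_fun hA); exact: measurable_Esq.
have I : (\int[mu]_x `|(cmod (fun y => (\1_B y)%:C : R[i]) x ^+ 2)%:E * Esq a x| = 0)%E.
  under eq_integral do rewrite gee0_abs ?mule_ge0 ?cmod_sqr_ge0 ?Esq_ge0//.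
  rewrite -(integral_sq_mul hA mchi ma).
  rewrite (@ge0_ae_eq_integral _ _ _ mu setT _ (cst 0%E)) ?integral0//.
  - by apply/measurable_EFinP; apply: measurable_cmod_sqr; exact: cmeasurableM.
  - by move=> x _; exact: cmod_sqr_ge0.
  - apply: aeS a0 => x + _; rewrite /cmod normcM' normc_real indicE.
    case: (boolP (x \in B)) => [/set_mem Bx /(_ Bx) ->|_ _].
      by rewrite Normc.normc0 mulr0 expr0n.
    by rewrite normr0 mul0r expr0n.
move/(ae_eq_integral_abs mu measurableT mf) : I; apply: aeS => x /(_ Logic.I) + Bx.
by rewrite /cmod normc_real indicE mem_set// normr1 expr1n mul1e.
Qed.

(** Square integrability of [w * E (u f)] forces [E (u f) = 0] wherever [E |w|^2] is
    infinite. Hence [conj u], restricted to a subset of that set on which [E |u|^2] is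
    bounded, is orthogonal to the domain and therefore vanishes; so does [E |u|^2]
    there. *)
Lemma dense_MEM_finite (w u : X -> R[i]) : cmeasurable w -> sq_conditionable u ->
  l2dense mu (domain (MEM w u)) ->
  {ae mu, forall x, esupport (Esq u) x -> (Esq w x < +oo)%E}.
Proof.
move=> mw su dT; have mu_ := su.1.
have [B0 [AB0 B0fin B0b B0ex]] := subalg_level_exhaustion hA
  (@measurable_Esq _ _ _ mu A u) su.2.
pose Y := [set x | Esq w x = +oo%E] `&` esupport (Esq u).
suff nY n : {ae mu, forall x, ~ (Y `&` B0 n) x}.
  apply: aeS2 (ae_foralln nY) B0ex => x nZ [N /(_ N (leqnn N)) Bx] Sx.
  by rewrite ltey; apply/eqP => wx; apply: (nZ N).
pose B := Y `&` B0 n.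
have AB : A B.
  apply/(subalg_measurableE hA); apply: measurableI; last exact/(subalg_measurableE hA).
  apply: measurableI; last by apply/(subalg_measurableE hA); exact: measurable_esupport.
  by have := @measurable_Esq _ _ _ mu A w measurableT _ (emeasurable_set1 +oo%E); rewrite setTI.
have mB : measurable B by exact: (subalg_sub hA).
have mB0 : measurable (B0 n) by exact: (subalg_sub hA).
have Bfin : (mu B < +oo)%E.
  by apply: le_lt_trans (B0fin n); apply: le_measure; rewrite ?inE// => x [].
pose chi x : R[i] := (\1_B x)%:C.
have mchi : Acmeasurable chi by exact: (indic_Acmeasurable hA AB).
pose y x : R[i] := chi x * (u x)^*.
have Ly : L2 y.
  apply: (L2_mul_bounded hA (c := n%:R) mchi (cmeasurable_conj mu_) AB Bfin) => //.
  apply: aeW => x; rewrite Esq_conj /cmod normc_real indicE.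
  case: (boolP (x \in B)) => [/set_mem [_ /B0b h]|_].
    by rewrite normr1 expr1n mul1e mulr1.
  by rewrite normr0 expr0n mul0e mulr0.
have y0 : {ae mu, forall x, y x = 0}.
  apply: (dense_orthogonal_eq0 _ dT Ly).
    by move=> f [v /MEMP[]].
  move=> f [v /MEMP[Lf cf Lv ve]].
  have mF : Acmeasurable (EC (fun z => u z * f z)) by exact: measurable_cond_expC.
  have F0 : {ae mu, forall x, B x -> EC (fun z => u z * f z) x = 0}.
    have Lv' : L2 (fun x => EC (fun z => u z * f z) x * w x).
      apply: L2_ae_congr Lv; first exact: cmeasurableM (subalg_cmeasurable hA mF) mw.
      by apply: aeS ve => x ->; rewrite mulrC.
    have mi : measurable_fun setT (fun x => ((cmod (EC (fun z => u z * f z)) x ^+ 2)%:E * Esq w x)%E).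
      apply: emeasurable_funM.
        by apply/measurable_EFinP; apply: measurable_cmod_sqr; exact: (subalg_cmeasurable hA mF).
      by apply: (subalg_measurable_fun hA); exact: measurable_Esq.
    have ii : mu.-integrable setT (fun x => ((cmod (EC (fun z => u z * f z)) x ^+ 2)%:E * Esq w x)%E).
      apply/integrableP; split => //.
      under eq_integral do rewrite gee0_abs ?mule_ge0 ?cmod_sqr_ge0 ?Esq_ge0//.
      by rewrite -(integral_sq_mul hA mF mw); case: Lv'.
    apply: aeS (integrable_ae measurableT ii) => x /(_ Logic.I) fin [[/= wx _] _].
    move: fin; rewrite wx; have := sqr_ge0 (cmod (EC (fun z => u z * f z)) x).
    rewrite le_eqVlt => /orP[|pos].
      by rewrite eq_sym sqrf_eq0 => /eqP /normc_eq0P.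
    by rewrite gt0_muley ?lte_fin.
  have i := cintegrable_mul_conj Ly Lf.
  have e : (fun x => y x * (f x)^*) = (fun x => chi x * (u x * f x)^*).
    by apply/funext => x; rewrite /y conjcM mulrA.
  have cj := conditionable_conj cf.
  rewrite /dot e; rewrite e in i.
  rewrite (cintegral_pull_out hA mchi cj i).
  rewrite (@cintegral_ae_congr _ _ _ mu _ (cst 0)).
  - by apply: eqc_ReIm => /=; rewrite Rintegral_cst// mul0r.
  - exact: (cmeasurableM (subalg_cmeasurable hA mchi)
      (subalg_cmeasurable hA (@measurable_cond_expC _ _ _ mu A _))).
  - exact: cmeasurable_cst.
  - apply: aeS F0 => x; rewrite cond_expC_conj /chi indicE.
    case: (boolP (x \in B)) => [/set_mem Bx /(_ Bx) ->|_ _]; last by rewrite rmorph0 mul0r.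
    by rewrite rmorph0 mulr0.
have u0 : {ae mu, forall x, B x -> u x = 0}.
  apply: aeS y0 => x + Bx; rewrite /y /chi indicE mem_set// mul1r => /(congr1 (fun z => z^*)).
  by rewrite conjCK rmorph0.
apply: aeS (Esq_eq0_of_ae AB mu_ u0) => x h Bx; move: (h Bx) => /eqP.
by case: Bx => [[_ /negP]].
Qed.

End dense_domain.

(** * Bounded, self-adjoint and positive operators *)

Section bounded_weighted_operators.
Context {d : measure_display} {X : measurableType d} {R : realType}.
Variables (mu : {measure set X -> \bar R}) (A : set (set X)).
Hypothesis hA : sigma_finite_subalgebra mu A.
Local Notation XA := (g_sigma_algebraType A).
Local Notation E f := (cond_exp mu A (EFin \o f%R)).
Local Notation dot := (dot mu).
Local Notation MEM := (MEM mu A).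
Local Notation EC := (cond_expC mu A).
Local Notation Esq f := (cond_exp_sq mu A f%R).
Local Notation "'Acmeasurable' f" := (@cmeasurable _ XA R f) (at level 10).
Local Notation "'Ameasurable' f" := (measurable_fun [set: XA] (f : X -> R)) (at level 10).
Local Notation L2 := (L2 mu).
Local Notation sqnorm := (sqnorm mu).
Local Notation sq_conditionable := (sq_conditionable mu A).
Local Notation fexp_sq := (fexp_sq mu A).
Local Notation fexp := (fexp mu A).
Implicit Types (a b f g : X -> R[i]) (t : X -> R).

(** The conditional Cauchy-Schwarz inequality, integrated against [|a|^2]. *)
Lemma MEM_bounded a b f : cmeasurable a -> sq_conditionable b ->
  {ae mu, forall x, (Esq a x * (fexp_sq b x)%:E <= 1)%E} -> L2 f ->
  L2 (fun x => a x * EC (fun y => b y * f y) x) /\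
  sqnorm (fun x => a x * EC (fun y => b y * f y) x) <= 4 * sqnorm f.
Proof.
move=> ma sb ab Lf; have sf := L2_sq_conditionable hA Lf.
have cbf := sq_conditionableM hA sb sf.
pose v := EC (fun y => b y * f y).
have mv : Acmeasurable v by exact: measurable_cond_expC.
have mvX := subalg_cmeasurable hA mv.
have le : (\int[mu]_x ((cmod (fun x => v x * a x)%R x) ^+ 2)%:E <= (4 * sqnorm f)%:E)%E.
  rewrite (integral_sq_mul hA mv ma) EFinM -(sqnormE Lf).
  have m1 := measurable_cmod_sqr sf.1.
  rewrite (cond_exp_integralT hA m1); last by move=> x; exact: sqr_ge0.
  have mEf : measurable_fun setT (fun x => E (fun x => cmod f x ^+ 2) x).
    by apply: (subalg_measurable_fun hA); exact: measurable_cond_exp.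
  have -> : (4%:E * \int[mu]_x E (fun x => cmod f x ^+ 2) x =
      \int[mu]_x (4%:E * E (fun x => cmod f x ^+ 2) x))%E.
    by apply/esym; apply: ge0_integralZl_EFin => // x _; exact: cond_exp_ge0.
  apply: ae_ge0_le_integral => //.
  - by move=> x _; rewrite mule_ge0 ?cmod_sqr_ge0 ?Esq_ge0.
  - apply: emeasurable_funM; first by apply/measurable_EFinP/measurable_cmod_sqr.
    by apply: (subalg_measurable_fun hA); exact: measurable_Esq.
  - by move=> x _; rewrite mule_ge0// cond_exp_ge0.
  - by apply: measurable_funeM.
  - apply: aeS3 (cond_expC_cauchy_schwarz hA sb sf) ab sf.2 => x l l3 fx _.
    rewrite -/(Esq f x) (fexp_sqK fx).
    apply: (@le_trans _ _ ((4 * (fexp_sq b x * fexp_sq f x))%:E * Esq a x)%E).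
      by apply: lee_wpmul2r; rewrite ?Esq_ge0 ?lee_fin.
    have -> : ((4 * (fexp_sq b x * fexp_sq f x))%:E * Esq a x =
       4%:E * (fexp_sq f x)%:E * (Esq a x * (fexp_sq b x)%:E))%E.
      rewrite !EFinM -!muleA; congr (_ * _)%E.
      by rewrite muleCA; congr (_ * _)%E; rewrite muleC.
    rewrite -[leRHS]mule1; apply: lee_wpmul2l => //.
    by rewrite mule_ge0 ?lee_fin ?fexp_sq_ge0.
have e : (fun x => a x * v x) = (fun x => v x * a x) by apply/funext => x; rewrite mulrC.
have Lva : L2 (fun x => v x * a x).
  by split; [exact: cmeasurableM mvX ma|exact: le_lt_trans le (ltry _)].
rewrite -/v e; split; first exact: Lva.
by rewrite -lee_fin -(sqnormE Lva).
Qed.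

Lemma cond_expC_mul_conj a t : sq_conditionable a -> Ameasurable t ->
  {ae mu, forall x, EC (fun y => a y * ((t y)%:C * (a y)^*)) x = (t x * fexp_sq a x)%:C}.
Proof.
move=> sa mt; have mtC := Acmeasurable_real mt.
have ca := sq_conditionableM hA sa (sq_conditionable_conj sa).
have -> : (fun y => a y * ((t y)%:C * (a y)^*)) = (fun y => (t y)%:C * (a y * (a y)^*)).
  by apply/funext => y; ring.
have e : EC (fun y => a y * (a y)^*) = EC (fun y => (cmod a y ^+ 2)%:C).
  by congr cond_expC; apply/funext => y; rewrite mulc_conj.
have r := cond_expC_real hA (measurable_cmod_sqr sa.1) (fun x => sqr_ge0 _).
apply: aeS2 (cond_expCM hA mtC ca) r => x ->; rewrite e => ->.
by rewrite rmorphM.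
Qed.

Section real_weight.
Variables (u : X -> R[i]) (t : X -> R).
Hypotheses (su : sq_conditionable u) (mt : Ameasurable t).

Local Notation a := (fun x => (t x)%:C * (u x)^*).

(** The real factor [t] passes through the conditional expectation to the other side. *)
Lemma MEM_real_selfadjoint : adjoint mu (MEM a u) = MEM a u.
Proof.
have mtC := Acmeasurable_real mt.
have sa : sq_conditionable a.
  exact: (sq_conditionable_mul hA mtC (sq_conditionable_conj su)).
rewrite (MEM_adjoint hA sa su) -(MEM_move_weight hA (fun x => (u x)^*) mtC su).
congr (MEM _ _); apply/funext => x; rewrite conjcM conjCK; congr (_ * _).
by apply: eqc_ReIm; rewrite ?Re_conjc ?Im_conjc//= oppr0.
Qed.

(** The scalar product of [t conj u * v] with [f], where [v = E (u f)], averages to the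
    integral of [t |v|^2]. *)
Lemma MEM_real_positive : (forall x, 0 <= t x) -> positive_operator mu (MEM a u).
Proof.
move=> t0 f g /MEMP[Lf cf Lg ge].
have mtC := Acmeasurable_real mt.
pose v := EC (fun y => u y * f y).
have mv : Acmeasurable v by exact: measurable_cond_expC.
have mtv : Acmeasurable (fun x => (t x)%:C * v x) by exact: (@cmeasurableM _ XA).
have mtvX := subalg_cmeasurable hA mtv.
have ccf := conditionable_conj cf.
have e : {ae mu, forall x, g x * (f x)^* = (t x)%:C * v x * (u x * f x)^*}.
  by apply: aeS ge => x ->; rewrite conjcM -/(v x); ring.
have i0 := cintegrable_mul_conj Lg Lf.
have m1 : cmeasurable (fun x => (t x)%:C * v x * (u x * f x)^*).
  exact: cmeasurableM mtvX ccf.1.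
have i1 : cintegrable mu (fun x => (t x)%:C * v x * (u x * f x)^*).
  case: m1 => z1 z2; case: i0 => i1 i2; split.
    by apply: integrable_ae_eq i1; [exact/measurable_EFinP|apply: aeS e => x ->].
  by apply: integrable_ae_eq i2; [exact/measurable_EFinP|apply: aeS e => x ->].
rewrite /dot (cintegral_ae_congr (cintegrable_cmeasurable i0) m1 e).
rewrite (cintegral_pull_out hA mtv ccf i1).
have -> : (fun x => (t x)%:C * v x * EC (fun y => (u y * f y)^*) x) =
          (fun x => (t x * cmod v x ^+ 2)%:C).
  apply/funext => x; rewrite cond_expC_conj -/(v x) -mulrA mulc_conj.
  by rewrite [RHS]rmorphM.
rewrite /cintegral /= Rintegral_cst// mul0r lecE /= eqxx /=.
by apply: Rintegral_ge0 => x _; rewrite mulr_ge0 ?sqr_ge0.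
Qed.

End real_weight.

End bounded_weighted_operators.

(** * The factors of the polar decomposition *)

Section polar_factors.
Context {d : measure_display} {X : measurableType d} {R : realType}.
Variables (mu : {measure set X -> \bar R}) (A : set (set X)).
Hypothesis hA : sigma_finite_subalgebra mu A.
Local Notation XA := (g_sigma_algebraType A).
Local Notation sqnorm := (sqnorm mu).
Local Notation L2 := (L2 mu).
Local Notation EC := (cond_expC mu A).
Local Notation Esq f := (cond_exp_sq mu A f%R).
Local Notation "'Acmeasurable' f" := (@cmeasurable _ XA R f) (at level 10).
Local Notation "'Ameasurable' f" := (measurable_fun [set: XA] (f : X -> R)) (at level 10).
Local Notation MEM := (MEM mu A).
Local Notation sq_conditionable := (sq_conditionable mu A).
Local Notation fexp_sq := (fexp_sq mu A).

Variables w u : X -> R[i].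

Definition common_support : set X := esupport (Esq u) `&` esupport (Esq w).
Local Notation D := common_support.

(** The other weights are built from [p = E |u|^2] and [q = E |w|^2] and cut to the
    common support, where the reciprocals are harmless: [k] and [r] are the real factors
    of the weights of the modulus and of the partial isometry, [h = (q p)^(1/2)] is the
    multiplier by which the modulus acts on functions [conj u * m] with [m] measurable
    for the subalgebra, and [s] normalises the projection onto the closed span of these
    functions. *)
Definition weight_p x : R := fexp_sq u x.
Definition weight_q x : R := fexp_sq w x.
Definition weight_k x : R := Num.sqrt (weight_q x * (weight_p x)^-1) * \1_D x.
Definition weight_h x : R := weight_k x * weight_p x.
Definition weight_r x : R := (Num.sqrt (weight_q x * weight_p x))^-1 * \1_D x.
Definition weight_s x : R := (weight_p x)^-1 * \1_D x.

Local Notation p := weight_p.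
Local Notation q := weight_q.
Local Notation k := weight_k.
Local Notation h := weight_h.
Local Notation r := weight_r.
Local Notation s := weight_s.
Local Notation chi := (fun x => (\1_D x)%:C : R[i]).

(** Outside the common support [w] may have an infinite second moment, without effect on
    the operator ([cut_wE]); after the cut it is finite and [MEM_adjoint] applies. *)
Definition cut_w x : R[i] := (\1_D x)%:C * w x.

Definition abs_op : graph := MEM (fun x => (k x)%:C * (u x)^*) u.
Definition iso_op : graph := MEM (fun x => (r x)%:C * w x) u.
(** The orthogonal projection onto the complement of the null space. *)
Definition proj_op : graph := MEM (fun x => (s x)%:C * (u x)^*) u.

Lemma common_supportA : A D.
Proof.
apply/(subalg_measurableE hA); apply: measurableI;
  apply/(subalg_measurableE hA); exact: measurable_esupport.
Qed.

Lemma measurable_weight_p : Ameasurable p. Proof. exact: measurable_fexp_sq. Qed.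
Lemma measurable_weight_q : Ameasurable q. Proof. exact: measurable_fexp_sq. Qed.

Let mD : Ameasurable (\1_D : X -> R).
Proof. by apply: (@measurable_indic _ XA); exact/(subalg_measurableE hA)/common_supportA. Qed.

Lemma weight_p_ge0 x : 0 <= p x. Proof. exact: fexp_sq_ge0. Qed.
Lemma weight_q_ge0 x : 0 <= q x. Proof. exact: fexp_sq_ge0. Qed.
Lemma weight_k_ge0 x : 0 <= k x.
Proof. by rewrite mulr_ge0 ?sqrtr_ge0// indicE ler0n. Qed.
Lemma weight_h_ge0 x : 0 <= h x.
Proof. by rewrite mulr_ge0 ?weight_k_ge0 ?weight_p_ge0. Qed.
Lemma measurable_weight_k : Ameasurable k.
Proof.
apply: (@measurable_funM _ XA) mD; apply: (@measurable_sqrtr _ XA _).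
apply: (@measurable_funM _ XA) measurable_weight_q _.
exact: (@measurable_invr_ge0 _ XA _ _ measurable_weight_p weight_p_ge0).
Qed.

Lemma measurable_weight_h : Ameasurable h.
Proof. exact: (@measurable_funM _ XA) measurable_weight_k measurable_weight_p. Qed.

Lemma measurable_weight_r : Ameasurable r.
Proof.
apply: (@measurable_funM _ XA) mD.
apply: (@measurable_invr_ge0 _ XA _); last by move=> x; exact: sqrtr_ge0.
apply: (@measurable_sqrtr _ XA _).
exact: (@measurable_funM _ XA) measurable_weight_q measurable_weight_p.
Qed.

Lemma measurable_weight_s : Ameasurable s.
Proof.
apply: (@measurable_funM _ XA) mD.
exact: (@measurable_invr_ge0 _ XA _ _ measurable_weight_p weight_p_ge0).
Qed.

Hypothesis mw : cmeasurable w.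
Hypothesis su : sq_conditionable u.
Hypothesis wS : {ae mu, forall x, esupport (Esq u) x -> (Esq w x < +oo)%E}.

Let mu_ : cmeasurable u. Proof. by case: su. Qed.
Let wDfin : {ae mu, forall x, D x -> (Esq w x < +oo)%E}.
Proof. by apply: aeS wS => x + [Sx _]; apply. Qed.
Let mchi : Acmeasurable chi. Proof. exact: (indic_Acmeasurable hA common_supportA). Qed.

(** On the common support all the weights are monomials in [a = (E |u|^2)^(1/2)] and [b
    = (E |w|^2)^(1/2)], so that every identity between them is a field identity. *)
Lemma weights_spec : {ae mu, forall x,
  (exists a b : R, [/\ 0 < a, 0 < b, Esq u x = (a ^+ 2)%:E, Esq w x = (b ^+ 2)%:E &
    [/\ D x, \1_D x = 1 :> R, p x = a ^+ 2, q x = b ^+ 2 &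
        [/\ k x = b / a, h x = a * b, r x = (a * b)^-1 & s x = (a ^+ 2)^-1]]]) \/
  [/\ ~ D x, \1_D x = 0 :> R, k x = 0, h x = 0 & [/\ r x = 0 & s x = 0]]}.
Proof.
apply: aeS2 su.2 wDfin => x ux wx; rewrite /h /k /r /s indicE.
case: (boolP (x \in D)) => [/set_mem Dx|/negP nDx]; last first.
  by right; rewrite !mulr0 mul0r; split; [move=> ?; apply: nDx; exact: mem_set| | | |].
left; have {}wx := wx Dx; have [ux0 wx0] := Dx.
have pP : Esq u x = (p x)%:E by exact: fexp_sqK.
have qP : Esq w x = (q x)%:E by exact: fexp_sqK.
have p0 : 0 < p x by move: ux0; rewrite /esupport /= pP eqe lt_neqAle eq_sym weight_p_ge0 => ->.
have q0 : 0 < q x by move: wx0; rewrite /esupport /= qP eqe lt_neqAle eq_sym weight_q_ge0 => ->.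
have [a a0 pa] : exists2 a, 0 < a & p x = a ^+ 2.
  by exists (Num.sqrt (p x)); rewrite ?sqrtr_gt0// sqr_sqrtr// ltW.
have [b b0 qb] : exists2 b, 0 < b & q x = b ^+ 2.
  by exists (Num.sqrt (q x)); rewrite ?sqrtr_gt0// sqr_sqrtr// ltW.
exists a, b; rewrite !mulr1 pP qP pa qb.
have e1 : Num.sqrt (b ^+ 2 / a ^+ 2) = b / a.
  by rewrite -expr_div_n sqrtr_sqr ger0_norm// divr_ge0// ltW.
have e2 : Num.sqrt (b ^+ 2 * a ^+ 2) = a * b.
  by rewrite -exprMn sqrtr_sqr ger0_norm 1?mulrC// mulr_ge0// ltW.
have an : a != 0 by exact: lt0r_neq0.
rewrite e1 e2; split; [exact: a0|exact: b0|by []|by []|].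
by split; [exact: Dx|by []|by []|by []|split => //; field].
Qed.

(** Where [E |u|^2] is positive but [E |w|^2] vanishes the ratio is 0 as well, so the
    support of [E |u|^2] may be replaced by the common support. *)
Lemma modulus_weightE : {ae mu, forall x, modulus_weight mu A w u x = (k x)%:C * (u x)^*}.
Proof.
apply: aeS3 su.2 wS weights_spec => x ux wx sx; rewrite /modulus_weight.
have [Sx|Sx] := boolP (x \in esupport (Esq u)); last first.
  rewrite indicE (negbTE Sx) mulr0 mul0r.
  case: sx => [[a [b [_ _ _ _ [[Sx' _] _ _ _ _]]]]|[_ _ -> _ _]].
    by rewrite mem_set in Sx.
  by rewrite mul0r.
have {}wx := wx (set_mem Sx); rewrite indicE Sx mulr1; congr (_%:C * _).
case: sx => [[a [b [a0 b0 pE qE [_ _ _ _ [-> _ _ _]]]]]|[nD _ -> _ _]].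
  rewrite pE qE inver; have an : a != 0 by exact: lt0r_neq0.
  rewrite (negbTE (_ : a ^+ 2 != 0)) ?expf_neq0//= -expr_div_n sqrtr_sqr.
  by rewrite ger0_norm// divr_ge0// ltW.
have -> : Esq w x = 0%E.
  by apply/eqP/negPn/negP => wn; apply: nD; split => //; exact: set_mem.
by rewrite mul0e sqrtr0.
Qed.

Lemma isometry_weightE :
  {ae mu, forall x, isometry_weight mu A w u x = (r x)%:C * w x}.
Proof.
apply: aeS weights_spec => x sx; rewrite /isometry_weight.
case: sx => [[a [b [a0 b0 pE qE [_ e1 _ _ [_ _ -> _]]]]]|[_ e1 _ _ [-> _]]].
  rewrite -/D e1 mulr1 pE qE -EFinM /= -exprMn sqrtr_sqr.
  rewrite ger0_norm ?mulr_ge0 ?ltW// mulrC; congr (_ * _).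
  by rewrite mulrC fmorphV.
by rewrite -/D e1 mulr0 mul0r.
Qed.

Lemma cmeasurable_isometry_weight : cmeasurable (isometry_weight mu A w u).
Proof.
have mEw := subalg_measurable_fun hA (@measurable_Esq _ _ _ mu A w).
have mEu := subalg_measurable_fun hA (@measurable_Esq _ _ _ mu A u).
apply: cmeasurableM; last exact: (subalg_cmeasurable hA mchi).
apply: (cmeasurableM mw); under eq_fun do rewrite -fmorphV; apply: cmeasurable_real.
apply: measurable_invr_ge0; last by move=> x; exact: sqrtr_ge0.
apply: measurable_sqrtr; apply: measurableT_comp => //.
exact: emeasurable_funM.
Qed.

(** [E (u f)] vanishes outside the support of [E |u|^2], and [w] outside that of [E
    |w|^2]. *)
Lemma mul_cut_w f : conditionable mu A (fun x => u x * f x) -> cmeasurable f ->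
  {ae mu, forall x, w x * EC (fun y => u y * f y) x = cut_w x * EC (fun y => u y * f y) x}.
Proof.
move=> cf mf.
apply: aeS2 (cond_expC_esupport hA mu_ cf mf) (ae_esupport hA mw) => x e1 e2.
rewrite e1 {1}e2 /cut_w.
have -> : (\1_D x)%:C = (\1_(esupport (Esq u)) x)%:C * (\1_(esupport (Esq w)) x)%:C :> R[i].
  by rewrite -rmorphM /common_support indicI.
set i := (\1_(esupport (Esq u)) x)%:C; set v := EC _ x; set j := (\1_ _ x)%:C.
have ii : i * i = i.
  by rewrite /i indicE; case: (_ \in _); rewrite ?mulr1 ?mulr0.
transitivity (i * j * w x * v); first by ring.
by rewrite -{1}ii; ring.
Qed.

Section components.
Variable f : X -> R[i].
Hypothesis Lf : L2 f.
Local Notation v := (EC (fun y => u y * f y)).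

Let cf : conditionable mu A (fun x => u x * f x).
Proof. exact: (sq_conditionableM hA su (L2_sq_conditionable hA Lf)). Qed.

Let mv : Acmeasurable v. Proof. exact: measurable_cond_expC. Qed.

Lemma abs_opP g : abs_op (f, g) <-> L2 g /\ {ae mu, forall x, g x = (k x)%:C * (u x)^* * v x}.
Proof.
by split=> [/MEMP[]//|[Lg e]]; apply/MEMP; split; [exact: Lf|exact: cf|exact: Lg|exact: e].
Qed.

Lemma iso_opP g : iso_op (f, g) <-> L2 g /\ {ae mu, forall x, g x = (r x)%:C * w x * v x}.
Proof.
by split=> [/MEMP[]//|[Lg e]]; apply/MEMP; split; [exact: Lf|exact: cf|exact: Lg|exact: e].
Qed.

Lemma proj_opP g : proj_op (f, g) <-> L2 g /\ {ae mu, forall x, g x = (s x)%:C * (u x)^* * v x}.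
Proof.
by split=> [/MEMP[]//|[Lg e]]; apply/MEMP; split; [exact: Lf|exact: cf|exact: Lg|exact: e].
Qed.

Lemma cut_opP g : MEM w u (f, g) <-> L2 g /\ {ae mu, forall x, g x = cut_w x * v x}.
Proof.
have e' := mul_cut_w cf (L2_cmeasurable Lf).
split=> [/MEMP[_ _ Lg e]|[Lg e]].
  by split; [exact: Lg|apply: aeS2 e e' => x -> ->].
by apply/MEMP; split; [exact: Lf|exact: cf|exact: Lg|apply: aeS2 e e' => x -> ->].
Qed.

End components.

Lemma cut_wE : MEM w u = MEM cut_w u.
Proof.
apply/seteqP; split => -[f g] fg; have /MEMP[Lf cf Lg e] := fg; last exact/(cut_opP Lf).
have [_ e'] := (cut_opP Lf g).1 fg.
by apply/MEMP; split; [exact: Lf|exact: cf|exact: Lg|exact: e'].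
Qed.

Lemma Esq_cut_w : {ae mu, forall x, Esq cut_w x = (\1_D x * q x)%:E}.
Proof.
apply: aeS2 (Esq_mul hA mchi mw) weights_spec => x -> sx.
rewrite /cmod normc_real.
case: sx => [[a [b [_ _ _ -> [_ -> _ -> _]]]]|[_ -> _ _ _]].
  by rewrite normr1 expr1n mul1e mul1r.
by rewrite normr0 expr0n mul0e mul0r.
Qed.

Lemma sq_cut_w : sq_conditionable cut_w.
Proof.
split; last by apply: aeS Esq_cut_w => x ->; rewrite ltry.
exact: cmeasurableM (subalg_cmeasurable hA mchi) mw.
Qed.

Lemma Esq_real_conj (t : X -> R) : Ameasurable t ->
  {ae mu, forall x, Esq (fun x => (t x)%:C * (u x)^*) x = (t x ^+ 2 * p x)%:E}.
Proof.
move=> mt; have mtC := Acmeasurable_real mt.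
apply: aeS2 (Esq_mul hA mtC (cmeasurable_conj mu_)) su.2 => x -> ux.
by rewrite Esq_conj (fexp_sqK ux) /cmod normc_real real_normK ?num_real.
Qed.

Lemma Esq_real_w (t : X -> R) : Ameasurable t ->
  {ae mu, forall x, Esq (fun x => (t x)%:C * w x) x = ((t x ^+ 2)%:E * Esq w x)%E}.
Proof.
move=> mt; have mtC := Acmeasurable_real mt.
apply: aeS (Esq_mul hA mtC mw) => x ->.
by rewrite /cmod normc_real real_normK ?num_real.
Qed.

Lemma cond_expC_lift (t : X -> R) m : Ameasurable t -> Acmeasurable m ->
  {ae mu, forall x, EC (fun y => u y * ((t y)%:C * (u y)^* * m y)) x = (t x * p x)%:C * m x}.
Proof.
move=> mt mm; have mtC := Acmeasurable_real mt.
have sa := sq_conditionable_mul hA mtC (sq_conditionable_conj su).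
have -> : (fun y => u y * ((t y)%:C * (u y)^* * m y)) =
          (fun y => m y * (u y * ((t y)%:C * (u y)^*))) by apply/funext => y; ring.
apply: aeS2 (cond_expCM hA mm (sq_conditionableM hA su sa)) (cond_expC_mul_conj hA su mt).
by move=> x -> ->; rewrite mulrC.
Qed.

Lemma cond_expC_cut_w : {ae mu, forall x, EC (fun y => (cut_w y)^* * cut_w y) x = (\1_D x * q x)%:C}.
Proof.
have -> : (fun y => (cut_w y)^* * cut_w y) = (fun y => (cmod cut_w y ^+ 2)%:C).
  by apply/funext => y; rewrite mulrC mulc_conj.
apply: aeS2 (cond_expC_real hA (measurable_cmod_sqr sq_cut_w.1) (fun x => sqr_ge0 _)) Esq_cut_w.
by move=> x -> e; rewrite fexpE -/(Esq cut_w x) e.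
Qed.

(** Both weights have the same conditional second moment, [q] on the common support. *)
Lemma abs_L2 f : L2 f ->
  let v := EC (fun y => u y * f y) in
  (L2 (fun x => cut_w x * v x) <-> L2 (fun x => (k x)%:C * (u x)^* * v x)) /\
  sqnorm (fun x => cut_w x * v x) = sqnorm (fun x => (k x)%:C * (u x)^* * v x).
Proof.
move=> Lf v; have mv : Acmeasurable v by exact: measurable_cond_expC.
have e : {ae mu, forall x, ((cmod v x ^+ 2)%:E * Esq cut_w x =
    (cmod v x ^+ 2)%:E * Esq (fun x => (k x)%:C * (u x)^*) x)%E}.
  apply: aeS3 Esq_cut_w (Esq_real_conj measurable_weight_k) weights_spec => x -> -> sx.
  congr (_ * _%:E)%E.
  case: sx => [[a [b [a0 b0 _ _ [_ -> -> -> [-> _ _ _]]]]]|[_ -> -> _ _]].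
    by field; exact: lt0r_neq0.
  by rewrite mul0r expr0n mul0r.
have mk : cmeasurable (fun x => (k x)%:C * (u x)^*).
  apply: cmeasurableM (cmeasurable_conj mu_); apply: (subalg_cmeasurable hA).
  exact: Acmeasurable_real measurable_weight_k.
have := L2_mul_Esq_eq hA mv sq_cut_w.1 mk e.
have -> : (fun x => v x * cut_w x) = (fun x => cut_w x * v x) by apply/funext => x; rewrite mulrC.
have -> // : (fun x => v x * ((k x)%:C * (u x)^*)) = (fun x => (k x)%:C * (u x)^* * v x).
by apply/funext => x; rewrite mulrC.
Qed.

(** Both weights have the same conditional second moment, [1 / p] on the common support. *)
Lemma iso_sqnorm f : L2 f ->
  let v := EC (fun y => u y * f y) in
  sqnorm (fun x => (r x)%:C * w x * v x) = sqnorm (fun x => (s x)%:C * (u x)^* * v x).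
Proof.
move=> Lf v; have mv : Acmeasurable v by exact: measurable_cond_expC.
have e : {ae mu, forall x, ((cmod v x ^+ 2)%:E * Esq (fun x => (r x)%:C * w x) x =
    (cmod v x ^+ 2)%:E * Esq (fun x => (s x)%:C * (u x)^*) x)%E}.
  apply: aeS3 (Esq_real_w measurable_weight_r) (Esq_real_conj measurable_weight_s) weights_spec.
  move=> x -> -> sx; congr (_ * _)%E.
  case: sx => [[a [b [a0 b0 _ -> [_ _ -> _ [_ _ -> ->]]]]]|[_ _ _ _ [-> ->]]].
    by rewrite -EFinM; congr _%:E; field; rewrite !lt0r_neq0.
  by rewrite expr0n mul0e mul0r.
have ms : cmeasurable (fun x => (s x)%:C * (u x)^*).
  apply: cmeasurableM (cmeasurable_conj mu_); apply: (subalg_cmeasurable hA).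
  exact: Acmeasurable_real measurable_weight_s.
have mr : cmeasurable (fun x => (r x)%:C * w x).
  apply: cmeasurableM mw; apply: (subalg_cmeasurable hA).
  exact: Acmeasurable_real measurable_weight_r.
have [_] := L2_mul_Esq_eq hA mv mr ms e.
have -> : (fun x => v x * ((r x)%:C * w x)) = (fun x => (r x)%:C * w x * v x).
  by apply/funext => x; rewrite mulrC.
have -> // : (fun x => v x * ((s x)%:C * (u x)^*)) = (fun x => (s x)%:C * (u x)^* * v x).
by apply/funext => x; rewrite mulrC.
Qed.

Lemma proj_bounded f : L2 f ->
  let v := EC (fun y => u y * f y) in
  L2 (fun x => (s x)%:C * (u x)^* * v x) /\
  sqnorm (fun x => (s x)%:C * (u x)^* * v x) <= 4 * sqnorm f.
Proof.
move=> Lf v; apply: (MEM_bounded hA _ su _ Lf).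
  apply: cmeasurableM (cmeasurable_conj mu_); apply: (subalg_cmeasurable hA).
  exact: Acmeasurable_real measurable_weight_s.
apply: aeS2 (Esq_real_conj measurable_weight_s) weights_spec => x -> sx.
rewrite -/(p x) -EFinM lee_fin.
case: sx => [[a [b [a0 b0 _ _ [_ _ -> _ [_ _ _ ->]]]]]|[_ _ _ _ [_ ->]]].
  rewrite [leLHS](_ : _ = 1)//; field; exact: lt0r_neq0.
by rewrite expr0n !mul0r.
Qed.

Lemma iso_bounded f : L2 f ->
  let v := EC (fun y => u y * f y) in
  L2 (fun x => (r x)%:C * w x * v x) /\
  sqnorm (fun x => (r x)%:C * w x * v x) <= 4 * sqnorm f.
Proof.
move=> Lf v; apply: (MEM_bounded hA _ su _ Lf).
  apply: cmeasurableM mw; apply: (subalg_cmeasurable hA).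
  exact: Acmeasurable_real measurable_weight_r.
apply: aeS2 (Esq_real_w measurable_weight_r) weights_spec => x -> sx.
rewrite -/(p x).
case: sx => [[a [b [a0 b0 _ -> [_ _ -> _ [_ _ -> _]]]]]|[_ _ _ _ [-> _]]].
  rewrite -!EFinM lee_fin [leLHS](_ : _ = 1)//; field; by rewrite !lt0r_neq0.
by rewrite expr0n !mul0e.
Qed.

(** This is the action of the adjoint of [iso_op], needed to see that the range of
    [iso_op] is closed. *)
Lemma coiso_bounded g : L2 g ->
  let z := EC (fun y => (r y)%:C * (cut_w y)^* * g y) in
  L2 (fun x => (u x)^* * z x) /\ sqnorm (fun x => (u x)^* * z x) <= 4 * sqnorm g.
Proof.
move=> Lg z; have mr := Acmeasurable_real measurable_weight_r.
have sb := sq_conditionable_mul hA mr (sq_conditionable_conj sq_cut_w).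
apply: (MEM_bounded hA (cmeasurable_conj mu_) sb _ Lg).
have := Esq_mul hA mr (cmeasurable_conj sq_cut_w.1); rewrite Esq_conj => e.
apply: aeS4 e Esq_cut_w weights_spec su.2 => x ex e2 sx ux.
rewrite /fexp_sq fexpE -/(Esq _ x) ex Esq_conj e2 (fexp_sqK ux) -/(p x).
rewrite /cmod normc_real real_normK ?num_real//= -EFinM lee_fin.
case: sx => [[a [b [a0 b0 _ _ [_ -> -> -> [_ _ -> _]]]]]|[_ _ _ _ [-> _]]].
  by rewrite [leLHS](_ : _ = 1)//; field; rewrite !lt0r_neq0.
by rewrite expr0n mul0r mulr0.
Qed.

Let sk : sq_conditionable (fun x => (k x)%:C * (u x)^*).
Proof.
exact: (sq_conditionable_mul hA (Acmeasurable_real measurable_weight_k) (sq_conditionable_conj su)).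
Qed.

Lemma abs_op_domain f : domain abs_op f <-> domain (MEM w u) f.
Proof.
split=> -[g fg].
  have /MEMP[Lf cf Lg e] := fg; exists (fun x => cut_w x * EC (fun y => u y * f y) x).
  apply/(cut_opP Lf); split; last exact: aeW.
  by apply: (abs_L2 Lf).1.2; apply: L2_ae_congr e Lg; apply: cmeasurableM sk.1 _;
    apply: (subalg_cmeasurable hA); exact: measurable_cond_expC.
have /MEMP[Lf cf _ _] := fg; have [Lg e] := (cut_opP Lf g).1 fg.
exists (fun x => (k x)%:C * (u x)^* * EC (fun y => u y * f y) x).
apply/(abs_opP Lf); split; last exact: aeW.
by apply: (abs_L2 Lf).1.1; apply: L2_ae_congr e Lg; apply: cmeasurableM sq_cut_w.1 _;
    apply: (subalg_cmeasurable hA); exact: measurable_cond_expC.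
Qed.

Lemma abs_op_linear : linear_operator mu abs_op.
Proof. exact: (MEM_linear hA sk.1 mu_). Qed.

Let abs_comp_weight : {ae mu, forall x, forall z : R[i],
  (k x)%:C * (u x)^* * (EC (fun y => u y * ((k y)%:C * (u y)^*)) x * z) =
  (u x)^* * (EC (fun y => (cut_w y)^* * cut_w y) x * z)}.
Proof.
apply: aeS3 cond_expC_cut_w (cond_expC_mul_conj hA su measurable_weight_k) weights_spec.
move=> x -> -> sx z; rewrite -/(p x).
have -> : \1_D x * q x = k x * (k x * p x).
  case: sx => [[a [b [a0 b0 _ _ [_ -> -> -> [-> _ _ _]]]]]|[_ -> -> _ _]].
    by field; exact: lt0r_neq0.
  by rewrite !mul0r.
by rewrite [(k x * (k x * p x))%:C]rmorphM; ring.
Qed.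

(** Both sides send [f] to [conj u * q * E (u f)] on the common support, and their
    domains agree by [abs_L2]. *)
Lemma abs_op_comp : op_comp abs_op abs_op = op_comp (adjoint mu (MEM w u)) (MEM w u).
Proof.
have ck := sq_conditionable_conj sq_cut_w; have mc := cmeasurable_conj mu_.
rewrite cut_wE (MEM_adjoint hA sq_cut_w su); apply/seteqP; split => -[f g].
  move=> /(MEM_compP hA u f g sk.1 su sk)[Lf cf Lkv Lg e].
  apply/(MEM_compP hA u f g mc ck sq_cut_w).
  split; [exact: Lf|exact: cf|exact/(abs_L2 Lf).1|exact: Lg|].
  by apply: aeS2 e abs_comp_weight => x -> ->.
move=> /(MEM_compP hA u f g mc ck sq_cut_w)[Lf cf Lkv Lg e].
apply/(MEM_compP hA u f g sk.1 su sk).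
split; [exact: Lf|exact: cf|exact/(abs_L2 Lf).1|exact: Lg|].
by apply: aeS2 e abs_comp_weight => x -> ->.
Qed.

Lemma abs_op_selfadjoint : adjoint mu abs_op = abs_op.
Proof. exact: (MEM_real_selfadjoint hA su measurable_weight_k). Qed.

Lemma abs_op_is_modulus : l2dense mu (domain (MEM w u)) -> is_modulus mu (MEM w u) abs_op.
Proof.
move=> dT; split.
- exact: abs_op_linear.
- split; last exact: abs_op_selfadjoint.
  by rewrite (_ : domain abs_op = domain (MEM w u))//; apply/seteqP; split=> f /abs_op_domain.
- exact (MEM_real_positive hA measurable_weight_k weight_k_ge0).
- exact: abs_op_comp.
Qed.

(** The multiplier produced by the composition is [r * k * p], the indicator of the
    common support. *)
Lemma MEM_eq_iso_abs : MEM w u = op_comp iso_op abs_op.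
Proof.
have mr : cmeasurable (fun x => (r x)%:C * w x).
  apply: cmeasurableM mw; apply: (subalg_cmeasurable hA).
  exact: Acmeasurable_real measurable_weight_r.
have e0 : {ae mu, forall x, forall z : R[i],
    (r x)%:C * w x * (EC (fun y => u y * ((k y)%:C * (u y)^*)) x * z) = cut_w x * z}.
  apply: aeS2 (cond_expC_mul_conj hA su measurable_weight_k) weights_spec.
  move=> x -> sx z; rewrite -/(p x) /cut_w.
  have -> : \1_D x = r x * (k x * p x).
    case: sx => [[a [b [a0 b0 _ _ [_ -> -> _ [-> _ -> _]]]]]|[_ -> _ _ [-> _]]].
      by field; rewrite !lt0r_neq0.
    by rewrite !mul0r.
  by rewrite [(r x * (k x * p x))%:C]rmorphM; ring.
apply/seteqP; split => -[f g].
  move=> fg; have /MEMP[Lf cf Lg _] := fg; have [_ e] := (cut_opP Lf g).1 fg.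
  apply/(MEM_compP hA u f g mr su sk); split; [exact: Lf|exact: cf| |exact: Lg|].
    apply/(abs_L2 Lf).1; apply: L2_ae_congr e Lg; apply: (cmeasurableM sq_cut_w.1).
    by apply: (subalg_cmeasurable hA); exact: measurable_cond_expC.
  by apply: aeS2 e e0 => x -> ->.
move=> /(MEM_compP hA u f g mr su sk)[Lf cf Lkv Lg e].
by apply/(cut_opP Lf); split; [exact: Lg|apply: aeS2 e e0 => x -> ->].
Qed.

Lemma proj_residue f : L2 f ->
  let v := EC (fun y => u y * f y) in
  {ae mu, forall x, EC (fun y => u y * (f y - (s y)%:C * (u y)^* * v y)) x =
    (1 - \1_D x)%:C * v x}.
Proof.
move=> Lf v; have mv : Acmeasurable v by exact: measurable_cond_expC.
have [LP _] := proj_bounded Lf; have Ly := L2B Lf LP.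
have c1 := sq_conditionableM hA su (L2_sq_conditionable hA Ly).
have c2 := sq_conditionableM hA su (L2_sq_conditionable hA LP).
have := cond_expCD hA c1 c2.
have -> : (fun x => u x * (f x - (s x)%:C * (u x)^* * v x) + u x * ((s x)%:C * (u x)^* * v x)) =
    (fun x => u x * f x) by apply/funext => x; ring.
move=> e; apply: aeS3 e (cond_expC_lift measurable_weight_s mv) weights_spec => x e1 e2 sx.
have -> : \1_D x = s x * p x.
  case: sx => [[a [b [a0 b0 _ _ [_ -> -> _ [_ _ _ ->]]]]]|[_ -> _ _ [_ ->]]].
    by field; exact: lt0r_neq0.
  by rewrite mul0r.
move: e1; rewrite -/v e2 rmorphB mulrBl rmorph1 mul1r => {1}->.
by rewrite addrK.
Qed.

(** Spectral truncations: on these sets multiplication by [h] is bounded with bounded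
    inverse. *)
Definition level n : set X := [set x | n.+1%:R^-1 <= h x <= n.+1%:R].

Lemma levelA n : A (level n).
Proof.
have mh : measurable_fun [set: XA] (fun x => (h x)%:E).
  by apply/measurable_EFinP; exact: measurable_weight_h.
have m1 := emeasurable_fun_c_infty measurableT mh (n.+1%:R^-1)%:E.
have m2 := emeasurable_fun_infty_c measurableT mh n.+1%:R%:E.
apply/(subalg_measurableE hA); have := measurableI _ _ m1 m2.
congr measurable; apply/seteqP; split => x; rewrite /level /= ?lee_fin.
  by move=> [[_ ->] [_ ->]].
by move=> /andP[-> ->].
Qed.

Lemma level_exhaust : {ae mu, forall x, D x -> exists N, forall n, (N <= n)%N -> level n x}.
Proof.
apply: aeS weights_spec => x [[a [b [a0 b0 _ _ [_ _ _ _ [_ hE _ _]]]]] _|[nD _ _ _ _]//].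
have h0 : 0 < h x by rewrite hE mulr_gt0.
exists (maxn (Num.truncn (h x)) (Num.truncn (h x)^-1)) => n; rewrite geq_max => /andP[n1 n2].
apply/andP; split; last first.
  by apply: ltW; apply: lt_le_trans (truncnS_gt _) _; rewrite ler_nat ltnS.
rewrite -[leRHS]invrK lef_pV2 ?posrE ?invr_gt0//.
by apply: ltW; apply: lt_le_trans (truncnS_gt _) _; rewrite ler_nat ltnS.
Qed.

End polar_factors.

(** * Uniqueness of the positive square root *)

Section square_root_uniqueness.
Context {d : measure_display} {X : measurableType d} {R : realType}.
Variables (mu : {measure set X -> \bar R}) (A : set (set X)).
Hypothesis hA : sigma_finite_subalgebra mu A.
Local Notation XA := (g_sigma_algebraType A).
Local Notation Re := complex.Re.
Local Notation EC := (cond_expC mu A).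
Local Notation Esq f := (cond_exp_sq mu A f%R).
Local Notation "'Acmeasurable' f" := (@cmeasurable _ XA R f) (at level 10).
Local Notation "'Ameasurable' f" := (measurable_fun [set: XA] (f : X -> R)) (at level 10).
Local Notation L2 := (L2 mu).
Local Notation dot := (dot mu).
Local Notation sqnorm := (sqnorm mu).
Local Notation sq_conditionable := (sq_conditionable mu A).

Lemma selfadjoint_closed (B : graph (X := X) (R := R)) : adjoint mu B = B -> closed_operator mu B.
Proof.
move=> aB fs gs f g Bn Lf Lg cf cg; rewrite -aB; split; [exact: Lf|exact: Lg|].
have Ln n : L2 (fs n) /\ L2 (gs n) by have := Bn n; rewrite -{1}aB => -[].
move=> a b ab; have [La Lb] : L2 a /\ L2 b by have := ab; rewrite -{1}aB => -[].
apply: (dot_limit (fun n => (Ln n).1) (fun n => (Ln n).2) Lf Lg Lb La cf cg) => n.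
by have := Bn n; rewrite -{1}aB => -[_ _]; exact.
Qed.

(** Passing to adjoints reverses the inclusion. *)
Lemma selfadjoint_sub_eq (B C : graph (X := X) (R := R)) :
  adjoint mu B = B -> adjoint mu C = C -> C `<=` B -> C = B.
Proof.
move=> aB aC CB; apply/seteqP; split=> // -[f g]; rewrite -aB -aC => -[Lf Lg H].
by split=> // a b /CB; exact: H.
Qed.

Variables w u : X -> R[i].
Hypothesis mw : cmeasurable w.
Hypothesis su : sq_conditionable u.
Hypothesis wS : {ae mu, forall x, esupport (Esq u) x -> (Esq w x < +oo)%E}.

Let mu_ : cmeasurable u. Proof. by case: su. Qed.

Local Notation k := (weight_k mu A w u).
Local Notation h := (weight_h mu A w u).
Local Notation s := (weight_s mu A w u).
Local Notation C := (abs_op mu A w u).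

Let mh : Ameasurable h. Proof. exact: measurable_weight_h. Qed.
Let hC : Acmeasurable (fun x => (h x)%:C). Proof. exact: Acmeasurable_real mh. Qed.

(** Functions [conj u * m] with [m] measurable for the subalgebra, carried by a band [a
    <= h <= b]. As [abs_op] multiplies such functions by [h] ([abs_op_slab]), they play
    the role of a spectral subspace. *)
Definition slab (a b : R) (m : X -> R[i]) : Prop :=
  [/\ Acmeasurable m, L2 (fun x => (u x)^* * m x) &
      forall x, m x = 0 \/ a <= h x <= b].

Local Notation lift m := (fun x => (u x)^* * m x).

Lemma slab_mul_h a b m : 0 <= a -> slab a b m -> slab a b (fun x => (h x)%:C * m x).
Proof.
move=> a0 [mm Lm hm]; split.
- exact: (@cmeasurableM _ XA).
- have mhm := cmeasurableM (subalg_cmeasurable hA hC) (subalg_cmeasurable hA mm).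
  apply: (@L2_le _ _ _ _ (b ^+ 2) _ (lift m) _ Lm).
    exact: cmeasurableM (cmeasurable_conj mu_) mhm.
  apply: aeW => x; rewrite /cmod !normcM' normc_conjc normc_real.
  case: (hm x) => [->|/andP[ah hb]]; first by rewrite Normc.normc0 !mulr0 expr0n mulr0.
  rewrite mulrCA exprMn ler_wpM2r ?sqr_ge0// ger0_norm ?weight_h_ge0//.
  by rewrite ler_sqr ?nnegrE// ?weight_h_ge0// (le_trans _ hb) ?weight_h_ge0.
- by move=> x; case: (hm x) => [->|]; [left; rewrite mulr0|right].
Qed.

Lemma abs_op_slab a b m : 0 <= a -> slab a b m ->
  C (lift m, lift (fun x => (h x)%:C * m x)).
Proof.
move=> a0 sm; have [_ Lhm _] := slab_mul_h a0 sm; have [mm Lm hm] := sm.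
apply/(abs_opP hA w su Lm); split; first exact: Lhm.
have m1 : Ameasurable (cst 1 : X -> R) by exact: measurable_cst.
have := cond_expC_lift hA su m1 mm.
have -> : (fun y => u y * ((cst 1 y)%:C * (u y)^* * m y)) = (fun y => u y * (lift m y)).
  by apply/funext => y; rewrite mul1r.
apply: aeS => x ->; rewrite /weight_h mul1r [in LHS]rmorphM; ring.
Qed.

Variable B : graph (X := X) (R := R).
Hypotheses (lB : linear_operator mu B) (aB : adjoint mu B = B).
Hypothesis pB : positive_operator mu B.
Hypothesis BC : op_comp B B = op_comp C C.

Let B_L2 f g : B (f, g) -> L2 f /\ L2 g. Proof. by case: lB => + _ _ _ _; exact. Qed.
Let B_fun f g g' : B (f, g) -> B (f, g') -> {ae mu, forall x, g x = g' x}.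
Proof. by case: lB => _ _ H _ _ h1 h2; apply/aeTP; exact: H h1 h2. Qed.

Lemma slab_sqrt a b m : 0 <= a -> slab a b m -> exists2 v, B (lift m, v) &
  B (v, lift (fun x => (h x)%:C * ((h x)%:C * m x))).
Proof.
move=> a0 sm; have sm2 := slab_mul_h a0 sm.
have : op_comp C C (lift m, lift (fun x => (h x)%:C * ((h x)%:C * m x))).
  by exists (lift (fun x => (h x)%:C * m x)); [exact: abs_op_slab sm|exact: abs_op_slab sm2].
by rewrite -BC => -[v Bv vB]; exists v.
Qed.

(** [B + a] is bounded below by [a], so [v - a f], which it sends to [(h^2 - a^2) f], is
    small when the band is narrow. *)
Lemma slab_estimate a b m v : 0 < a -> slab a b m -> B (lift m, v) ->
  sqnorm (fun x => v x - lift (fun y => (h y)%:C * m y) x) <=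
  (2 * ((b ^+ 2 - a ^+ 2) / a) ^+ 2 + 2 * (b - a) ^+ 2) * sqnorm (lift m).
Proof.
move=> a0 sm Bv; have a0' := ltW a0; have [mm Lm hm] := sm.
have sm1 := slab_mul_h a0' sm; have [mm1 Lm1 _] := sm1.
have [_ Lm2 _] := slab_mul_h a0' sm1.
have [v' Bv' Bvh'] := slab_sqrt a0' sm.
have Bvh : B (v, lift (fun x => (h x)%:C * ((h x)%:C * m x))).
  have [_ cong _ _ _] := lB; have [_ Lv] := B_L2 Bv; have [_ Lh] := B_L2 Bvh'.
  by apply: (cong _ _ _ _ Bvh' Lv Lh); apply/aeTP; [exact: B_fun Bv' Bv|exact: aeW].
have [_ Lv] := B_L2 Bv.
have [_ _ _ _ lin] := lB.
have Be := lin (- a)%:C _ _ _ _ Bv Bvh.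
set e := fun x => _ in Be; set z := (X in B (_, X)) in Be.
have [Le Lz] := B_L2 Be.
have pos : 0 <= Re (dot z e) by have := pB Be; rewrite lecE => /andP[_].
have low : a ^+ 2 * sqnorm e <= sqnorm (fun x => z x + a%:C * e x).
  rewrite (sqnormD Lz (L2Z _ Le)) (dotZr _ Lz Le) (sqnormZ _ Le) normc_real.
  have -> : (a%:C : R[i])^* = a%:C by apply: eqc_ReIm; rewrite ?Re_conjc ?Im_conjc//= oppr0.
  move: (dot z e) pos => c pos.
  rewrite Re_mulc /= mul0r subr0 real_normK ?num_real//.
  have := sqnorm_ge0 mu z; have := mulr_ge0 a0' pos; lra.
have up : sqnorm (fun x => z x + a%:C * e x) <= (b ^+ 2 - a ^+ 2) ^+ 2 * sqnorm (lift m).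
  apply: (le_sqnorm (L2D Lz (L2Z _ Le)) Lm).
  apply: aeW => x; rewrite /cmod.
  have -> : z x + a%:C * e x = (h x ^+ 2 - a ^+ 2)%:C * lift m x.
    by rewrite /z /e rmorphB !rmorphXn rmorphN /=; ring.
  rewrite normcM' exprMn normc_real real_normK ?num_real//.
  case: (hm x) => [->|/andP[ah hb]]; first by rewrite mulr0 Normc.normc0 expr0n !mulr0.
  rewrite ler_wpM2r ?sqr_ge0//.
  have h1 : a ^+ 2 <= h x ^+ 2 by rewrite ler_sqr ?nnegrE// (le_trans a0').
  have h2 : h x ^+ 2 <= b ^+ 2.
    by rewrite ler_sqr ?nnegrE// ?weight_h_ge0// (le_trans _ hb) ?weight_h_ge0.
  rewrite ler_sqr ?nnegrE; lra.
have dif : sqnorm (fun x => a%:C * lift m x - lift (fun y => (h y)%:C * m y) x) <=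
    (b - a) ^+ 2 * sqnorm (lift m).
  apply: (le_sqnorm (L2B (L2Z _ Lm) Lm1) Lm).
  apply: aeW => x; rewrite /cmod.
  have -> : a%:C * lift m x - lift (fun y => (h y)%:C * m y) x = (a - h x)%:C * lift m x.
    by rewrite rmorphB /=; ring.
  rewrite normcM' exprMn normc_real real_normK ?num_real//.
  case: (hm x) => [->|/andP[ah hb]]; first by rewrite mulr0 Normc.normc0 expr0n !mulr0.
  rewrite ler_wpM2r ?sqr_ge0// -sqrrN ler_sqr ?nnegrE; lra.
have -> : (fun x => v x - lift (fun y => (h y)%:C * m y) x) =
    (fun x => e x + (a%:C * lift m x - lift (fun y => (h y)%:C * m y) x)).
  by apply/funext => x; rewrite /e rmorphN; ring.
apply: le_trans (sqnormD_le Le (L2B (L2Z _ Lm) Lm1)) _.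
rewrite [leRHS]mulrDl; apply: lerD; rewrite -mulrA ler_pM2l//.
rewrite expr_div_n mulrAC ler_pdivlMr ?exprn_gt0//.
by rewrite mulrC; exact: le_trans low up.
Qed.

(** Cutting the band in two halves the estimate, since the error is quadratic in the
    width while the two pieces are orthogonal. *)
Lemma slab_bisect al be n : 0 < al -> forall a b m v, al <= a -> a <= b -> b <= be ->
  slab a b m -> B (lift m, v) ->
  sqnorm (fun x => v x - lift (fun y => (h y)%:C * m y) x) <=
  (8 * (be / al) ^+ 2 + 2) * (b - a) ^+ 2 / 2 ^+ n * sqnorm (lift m).
Proof.
move=> al0; elim: n => [|n IH] a b m v ala ab bbe sm Bv.
  have a0 : 0 < a by exact: lt_le_trans ala.
  apply: le_trans (slab_estimate a0 sm Bv) _; rewrite expr0 divr1.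
  (* the constant: [(b + a) / a <= 2 be / al] on every band inside [[al, be]] *)
  rewrite ler_wpM2r ?sqnorm_ge0// [leRHS]mulrDl lerD2r.
  have -> : (b ^+ 2 - a ^+ 2) / a = (b - a) * ((b + a) / a) by field; exact: lt0r_neq0.
  rewrite exprMn mulrCA [leRHS]mulrC ler_wpM2l ?sqr_ge0//.
  have -> : 8 * (be / al) ^+ 2 = 2 * (2 * (be / al)) ^+ 2 by ring.
  rewrite ler_pM2l// ler_sqr ?nnegrE; first last.
  - by rewrite mulr_ge0// divr_ge0; lra.
  - by rewrite divr_ge0; lra.
  have i1 : a^-1 <= al^-1 by rewrite lef_pV2 ?posrE.
  have i2 : 0 < a^-1 by rewrite invr_gt0.
  apply: le_trans (_ : 2 * be * a^-1 <= _); first by rewrite ler_pM2r//; lra.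
  by rewrite -mulrA ler_pM2l// ler_wpM2l//; lra.
pose c := (a + b) / 2.
have [mm Lm hm] := sm.
have a0 : 0 <= a by rewrite (le_trans (ltW al0)).
have AE : A [set x | h x <= c].
  apply/(subalg_measurableE hA); rewrite -[X in measurable X]setTI.
  have mhE : measurable_fun [set: XA] (fun x => (h x)%:E) by exact/measurable_EFinP.
  exact: (emeasurable_fun_infty_c measurableT mhE c%:E).
pose m1 x := (\1_[set x | h x <= c] x)%:C * m x.
pose m2 x := m x - m1 x.
have mE := indic_Acmeasurable (R := R) hA AE.
have mm1 : Acmeasurable m1 by exact: (@cmeasurableM _ XA).
have mm2 : Acmeasurable m2 by exact: (@cmeasurableB _ XA).
have Lm1 : L2 (lift m1).
  have := L2_indic (subalg_measurable hA ((subalg_measurableE hA _).2 AE)) Lm.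
  by congr L2; apply/funext => x; rewrite /m1; ring.
have Lm2 : L2 (lift m2).
  by have := L2B Lm Lm1; congr L2; apply/funext => x; rewrite /m2; ring.
have m12 x : (m1 x = 0 /\ m2 x = m x /\ c <= h x) \/ (m2 x = 0 /\ m1 x = m x /\ h x <= c).
  rewrite /m2 /m1 indicE; case: (boolP (x \in _)) => [/set_mem /= hx|].
    by right; rewrite mul1r subrr.
  by rewrite notin_setE /= => /negP; rewrite -ltNge => /ltW hx; left; rewrite mul0r subr0.
have sm1 : slab a c m1.
  split=> // x; case: (m12 x) => [[-> _]|[_ [-> hc]]]; first by left.
  by case: (hm x) => [->|/andP[ah _]]; [left|right; rewrite ah].
have sm2 : slab c b m2.
  split=> // x; case: (m12 x) => [[_ [-> hc]]|[-> _]]; last by left.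
  by case: (hm x) => [->|/andP[_ hb]]; [left|right; rewrite hb hc].
have c0 : 0 <= c by rewrite /c; lra.
have [v1 Bv1 _] := slab_sqrt a0 sm1; have [v2 Bv2 _] := slab_sqrt c0 sm2.
have i1 : sqnorm _ <= _ := IH a c m1 v1 ala ltac:(by rewrite /c; lra) ltac:(by rewrite /c; lra) sm1 Bv1.
have i2 : sqnorm _ <= _ := IH c b m2 v2 ltac:(by rewrite /c; lra) ltac:(by rewrite /c; lra) bbe sm2 Bv2.
have [_ _ _ _ lin] := lB.
have := lin 1 _ _ _ _ Bv1 Bv2.
have -> : (fun x => 1 * lift m1 x + lift m2 x) = lift m.
  by apply/funext => x; rewrite /m2; ring.
move=> Bv12; have [_ Lv12] := B_L2 Bv12; have [_ Lv] := B_L2 Bv.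
have [_ Lv1] := B_L2 Bv1; have [_ Lv2] := B_L2 Bv2.
have ve := B_fun Bv Bv12.
have [_ Lh1 _] := slab_mul_h a0 sm1; have [_ Lh2 _] := slab_mul_h c0 sm2.
have [_ Lh _] := slab_mul_h a0 sm.
have Lz1 := L2B Lv1 Lh1; have Lz2 := L2B Lv2 Lh2.
rewrite (@sqnorm_ae_congr _ _ _ mu _ (fun x =>
   (v1 x - lift (fun y => (h y)%:C * m1 y) x) + (v2 x - lift (fun y => (h y)%:C * m2 y) x))).
- have orth : sqnorm (lift m) = sqnorm (lift m1) + sqnorm (lift m2).
    have -> : sqnorm (lift m) = sqnorm (fun x => lift m1 x + lift m2 x).
      by apply: f_equal; apply/funext => x; rewrite /m2; ring.
    rewrite (sqnormD Lm1 Lm2) (_ : dot _ _ = 0) ?mulr0 ?addr0//.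
    rewrite /dot (_ : (fun x => _) = cst 0); last first.
      apply/funext => x; case: (m12 x) => [[-> _]|[-> _]]; first by rewrite mulr0 mul0r.
      by rewrite mulr0 rmorph0 mulr0.
    by rewrite /cintegral /= Rintegral_cst// mul0r.
  apply: le_trans (sqnormD_le Lz1 Lz2) _; rewrite orth.
  have e1 : (c - a) ^+ 2 = (b - a) ^+ 2 / 4 by rewrite /c; field.
  have e2 : (b - c) ^+ 2 = (b - a) ^+ 2 / 4 by rewrite /c; field.
  move: i1 i2; rewrite e1 e2 [2 ^+ n.+1]exprS.
  set M := 8 * (be / al) ^+ 2 + 2; set s1 := sqnorm (lift m1); set s2 := sqnorm (lift m2).
  have -> : M * (b - a) ^+ 2 / (2 * 2 ^+ n) * (s1 + s2) =
     2 * (M * ((b - a) ^+ 2 / 4) / 2 ^+ n * s1) + 2 * (M * ((b - a) ^+ 2 / 4) / 2 ^+ n * s2).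
    by field; rewrite expf_neq0.
  by move=> i1 i2; apply: lerD; rewrite ler_pM2l.
- exact: L2_cmeasurable (L2B Lv Lh).
- exact: L2_cmeasurable (L2D Lz1 Lz2).
- by apply: aeS ve => x ->; rewrite /m2; ring.
Qed.


Lemma slab_abs a b m : 0 < a -> a <= b -> slab a b m ->
  B (lift m, lift (fun x => (h x)%:C * m x)).
Proof.
move=> a0 ab sm; have a0' := ltW a0.
have [v Bv _] := slab_sqrt a0' sm; have [_ Lv] := B_L2 Bv.
have [mm Lm hm] := sm; have [_ Lh _] := slab_mul_h a0' sm.
pose K := (8 * (b / a) ^+ 2 + 2) * (b - a) ^+ 2 * sqnorm (lift m).
have le n : sqnorm (fun x => v x - lift (fun y => (h y)%:C * m y) x) * 2 ^+ n <= K.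
  rewrite -ler_pdivlMr ?exprn_gt0// /K mulrAC.
  exact: (slab_bisect n a0 (lexx _) ab (lexx _) sm Bv).
have v0 : sqnorm (fun x => v x - lift (fun y => (h y)%:C * m y) x) = 0.
  apply/eqP; rewrite eq_le sqnorm_ge0 andbT leNgt; apply/negP => pos.
  set z := sqnorm _ in le pos.
  have [n Kn] : exists n : nat, K / z < n%:R.
    by exists (Num.truncn (K / z)).+1; exact: truncnS_gt.
  have := le n; rewrite leNgt => /negP; apply.
  rewrite -ltr_pdivrMl// mulrC; apply: lt_trans Kn _.
  by rewrite -natrX ltr_nat ltn_expl.
have [_ cong _ _ _] := lB; have [Lf _] := B_L2 Bv.
apply: (cong _ _ _ _ Bv Lf Lh); apply/aeTP; first exact: aeW.
by apply: aeS (sqnorm_eq0 (L2B Lv Lh) v0) => x /subr0_eq.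
Qed.

(** If [B y = v] then [B v = B^2 y = 0], so that [<v, v> = <y, B v> = 0]. *)
Lemma abs_kernel y : C (y, cst 0) -> B (y, cst 0).
Proof.
move=> Cy; have C0 : C (cst 0, cst 0) by have [_ _ _] := abs_op_linear hA w su.
have : op_comp C C (y, cst 0) by exists (cst 0); [exact: Cy|exact: C0].
rewrite -BC => -[v /= Byv Bv0]; have [Ly Lv] := B_L2 Byv.
have : dot v v = dot y (cst 0).
  by move: Bv0; rewrite -{1}aB => -[_ _]; exact.
rewrite (dot_self Lv) (_ : dot y (cst 0) = 0); last first.
  rewrite /dot (_ : (fun x => _) = cst 0); last by apply/funext => x; rewrite rmorph0 mulr0.
  by rewrite /cintegral /= Rintegral_cst// mul0r.
move=> /(congr1 (@complex.Re R)) /= v0.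
have [_ cong _ _ _] := lB.
apply: (cong _ _ _ _ Byv Ly (L20 mu)); apply/aeTP; first exact: aeW.
exact: (sqnorm_eq0 Lv v0).
Qed.

(** A vector of the domain is the sum of its residue in the null space and of a function
    [conj u * m]; the latter is the limit of its truncations to the levels of [h], on
    which [slab_abs] applies, and [B] is closed. *)
Lemma abs_op_sub : C `<=` B.
Proof.
move=> [f g] fg; have /MEMP[Lf _ Lg e] := fg.
pose v := EC (fun y => u y * f y).
have mv : Acmeasurable v by exact: measurable_cond_expC.
have [LP _] := proj_bounded hA su wS Lf; rewrite -/v in LP.
pose P x := (s x)%:C * (u x)^* * v x.
have By : B (fun x => f x - P x, cst 0).
  have Ly : L2 (fun x => f x - P x) := L2B Lf LP.
  apply: abs_kernel; apply/(abs_opP hA w su Ly); split; first exact: L20.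
  apply: aeS2 (proj_residue hA su wS Lf) (weights_spec su wS) => x -> sx.
  case: sx => [[a [b [_ _ _ _ [_ -> _ _ _]]]]|[_ _ -> _ _]].
    by rewrite subrr mul0r mulr0.
  by rewrite !mul0r.
pose g' x := (h x)%:C * P x.
have ge : {ae mu, forall x, g x = g' x}.
  apply: aeS2 e (weights_spec su wS) => x -> sx; rewrite /g' /P -/v !mulrA -rmorphM.
  have -> // : h x * s x = k x.
  case: sx => [[a [b [a0 b0 _ _ [_ _ _ _ [-> -> _ ->]]]]]|[_ _ -> -> _]].
    by field; exact: lt0r_neq0.
  by rewrite mul0r.
have mP : cmeasurable P by exact: L2_cmeasurable LP.
have Lg' : L2 g'.
  by apply: L2_ae_congr ge Lg; exact: cmeasurableM (subalg_cmeasurable hA hC) mP.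
have AD n := levelA hA w u n.
have mD n : measurable (level mu A w u n).
  exact: (subalg_sub hA).
pose m n x := (\1_(level mu A w u n) x)%:C * ((s x)%:C * v x).
have mE n : lift (m n) = (fun x => (\1_(level mu A w u n) x)%:C * P x).
  by apply/funext => x; rewrite /m /P; ring.
have sm n : slab n.+1%:R^-1 n.+1%:R (m n).
  split.
  - apply: (@cmeasurableM _ XA _ _ _ (indic_Acmeasurable hA (AD n))).
    exact: (@cmeasurableM _ XA _ _ _ (Acmeasurable_real (measurable_weight_s hA w u)) mv).
  - by rewrite mE; exact: L2_indic (mD n) LP.
  - move=> x; rewrite /m indicE; case: (boolP (x \in _)) => [/set_mem|_]; first by right.
    by left; rewrite mul0r.
have n1 n : n.+1%:R^-1 <= n.+1%:R :> R.
  by rewrite (@le_trans _ _ 1)// ?invf_le1// ler1n.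
have Bm n := slab_abs (ltac:(by rewrite invr_gt0) : 0 < n.+1%:R^-1 :> R) (n1 n) (sm n).
have [_ cong _ _ lin] := lB.
have Bn n := lin 1 _ _ _ _ By (Bm n).
have supp : {ae mu, forall x, P x = 0 \/ exists N, forall n, (N <= n)%N -> level mu A w u n x}.
  apply: aeS2 (level_exhaust su wS) (weights_spec su wS) => x lx.
  case=> [[a [b [_ _ _ _ [Dx _ _ _ _]]]]|[_ _ _ _ [_ s0]]]; first by right; exact: lx.
  by left; rewrite /P s0 !mul0r.
have cP := l2_cvg_indic mD LP supp.
have cg' : l2dist mu (fun x => (\1_(level mu A w u n) x)%:C * g' x) g' @[n --> \oo] --> (0 : R).
  apply: (l2_cvg_indic mD Lg'); apply: aeS supp => x [P0|]; last by right.
  by left; rewrite /g' P0 mulr0.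
suff Bfg' : B (f, g').
  by apply: (cong _ _ _ _ Bfg' Lf Lg); apply/aeTP; [exact: aeW|apply: aeS ge => x ->].
apply: (selfadjoint_closed aB Bn Lf Lg').
- move: cP; apply: cvg_trans; apply: near_eq_cvg; apply: nearW => n.
  by rewrite /l2dist; congr l2norm; apply/funext => x; rewrite /m /P; ring.
- move: cg'; apply: cvg_trans; apply: near_eq_cvg; apply: nearW => n.
  by rewrite /l2dist; congr l2norm; apply/funext => x; rewrite /m /g' /P; ring.
Qed.

Lemma sqrt_unique : B = C.
Proof.
apply/esym; apply: (selfadjoint_sub_eq aB _ abs_op_sub).
exact: (abs_op_selfadjoint hA w su).
Qed.

End square_root_uniqueness.

(** * The partial isometry and its uniqueness *)

Section bounded_operators.
Context {d : measure_display} {X : measurableType d} {R : realType}.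
Variable mu : {measure set X -> \bar R}.
Local Notation L2 := (L2 mu).
Local Notation dot := (dot mu).
Local Notation sqnorm := (sqnorm mu).
Implicit Types (f g : X -> R[i]) (U V T : graph (X := X) (R := R)).

Lemma dot0l f : dot (cst 0) f = 0.
Proof.
rewrite /dot (_ : (fun x => _) = cst 0); last by apply/funext => x; rewrite mul0r.
by rewrite /cintegral /= Rintegral_cst// mul0r.
Qed.

Lemma le_l2norm (c : R) f g : 0 <= c -> sqnorm g <= c ^+ 2 * sqnorm f ->
  l2norm mu g <= c * l2norm mu f.
Proof.
move=> c0 h; rewrite -(@ler_pXn2r _ 2)// ?nnegrE ?mulr_ge0 ?l2norm_ge0//.
by rewrite exprMn !l2norm_sqr.
Qed.

Lemma l2_limit_unique (fs : nat -> X -> R[i]) f g : (forall n, L2 (fs n)) -> L2 f -> L2 g ->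
  l2dist mu (fs n) f @[n --> \oo] --> (0 : R) ->
  l2dist mu (fs n) g @[n --> \oo] --> (0 : R) -> {ae mu, forall x, f x = g x}.
Proof.
move=> Lfs Lf Lg cf cg; have Ld := L2B Lf Lg.
have e := dot_limit Lfs Lfs Lf Lg Ld Ld cf cg (fun n => erefl).
have := dot_self Ld; rewrite {1}(dotBr Lf Lg Ld) e subrr => /(congr1 (@complex.Re R)) /= e0.
by apply: aeS (sqnorm_eq0 Ld (esym e0)) => x /subr0_eq.
Qed.

Lemma bounded_operator_cvg U (fs gs : nat -> X -> R[i]) f g : bounded_operator mu U ->
  (forall n, U (fs n, gs n)) -> U (f, g) ->
  l2dist mu (fs n) f @[n --> \oo] --> (0 : R) ->
  l2dist mu (gs n) g @[n --> \oo] --> (0 : R).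
Proof.
move=> [[_ _ _ _ lin] _ [c cU]] Un Ufg cf.
apply: (@squeeze_cvgr _ _ _ _ (cst 0) (fun n => c * l2dist mu (fs n) f)).
- apply: nearW => n; rewrite sqrtr_ge0/=.
  have := cU _ _ (lin (- 1) _ _ _ _ Ufg (Un n)).
  have e (h1 h2 : X -> R[i]) : (fun x => - 1 * h1 x + h2 x) = (fun x => h2 x - h1 x).
    by apply/funext => x; ring.
  by rewrite !e.
- exact: cvg_cst.
- by rewrite -[X in _ --> X](mulr0 c); exact: cvgZr.
Qed.

Lemma operator_sub_eq U V : linear_operator mu U -> linear_operator mu V ->
  domain U = L2 -> U `<=` V -> V = U.
Proof.
move=> [_ cong _ _ _] [VL _ func _ _] dU UV; apply/seteqP; split=> // -[f g] Vfg.
have [Lf Lg] := VL _ _ Vfg.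
have [g' Ufg'] : domain U f by rewrite dU.
by apply: (cong _ _ _ _ Ufg' Lf Lg _ (func _ _ _ (UV _ Ufg') Vfg)); apply/aeTP; exact: aeW.
Qed.

End bounded_operators.

Section partial_isometry.
Context {d : measure_display} {X : measurableType d} {R : realType}.
Variables (mu : {measure set X -> \bar R}) (A : set (set X)).
Hypothesis hA : sigma_finite_subalgebra mu A.
Local Notation XA := (g_sigma_algebraType A).
Local Notation Re := complex.Re.
Local Notation EC := (cond_expC mu A).
Local Notation Esq f := (cond_exp_sq mu A f%R).
Local Notation "'Acmeasurable' f" := (@cmeasurable _ XA R f) (at level 10).
Local Notation "'Ameasurable' f" := (measurable_fun [set: XA] (f : X -> R)) (at level 10).
Local Notation L2 := (L2 mu).
Local Notation dot := (dot mu).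
Local Notation MEM := (MEM mu A).
Local Notation sqnorm := (sqnorm mu).
Local Notation sq_conditionable := (sq_conditionable mu A).

Variables w u : X -> R[i].
Hypothesis mw : cmeasurable w.
Hypothesis su : sq_conditionable u.
Hypothesis wS : {ae mu, forall x, esupport (Esq u) x -> (Esq w x < +oo)%E}.

Let mu_ : cmeasurable u. Proof. by case: su. Qed.

Local Notation D := (common_support mu A w u).
Local Notation p := (weight_p mu A u).
Local Notation q := (weight_q mu A w).
Local Notation k := (weight_k mu A w u).
Local Notation h := (weight_h mu A w u).
Local Notation r := (weight_r mu A w u).
Local Notation s := (weight_s mu A w u).
Local Notation T := (MEM w u).
Local Notation C := (abs_op mu A w u).
Local Notation U0 := (iso_op mu A w u).
Local Notation cut := (cut_w mu A w u).
Local Notation lev := (level mu A w u).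
Local Notation v f := (EC (fun y => u y * f y)).
Local Notation P f := (fun x => (s x)%:C * (u x)^* * v f x).

Let mrw : cmeasurable (fun x => (r x)%:C * w x).
Proof.
apply: cmeasurableM mw; apply: (subalg_cmeasurable hA).
exact: (Acmeasurable_real (measurable_weight_r hA w u)).
Qed.

Let mv f : Acmeasurable (v f). Proof. exact: measurable_cond_expC. Qed.

Let spec := weights_spec su wS.

(** If [w * v = 0], where [v = E (u f)], then the projection [s conj u * v] vanishes
    too, by [iso_sqnorm]; multiplying it by [u] and averaging gives back [v] on the
    common support. *)
Lemma null_spaceP f : null_space T f <-> L2 f /\ {ae mu, forall x, (\1_D x)%:C * v f x = 0}.
Proof.
split=> [Tf|[Lf e]]; last first.
  apply/(cut_opP hA mw su Lf); split; first exact: L20.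
  by apply: aeS e => x e; rewrite /cut_w mulrAC e mul0r.
have /MEMP[Lf _ _ _] := Tf; split; first exact: Lf.
have [_ e] := (cut_opP hA mw su Lf _).1 Tf.
have [LP _] := proj_bounded hA su wS Lf; have [LU _] := iso_bounded hA mw su wS Lf.
have U0e : {ae mu, forall x, (r x)%:C * w x * v f x = 0}.
  apply: aeS2 e spec => x /esym ex sx.
  have -> : (r x)%:C = (r x)%:C * (\1_D x)%:C :> R[i].
    by case: sx => [[a [b [_ _ _ _ [_ -> _ _ _]]]]|[_ -> _ _ [-> _]]]; rewrite ?mulr1 ?mul0r.
  by rewrite -!mulrA; move: ex; rewrite /cut_w -mulrA => ->; rewrite mulr0.
have P0 : {ae mu, forall x, P f x = 0}.
  apply: (sqnorm_eq0 LP); rewrite -(iso_sqnorm hA mw su wS Lf).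
  by rewrite (sqnorm_ae_congr (L2_cmeasurable LU) (cmeasurable_cst 0) U0e) sqnorm0.
have m0 : Acmeasurable (fun _ : XA => 0 : R[i]) by exact: cmeasurable_cst.
have cf := sq_conditionableM hA su (L2_sq_conditionable hA Lf).
have m1 := cmeasurableM mu_ (L2_cmeasurable LP).
have m2 := cmeasurableM (subalg_cmeasurable hA m0) cf.1.
have e1 : {ae mu, forall x, u x * P f x = 0 * (u x * f x)}.
  by apply: aeS P0 => x ->; rewrite mulr0 mul0r.
have := cond_expC_lift hA su (measurable_weight_s hA w u) (mv f).
rewrite (cond_expC_ae_congr hA m1 m2 e1) => e2.
apply: aeS3 e2 (cond_expCM hA m0 cf) spec => x e3 e4 sx.
have -> : \1_D x = s x * p x.
  case: sx => [[a [b [a0 b0 _ _ [_ -> -> _ [_ _ _ ->]]]]]|[_ -> _ _ [_ ->]]].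
    by field; exact: lt0r_neq0.
  by rewrite mul0r.
by rewrite -e3 e4 mul0r.
Qed.

Lemma null_space_iso : null_space U0 = null_space T.
Proof.
apply/seteqP; split=> f.
  move=> Uf; have /MEMP[Lf _ _ _] := Uf; have [_ e] := (iso_opP hA w su Lf _).1 Uf.
  apply/(cut_opP hA mw su Lf); split; first exact: L20.
  apply: aeS2 e spec => x ex sx.
  have -> : cut x = (h x)%:C * ((r x)%:C * w x).
    rewrite /cut_w mulrA -rmorphM; congr (_%:C * _).
    case: sx => [[a [b [a0 b0 _ _ [_ -> _ _ [_ -> -> _]]]]]|[_ -> _ -> _]].
      by field; rewrite !lt0r_neq0.
    by rewrite mul0r.
  by rewrite -mulrA -ex mulr0.
move=> /null_spaceP[Lf e]; apply/(iso_opP hA w su Lf); split; first exact: L20.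
apply: aeS2 e spec => x ex [[a [b [_ _ _ _ [_ e1 _ _ _]]]]|[_ _ _ _ [-> _]]].
  by move: ex; rewrite e1 mul1r => ->; rewrite mulr0.
by rewrite !mul0r.
Qed.

Lemma residue_null f : L2 f -> null_space T (fun x => f x - P f x).
Proof.
move=> Lf; have [LP _] := proj_bounded hA su wS Lf.
apply/null_spaceP; split; first exact: L2B Lf LP.
apply: aeS2 (proj_residue hA su wS Lf) spec => x -> sx.
rewrite mulrA -rmorphM (_ : \1_D x * (1 - \1_D x) = 0) ?mul0r//.
by case: sx => [[a [b [_ _ _ _ [_ -> _ _ _]]]]|[_ -> _ _ _]]; rewrite ?subrr ?mulr0 ?mul0r.
Qed.

(** The projection is self-adjoint and kills the null space. *)
Lemma dot_null_proj y f : null_space T y -> L2 f -> dot y (P f) = 0.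
Proof.
move=> /null_spaceP[Ly e] Lf; have [LP _] := proj_bounded hA su wS Lf.
have aP := MEM_real_selfadjoint hA su (measurable_weight_s hA w u).
have : proj_op mu A w u (f, P f) by apply/(proj_opP hA w su Lf); split; [exact: LP|exact: aeW].
rewrite /proj_op -aP => -[_ _ H].
have Py : proj_op mu A w u (y, cst 0).
  apply/(proj_opP hA w su Ly); split; first exact: L20.
  apply: aeS2 e spec => x ex [[a [b [_ _ _ _ [_ e1 _ _ _]]]]|[_ _ _ _ [_ ->]]].
    by move: ex; rewrite e1 mul1r => ->; rewrite mulr0.
  by rewrite !mul0r.
by have := H _ _ Py; rewrite dot0l.
Qed.

Lemma proj_perp f : L2 f -> orthogonal_complement mu (null_space T) (P f).
Proof.
move=> Lf; have [LP _] := proj_bounded hA su wS Lf.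
by split; [exact: LP|move=> y yN; exact: dot_null_proj].
Qed.

(** The residue [f - P f] lies in the null space, so it is orthogonal to both [f] and [P
    f]. *)
Lemma perp_proj f : orthogonal_complement mu (null_space T) f ->
  {ae mu, forall x, f x = P f x}.
Proof.
move=> [Lf H]; have [LP _] := proj_bounded hA su wS Lf; have Ld := L2B Lf LP.
have Nd := residue_null Lf.
have := dot_self Ld; rewrite {1}(dotBr Lf LP Ld) (H _ Nd) (dot_null_proj Nd Lf) subrr.
move=> /(congr1 (@complex.Re R)) /= e0.
by apply: aeS (sqnorm_eq0 Ld (esym e0)) => x /subr0_eq.
Qed.

Lemma iso_bounded_operator : bounded_operator mu U0.
Proof.
split; first exact: (MEM_linear hA mrw mu_).
- apply/seteqP; split => [f [g /MEMP[]//]|f Lf].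
  have [LU _] := iso_bounded hA mw su wS Lf.
  by eexists; apply/(iso_opP hA w su Lf); split; [exact: LU|exact: aeW].
- exists 2 => f g fg; have /MEMP[Lf _ Lg _] := fg.
  have [_ e] := (iso_opP hA w su Lf _).1 fg.
  have [LU le] := iso_bounded hA mw su wS Lf.
  apply: le_l2norm => //; rewrite (sqnorm_ae_congr (L2_cmeasurable Lg) (L2_cmeasurable LU) e).
  by rewrite (_ : 2 ^+ 2 = 4)//; ring.
Qed.

Lemma iso_partial_isometry : partial_isometry mu U0.
Proof.
split; first exact: iso_bounded_operator.
move=> f g; rewrite /initial_space null_space_iso => fN fg.
have [Lf _] := fN; have [Lg e] := (iso_opP hA w su Lf _).1 fg.
have [LP _] := proj_bounded hA su wS Lf; have [LU _] := iso_bounded hA mw su wS Lf.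
rewrite /l2norm -!/(sqnorm _).
rewrite (sqnorm_ae_congr (L2_cmeasurable Lg) (L2_cmeasurable LU) e) (iso_sqnorm hA mw su wS Lf).
by rewrite -(sqnorm_ae_congr (L2_cmeasurable Lf) (L2_cmeasurable LP) (perp_proj fN)).
Qed.

(** The truncation of [r * P f] to a level of [h] is square integrable, because [r = 1 /
    h] is bounded there, and it is sent to the truncations of [P f] and of the isometric
    image by the modulus and by the operator itself. *)
Lemma level_preimage n f : L2 f -> exists f',
  C (f', fun x => (\1_(lev n) x)%:C * P f x) /\
  T (f', fun x => (\1_(lev n) x)%:C * ((r x)%:C * w x * v f x)).
Proof.
move=> Lf; have [LP _] := proj_bounded hA su wS Lf; have [LU _] := iso_bounded hA mw su wS Lf.
pose t x := \1_(lev n) x * (r x * s x).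
have AD := levelA hA w u n.
have mD : measurable (lev n) by exact: (subalg_sub hA).
have mt : Ameasurable t.
  apply: (@measurable_funM _ XA).
    by apply: (@measurable_indic _ XA); exact/(subalg_measurableE hA).
  exact: (@measurable_funM _ XA _ _ _ _ (measurable_weight_r hA w u) (measurable_weight_s hA w u)).
have mtX := subalg_cmeasurable hA (Acmeasurable_real mt).
pose f' x := (t x)%:C * (u x)^* * v f x.
have Lf' : L2 f'.
  apply: (@L2_le _ _ _ _ (n.+1%:R ^+ 2) _ (P f) _ LP).
    by apply: cmeasurableM (subalg_cmeasurable hA (mv f)); exact: cmeasurableM mtX (cmeasurable_conj mu_).
  apply: aeS spec => x sx; rewrite /cmod.
  have -> : f' x = (\1_(lev n) x * r x)%:C * P f x by rewrite /f' /t !rmorphM; ring.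
  rewrite normcM' exprMn ler_wpM2r ?sqr_ge0// normc_real real_normK ?num_real// indicE.
  case: (boolP (x \in lev n)) => [/set_mem /andP[l1 _]|_]; last by rewrite mul0r expr0n sqr_ge0.
  case: sx => [[a [b [a0 b0 _ _ [_ _ _ _ [_ hE -> _]]]]]|[_ _ _ _ [-> _]]]; last first.
    by rewrite mulr0 expr0n sqr_ge0.
  have ab0 : 0 < a * b by rewrite mulr_gt0.
  rewrite mul1r ler_sqr ?nnegrE ?invr_ge0 ?(ltW ab0)//.
  by rewrite -[leRHS]invrK lef_pV2 ?posrE ?invr_gt0// -hE.
have e0 := cond_expC_lift hA su mt (mv f).
exists f'; split.
  apply/(abs_opP hA w su Lf'); split; first exact: (L2_indic mD LP).
  apply: aeS2 e0 spec => x -> sx; rewrite /t.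
  have -> : \1_(lev n) x * (r x * s x) * p x = \1_(lev n) x * (r x * (s x * p x)) by ring.
  have e1 : s x = k x * (r x * (s x * p x)).
    case: sx => [[a [b [a0 b0 _ _ [_ _ -> _ [-> _ -> ->]]]]]|[_ _ -> _ [_ ->]]].
      by field; rewrite !lt0r_neq0.
    by rewrite mul0r.
  by rewrite {1}e1 !rmorphM; ring.
apply/(cut_opP hA mw su Lf'); split; first exact: (L2_indic mD LU).
apply: aeS2 e0 spec => x -> sx; rewrite /t /cut_w.
have e1 : r x = \1_D x * (r x * (s x * p x)).
  case: sx => [[a [b [a0 b0 _ _ [_ -> -> _ [_ _ -> ->]]]]]|[_ -> _ _ [-> _]]].
    by field; rewrite !lt0r_neq0.
  by rewrite mul0r.
by rewrite {1}e1 !rmorphM; ring.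
Qed.

Let level_cvg f : L2 f -> {ae mu, forall x, ~ D x -> f x = 0} ->
  l2dist mu (fun x => (\1_(lev n) x)%:C * f x) f @[n --> \oo] --> (0 : R).
Proof.
move=> Lf f0; apply: l2_cvg_indic => [n|//|].
  by apply: (subalg_measurable hA); apply/(subalg_measurableE hA); exact: levelA.
by apply: aeS2 f0 (level_exhaust su wS) => x fx lx; have [/lx|/fx] := pselect (D x); [right|left].
Qed.

Lemma iso_range_sub : range_of U0 `<=` l2closure mu (range_of T).
Proof.
move=> g [f fg]; have /MEMP[Lf _ _ _] := fg; have [Lg e] := (iso_opP hA w su Lf _).1 fg.
have [LU _] := iso_bounded hA mw su wS Lf.
split; first exact: Lg.
move=> eps eps0.
have supp : {ae mu, forall x, ~ D x -> (r x)%:C * w x * v f x = 0}.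
  apply: aeS spec => x [[a [b [_ _ _ _ [Dx _ _ _ _]]]]|[_ _ _ _ [-> _]]] nD; first by [].
  by rewrite !mul0r.
have c := level_cvg LU supp.
have [_ cl] := l2closure_of_seq (V := range_of T) LU
  (fun n => let: ex_intro f' (conj _ Tf') := level_preimage n Lf in ex_intro _ f' Tf') c.
have [g' Vg' dg'] := cl _ eps0; exists g' => //.
rewrite (_ : l2dist mu g g' = l2dist mu (fun x => (r x)%:C * w x * v f x) g')//.
rewrite /l2dist /l2norm -!/(sqnorm _); congr Num.sqrt.
have Lg' : L2 g' by case: Vg' => f' /MEMP[].
apply: sqnorm_ae_congr; [exact: L2_cmeasurable (L2B Lg Lg')|exact: L2_cmeasurable (L2B LU Lg')|].
by apply: aeS e => x ->.
Qed.

Local Notation V0 := (MEM (fun x => (u x)^*) (fun x => (r x)%:C * (cut x)^*)).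

Let sb : sq_conditionable (fun x => (r x)%:C * (cut x)^*).
Proof.
exact: (sq_conditionable_mul hA (Acmeasurable_real (measurable_weight_r hA w u))
  (sq_conditionable_conj (sq_cut_w hA mw su wS))).
Qed.

Let coisoP f g : L2 f -> (V0 (f, g) <-> L2 g /\
  {ae mu, forall x, g x = (u x)^* * EC (fun y => (r y)%:C * (cut y)^* * f y) x}).
Proof.
move=> Lf; have c := sq_conditionableM hA sb (L2_sq_conditionable hA Lf).
by split=> [/MEMP[]//|[Lg e]]; apply/MEMP; split; [exact: Lf|exact: c|exact: Lg|exact: e].
Qed.

Lemma coiso_bounded_operator : bounded_operator mu V0.
Proof.
split; first exact: (MEM_linear hA (cmeasurable_conj mu_) sb.1).
- apply/seteqP; split => [f [g /MEMP[]//]|f Lf].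
  have [LU _] := coiso_bounded hA mw su wS Lf.
  by eexists; apply/(coisoP _ Lf); split; [exact: LU|exact: aeW].
- exists 2 => f g fg; have /MEMP[Lf _ Lg _] := fg.
  have [_ e] := (coisoP _ Lf).1 fg.
  have [LU le] := coiso_bounded hA mw su wS Lf.
  apply: le_l2norm => //; rewrite (sqnorm_ae_congr (L2_cmeasurable Lg) (L2_cmeasurable LU) e).
  by rewrite (_ : 2 ^+ 2 = 4)//; ring.
Qed.

(** On the common support [r * q = k]. *)
Lemma coiso_abs f c g : C (f, c) -> T (f, g) -> V0 (g, c).
Proof.
move=> fc fg; have /MEMP[Lf _ _ _] := fg.
have [Lg eg] := (cut_opP hA mw su Lf _).1 fg; have [Lc ec] := (abs_opP hA w su Lf _).1 fc.
have sc := sq_cut_w hA mw su wS.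
apply/(coisoP _ Lg); split; first exact: Lc.
have cc := sq_conditionableM hA (sq_conditionable_conj sc) sc.
have mr := Acmeasurable_real (measurable_weight_r hA w u).
have mrv : Acmeasurable (fun x => (r x)%:C * v f x) by exact: (@cmeasurableM _ XA).
have e1 : {ae mu, forall x, (r x)%:C * (cut x)^* * g x = (r x)%:C * v f x * ((cut x)^* * cut x)}.
  by apply: aeS eg => x ->; ring.
have m1 := cmeasurableM sb.1 (L2_cmeasurable Lg).
have m2 := cmeasurableM (subalg_cmeasurable hA mrv) cc.1.
rewrite (cond_expC_ae_congr hA m1 m2 e1).
apply: aeS4 ec (cond_expCM hA mrv cc) (cond_expC_cut_w hA mw su wS) spec => x -> -> -> sx.
have -> : k x = r x * (\1_D x * q x).
  case: sx => [[a [b [a0 b0 _ _ [_ -> _ -> [-> _ -> _]]]]]|[_ -> -> _ _]].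
    by field; rewrite !lt0r_neq0.
  by rewrite mul0r mulr0.
by rewrite !rmorphM; ring.
Qed.

(** The bounded operator [V0] recovers the modulus from the operator ([coiso_abs]), so
    [iso_op] composed with [V0] is the identity on the range of the operator and, by
    continuity, on its closure. *)
Lemma iso_range : range_of U0 = l2closure mu (range_of T).
Proof.
apply/seteqP; split; first exact: iso_range_sub.
move=> g gT; have [Lg _] := gT; have [gs [Tgs cgs]] := l2closure_seq gT.
have [zU domU _] := coiso_bounded_operator.
have [z Vz] : domain V0 g by rewrite domU.
have Lz : L2 z by have /MEMP[] := Vz.
have [lU domU0 _] := iso_bounded_operator.
have [y Uzy] : domain U0 z by rewrite domU0.
have H n : exists c, V0 (gs n, c) /\ U0 (c, gs n).
  have [f fg] := Tgs n; have := fg; rewrite (MEM_eq_iso_abs hA mw su wS) => -[c fc cg].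
  by exists c; split; [exact: coiso_abs fc fg|exact: cg].
have {H}[cs csP] := choice H.
have ccs := bounded_operator_cvg coiso_bounded_operator (fun n => (csP n).1) Vz cgs.
have cgs' := bounded_operator_cvg iso_bounded_operator (fun n => (csP n).2) Uzy ccs.
have Lgs n : L2 (gs n) by have [f /MEMP[]] := Tgs n.
have Ly : L2 y by have /MEMP[] := Uzy.
have e := l2_limit_unique Lgs Ly Lg cgs' cgs.
exists z; have [_ cong _ _ _] := lU.
by apply: (cong _ _ _ _ Uzy Lz Lg); apply/aeTP; [exact: aeW|exact: e].
Qed.

(** On the range of [P], [U] is determined by continuity from [T = U C]. For [y] in the
    null space of [T], [U y] lies in the common range, so [U y = U (P z)] for some [z];
    then [y - P z] is in the null space of [U], hence orthogonal to [P z], as [y] is. So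
    [P z = 0] and [U y = 0]. *)
Lemma iso_unique U : bounded_operator mu U ->
  initial_space mu U = orthogonal_complement mu (null_space T) ->
  range_of U = l2closure mu (range_of T) -> T = op_comp U C -> U = U0.
Proof.
move=> bU iU rU TU; have [lU dU _] := bU; have [lU0 dU0 _] := iso_bounded_operator.
have [UL Ucong Ufun U00 Ulin] := lU; have [U0L U0cong U0fun U000 U0lin] := lU0.
have onP f g : L2 f -> U0 (f, g) -> U (P f, g).
  move=> Lf fg; have [LP _] := proj_bounded hA su wS Lf.
  have [LU _] := iso_bounded hA mw su wS Lf.
  have [Lg eg] := (iso_opP hA w su Lf _).1 fg.
  have [y UPy] : domain U (P f) by rewrite dU.
  have [_ Ly] := UL _ _ UPy.
  have Un n : U (fun x => (\1_(lev n) x)%:C * P f x,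
                 fun x => (\1_(lev n) x)%:C * ((r x)%:C * w x * v f x)).
    have [f' [Cf' Tf']] := level_preimage n Lf.
    have [_ _ Cfun _ _] := abs_op_linear hA w su.
    have := Tf'; rewrite TU => -[c f'c Uc].
    have ec := Cfun _ _ _ f'c Cf'.
    have [_ Lc'] : L2 f' /\ L2 (fun x => (\1_(lev n) x)%:C * P f x).
      by have /MEMP[? _ ? _] := Cf'.
    have [_ Lt'] := UL _ _ Uc.
    by apply: (Ucong _ _ _ _ Uc Lc' Lt' ec); apply/aeTP; exact: aeW.
  have c1 : l2dist mu (fun x => (\1_(lev n) x)%:C * P f x) (P f) @[n --> \oo] --> (0 : R).
    apply: (level_cvg LP).
    apply: aeS spec => x [[a [b [_ _ _ _ [Dx _ _ _ _]]]]|[_ _ _ _ [_ ->]]] nD; first by [].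
    by rewrite !mul0r.
  have c2 : l2dist mu (fun x => (\1_(lev n) x)%:C * ((r x)%:C * w x * v f x))
     (fun x => (r x)%:C * w x * v f x) @[n --> \oo] --> (0 : R).
    apply: (level_cvg LU).
    apply: aeS spec => x [[a [b [_ _ _ _ [Dx _ _ _ _]]]]|[_ _ _ _ [-> _]]] nD; first by [].
    by rewrite !mul0r.
  have c3 := bounded_operator_cvg bU Un UPy c1.
  have Ln n := (UL _ _ (Un n)).2.
  have ey := l2_limit_unique Ln Ly LU c3 c2.
  apply: (Ucong _ _ _ _ UPy LP Lg); apply/aeTP; first exact: aeW.
  by apply: aeS2 ey eg => x -> ->.
(* [U y] has a preimage orthogonal to the null space of [U]; it turns out to be 0 *)
have onN y : null_space T y -> U (y, cst 0).
  move=> yN; have /null_spaceP[Ly _] := yN.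
  have [z Uyz] : domain U y by rewrite dU.
  have [_ Lz] := UL _ _ Uyz.
  have : range_of U z by exists y.
  rewrite rU -iso_range => -[x0 Ux0z]; have [Lx0 _] := U0L _ _ Ux0z.
  have UPz := onP _ _ Lx0 Ux0z.
  have [LP _] := proj_bounded hA su wS Lx0.
  have Nd : null_space U (fun x => y x - P x0 x).
    have := Ulin (- 1) _ _ _ _ UPz Uyz.
    rewrite /null_space /=; congr (U (_, _)); apply/funext => x; last by rewrite mulN1r addNr.
    by ring.
  have : initial_space mu U (P x0) by rewrite iU; exact: proj_perp.
  case=> _ /(_ _ Nd); rewrite (dotBl Ly LP LP) (dot_null_proj yN Lx0) sub0r (dot_self LP).
  move=> /eqP; rewrite oppr_eq0 => /eqP /(congr1 (@complex.Re R)) /= P0.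
  have PP := sqnorm_eq0 LP P0.
  have U0z : U (cst 0, z).
    apply: (Ucong _ _ _ _ UPz (L20 mu) Lz); apply/aeTP; first exact: PP.
    exact: aeW.
  have z0 := Ufun _ _ _ U0z U00.
  by apply: (Ucong _ _ _ _ Uyz Ly (L20 mu) _ z0); apply/aeTP; exact: aeW.
apply: (operator_sub_eq lU0 lU dU0) => -[f g] fg.
have [Lf Lg] := U0L _ _ fg; have [LP _] := proj_bounded hA su wS Lf.
have := Ulin 1 _ _ _ _ (onP _ _ Lf fg) (onN _ (residue_null Lf)).
congr (U (_, _)); apply/funext => x; first by ring.
by rewrite mul1r addr0.
Qed.

End partial_isometry.

(** * The polar decomposition *)

(** Both hypotheses on the operator are spent here, on making the two conditional second
    moments finite. *)
Lemma polar_setting (d : measure_display) (X : measurableType d) (R : realType)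
    (mu : {measure set X -> \bar R}) (A : set (set X)) (hA : sigma_finite_subalgebra mu A)
    (w u : X -> R[i]) : conditionable mu A w -> conditionable mu A u ->
  l2dense mu (domain (MEM mu A w u)) -> closed_operator mu (MEM mu A w u) ->
  [/\ cmeasurable w, sq_conditionable mu A u &
      {ae mu, forall x, esupport (cond_exp_sq mu A u) x -> (cond_exp_sq mu A w x < +oo)%E}].
Proof.
move=> [mw _] cu dT cT; have su := closed_MEM_sq_conditionable hA cu cT.
by split; [exact: mw|exact: su|exact: (dense_MEM_finite hA mw su dT)].
Qed.

Theorem theorem2p8 (d : measure_display) (X : measurableType d) (R : realType)
    (mu : {measure set X -> \bar R}) (hmu : sigma_finite setT mu)
    (A : set (set X)) (hA : sigma_finite_subalgebra mu A)
    (w u : X -> R[i]) (hw : conditionable mu A w) (hu : conditionable mu A u)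
    (hdense : l2dense mu (domain (MEM mu A w u))) :
  let T := MEM mu A w u in
  let u' := modulus_weight mu A w u in
  let w' := isometry_weight mu A w u in
  let S := esupport (cond_exp_sq mu A u) in
  let G := esupport (cond_exp_sq mu A w) in
  (forall U absT : graph, polar_decomposition mu T U absT ->
    [/\ absT = MEM mu A u' u,
        U = MEM mu A w' u,
        cmeasurable w' &
        {ae mu, forall x, (S `&` G) x ->
          (0 < cond_exp_sq mu A w x * cond_exp_sq mu A u x < +oo)%E}]) /\
  (closed_operator mu T ->
    polar_decomposition mu T (MEM mu A w' u) (MEM mu A u' u)).
Proof.
move=> T u' w' S G.
have ops : closed_operator mu T -> MEM mu A u' u = abs_op mu A w u /\
    MEM mu A w' u = iso_op mu A w u.
  move=> cT; have [mw su wS] := polar_setting hA hw hu hdense cT; split.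
    exact: MEM_ae_weight (modulus_weightE su wS).
  exact: MEM_ae_weight (isometry_weightE su wS).
split.
  move=> U absT [_ cT [lB [_ aB] pB BB] [[bU _] iU rU] TU].
  have [mw su wS] := polar_setting hA hw hu hdense cT.
  have [-> ->] := ops cT.
  have Babs : absT = abs_op mu A w u.
    apply: (sqrt_unique hA su wS lB aB pB).
    by rewrite (abs_op_comp hA mw su wS); exact: BB.
  split; [exact: Babs| |exact: (cmeasurable_isometry_weight hA u mw)|].
    by apply: (iso_unique hA mw su wS bU iU rU); rewrite -Babs; exact: TU.
  apply: aeS (weights_spec su wS) => x sx SGx.
  case: sx => [[a [b [a0 b0 -> -> _]]]|[nD _ _ _ _]]; last by [].
  by rewrite -EFinM lte_fin ltry andbT mulr_gt0 ?exprn_gt0.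
move=> cT; have [mw su wS] := polar_setting hA hw hu hdense cT.
have [-> ->] := ops cT; split.
- by split; [exact: (MEM_linear hA mw su.1)|exact: hdense].
- exact: cT.
- exact: (abs_op_is_modulus hA mw su wS hdense).
- split; [exact: (iso_partial_isometry hA mw su wS)| |exact: (iso_range hA mw su wS)].
  by rewrite /initial_space (null_space_iso hA mw su wS).
- exact: (MEM_eq_iso_abs hA mw su wS).
Qed.
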